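(* Let $|\nu|\le\frac12$, $0\le\alpha<1$ and $\beta\ge0$. Then the radius of $\beta$-uniform convexity of order $\alpha$, $r_{u_\nu}^{\beta-uc(\alpha)}$, of the function $u_\nu$ is the smallest positive root $r$ of the equation $$(1-\alpha)+(1+\beta)\left(\frac{r\,\mathbf{H}_\nu''(r)}{\mathbf{H}_\nu'(r)}+\left(\frac{1}{\nu+1}-1\right)\frac{r\,\mathbf{H}_\nu'(r)}{\mathbf{H}_\nu(r)}\right)=0.$$ Moreover, $r_{u_\nu}^{\beta-uc(\alpha)}<r_{u_\nu}^{c}<h_{\nu,1}'<h_{\nu,1}$, where $h_{\nu,1}$ and $h_{\nu,1}'$ denote the first positive zeros of $\mathbf{H}_\nu$ and $\mathbf{H}_\nu'$, respectively, and $r_{u_\nu}^{c}$ is the radius of convexity of $u_\nu$.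
   Context: Primes on functions denote derivatives. The Struve function of the first kind is $$\mathbf{H}_\nu(z)=\frac{\left(\frac z2\right)^{\nu+1}}{\sqrt{\frac{\pi}{4}}\,\Gamma\left(\nu+\frac32\right)}\,{}_1F_2\left(1;\tfrac32,\nu+\tfrac32;-\tfrac{z^2}{4}\right).$$ The normalized function is $u_\nu(z)=\left(\sqrt\pi\,2^\nu\,\Gamma\left(\nu+\frac32\right)\mathbf{H}_\nu(z)\right)^{\frac{1}{\nu+1}}$, understood as $u_\nu(z)=z\left[{}_1F_2\left(1;\frac32,\nu+\frac32;-\frac{z^2}{4}\right)\right]^{1/(\nu+1)}$ with the branch of the power equal to $1$ at $z=0$; it is analytic near $0$ with $u_\nu(z)=z+\cdots$. For $f(z)=z+\sum_{n\ge2}a_nz^n$ with radius of convergence $r_f\in(0,\infty]$ and $U(r)=\{z\in\mathbb{C}:|z|<r\}$, the radius of convexity is $$r_f^{c}=\sup\left\{r\in(0,r_f):\Re\left(1+\frac{zf''(z)}{f'(z)}\right)>0,\ z\in U(r)\right\},$$ and for $\beta\ge0$, $\alpha\in[0,1)$ the radius of $\beta$-uniform convexity of order $\alpha$ is $$r_f^{\beta-uc(\alpha)}=\sup\left\{r\in(0,r_f):\Re\left(1+\frac{zf''(z)}{f'(z)}\right)>\beta\left|\frac{zf''(z)}{f'(z)}\right|+\alpha,\ z\in U(r)\right\}.$$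
   Formalization: The strict inequality between the radius of β-uniform convexity of order α and the radius of convexity is claimed only when (α,β) ≠ (0,0); for α = β = 0 the two radii coincide by definition, so only ≤ is claimed there. *)

(* Defs.v *)
From Stdlib Require Export Reals Factorial.
From Coquelicot Require Export Coquelicot.
Open Scope R_scope.

(** * Gamma and the hypergeometric series 1F2 *)

Definition Gamma (x : R) : R :=
  RInt_gen (fun t => Rpower t (x - 1) * exp (- t))
           (at_right 0) (Rbar_locally p_infty).

Fixpoint pochhammer (a : R) (n : nat) : R :=
  match n with
  | O => 1
  | S m => pochhammer a m * (a + INR m)
  end.

Definition coef_1F2 (a b c : R) (n : nat) : R :=
  pochhammer a n / (pochhammer b n * pochhammer c n * INR (fact n)).

Definition hyp1F2 (a b c x : R) : R := PSeries (coef_1F2 a b c) x.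

Definition CPSeries (a : nat -> C) (z : C) : C :=
  (Series (fun n => Re (a n * z ^ n)%C), Series (fun n => Im (a n * z ^ n)%C)).

Definition Chyp1F2 (a b c : R) (z : C) : C :=
  CPSeries (fun n => RtoC (coef_1F2 a b c n)) z.

(** * Principal branch of complex powers *)

(* The real exponential, sine and cosine give exp (x + i y). *)
Definition Cexp (z : C) : C :=
  (exp (Re z) * cos (Im z), exp (Re z) * sin (Im z)).

(* Principal value, in (-PI, PI], for z <> 0. *)
Definition Carg (z : C) : R :=
  let x := Re z in
  let y := Im z in
  if Rlt_dec 0 x then atan (y / x)
  else if Rlt_dec 0 y then PI / 2 - atan (x / y)
  else if Rlt_dec y 0 then - (PI / 2) - atan (x / y)
  else PI.

Definition Clog (z : C) : C := (ln (Cmod z), Carg z).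

Definition Cpower (z : C) (p : R) : C := Cexp (RtoC p * Clog z)%C.

(** * The Struve function and its normalization *)

(* Meant for x > 0, where (x/2)^(nu+1) is an ordinary real power. *)
Definition struve (nu x : R) : R :=
  Rpower (x / 2) (nu + 1) / (sqrt (PI / 4) * Gamma (nu + 3 / 2))
  * hyp1F2 1 (3 / 2) (nu + 3 / 2) (- (x ^ 2 / 4)).

(* The 1F2 factor is 1 at z = 0, so near 0 the principal power is the branch
   equal to 1 there.  Away from 0 the principal power may jump across a cut;
   the radii below only use the germ of this function at 0. *)
Definition u (nu : R) (z : C) : C :=
  (z * Cpower (Chyp1F2 1 (3 / 2) (nu + 3 / 2) (- (z ^ 2 / RtoC 4)))
              (1 / (nu + 1)))%C.

(** * Radii of convexity *)

Fixpoint C_derive_n (f : C -> C) (n : nat) : C -> C :=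
  match n with
  | O => f
  | S m => C_derive (C_derive_n f m)
  end.

Definition taylor (f : C -> C) (n : nat) : C :=
  (C_derive_n f n (RtoC 0) / RtoC (INR (fact n)))%C.

(* A complex power series converges absolutely inside its disc of convergence,
   so its radius is that of the real series of moduli. *)
Definition taylor_radius (f : C -> C) : Rbar :=
  CV_radius (fun n => Cmod (taylor f n)).

(* The analytic function on the disc of convergence having the germ of f at 0. *)
Definition taylor_sum (f : C -> C) : C -> C := CPSeries (taylor f).

Definition zf''_f' (f : C -> C) (z : C) : C :=
  (z * C_derive_n f 2 z / C_derive f z)%C.

(* As division by 0 is total, f' <> 0 is required explicitly. *)
Definition convexity_radius (f : C -> C) : Rbar :=
  Lub_Rbar (fun r =>
    0 < r /\ Rbar_lt r (taylor_radius f) /\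
    forall z : C, Cmod z < r ->
      C_derive (taylor_sum f) z <> RtoC 0 /\
      Re (RtoC 1 + zf''_f' (taylor_sum f) z)%C > 0).

Definition uniform_convexity_radius (beta alpha : R) (f : C -> C) : Rbar :=
  Lub_Rbar (fun r =>
    0 < r /\ Rbar_lt r (taylor_radius f) /\
    forall z : C, Cmod z < r ->
      C_derive (taylor_sum f) z <> RtoC 0 /\
      Re (RtoC 1 + zf''_f' (taylor_sum f) z)%C
        > beta * Cmod (zf''_f' (taylor_sum f) z) + alpha).

(** * Positive zeros and the equation *)

Definition is_smallest_positive (P : R -> Prop) (r : R) : Prop :=
  0 < r /\ P r /\ forall s, 0 < s -> P s -> r <= s.

(* A root must be a point where both quotients are meaningful. *)
Definition uc_equation (nu alpha beta r : R) : Prop :=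
  struve nu r <> 0 /\ Derive (struve nu) r <> 0 /\
  (1 - alpha)
  + (1 + beta)
    * (r * Derive_n (struve nu) 2 r / Derive (struve nu) r
       + (1 / (nu + 1) - 1) * (r * Derive (struve nu) r / struve nu r))
  = 0.

(* Main.v *)
Require Import Defs.
From Stdlib Require Import Reals Lra Lia Ranalysis5 IndefiniteDescription.
From Coquelicot Require Import Coquelicot.
Open Scope R_scope.

(** Write w = z^2. Up to a factor z^(nu+1) the Struve function is the entire
    function phi(w) = sum b_m w^m, with b_m = struve_coef nu m, and
    u = z phi(z^2)^kappa with kappa = 1/(nu+1).

    Everything follows from one fact about phi. Let H be the first positive
    zero of phi. Then -phi'/phi = sum p_k w^k on |w| < H with all p_k >= 0
    ([struve_log_derivative_data]). Put q(w) = 2 kappa w sum p_k w^k. Then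
    z u'/u = 1 - q(z^2), and differentiating once more gives
<<
      z u''/u' = - Q(z^2),      Q(w) = q(w) + 2 w q'(w) / (1 - q(w)).
>>
    Since q has nonnegative coefficients, it increases on [0,H), it reaches 1
    at a point w1 < H (otherwise phi = exp(-int sum p_k w^k) would stay away
    from 0 up to H), and |Q(w)| <= Q(|w|) for |w| < w1. Hence, for |z| < sqrt w1,
    both Re (z u''/u') and -|z u''/u'| are at least -Q(|z|^2), with equality on
    the positive axis, and the condition defining the radius of beta-uniform
    convexity of order alpha holds on |z| < r exactly as long as
    Q(r^2) <= (1-alpha)/(1+beta). The function Q increases from 0 to infinity
    on [0,w1), so the radius is the root of Q(r^2) = (1-alpha)/(1+beta), and
    this is the equation of the statement because, on the positive axis,
    -Q(r^2) is the combination of logarithmic derivatives which appears there.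
    Finally sqrt H and sqrt w1 are the first positive zeros of the Struve
    function and of its derivative.

    It remains to see why p_k >= 0 and why the series has radius at least H.
    Both hold for a polynomial prod (1 - a_j w) with a_j > 0, for which
    p_k = sum a_j^(k+1), and both pass to limits
    ([positive_rooted_limit]). The approximating polynomials are
<<
      A_N(S) = 3F2(-N, N+lambda+1, 1; 3/2, lambda+1; S),   S = w / (4 N^2),
>>
    where lambda = nu + 1/2. An explicit connection formula expands A_N, up
    to a positive factor, in the polynomials sin((2j+1) t) / ((2j+1) sin t) of
    S = sin^2 t, with coefficients (2j+1) alpha_j, where
    alpha_0 < alpha_1 < ... < alpha_N as soon as 0 < lambda < 1
    ([moment_step], [weight_pos_incr]). Therefore
<<
      2 sin^2 t sum_(0<=j<=N) alpha_j sin((2j+1) t) / sin t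
        = alpha_0 + sum_(0<j<=N) (alpha_j - alpha_(j-1)) cos 2jt
          - alpha_N cos (2N+2)t
>>
    has the sign of -cos (2N+2)t at the N+1 points t = m pi / (2N+2) of
    (0, pi/2], so A_N has N zeros in (0,1), as many as its degree. This is a
    discrete form of Polya's theorem on the sine transforms of increasing
    functions. The end points lambda = 0 and lambda = 1, where zeros may be
    double, are reached by letting lambda vary with N. *)

(** * Polynomials with positive roots *)

Definition polynomial (c : nat -> R) (N : nat) (x : R) : R :=
  sum_f_R0 (fun m => c m * x ^ m) N.

(** The coefficients of (1 - a x) * c(x). *)
Definition mul_linear (a : R) (c : nat -> R) (n : nat) : R :=
  match n with
  | O => c O
  | S k => c (S k) - a * c k
  end.

(** The coefficient sequences of finite products of factors 1 - a x with
    a > 0, that is, of polynomials with value 1 at 0 and only positive roots. *)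
Inductive positive_rooted : (nat -> R) -> Prop :=
| positive_rooted_one c :
    c O = 1 -> (forall m, c (S m) = 0) -> positive_rooted c
| positive_rooted_mul a c' c :
    0 < a -> positive_rooted c' -> (forall n, c n = mul_linear a c' n) ->
    positive_rooted c.

Lemma polynomial_mul_linear a c N x :
  c (S N) = 0 ->
  polynomial (mul_linear a c) (S N) x = (1 - a * x) * polynomial c N x.
Proof.
  unfold polynomial. intros H.
  assert (E : forall M, sum_f_R0 (fun m => mul_linear a c m * x ^ m) (S M)
     = (1 - a * x) * sum_f_R0 (fun m => c m * x ^ m) M + c (S M) * x ^ (S M)).
  { induction M as [|M IH].
    - simpl. ring.
    - rewrite tech5, IH, (tech5 _ M). simpl. ring. }
  rewrite E, H. ring.
Qed.

Lemma polynomial_continuity c N : continuity (polynomial c N).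
Proof.
  unfold polynomial. induction N as [|N IH]; simpl.
  - apply continuity_const. intros x y. reflexivity.
  - apply (continuity_plus (fun x => sum_f_R0 (fun m => c m * x ^ m) N)
             (fun x => c (S N) * (x * x ^ N))); [exact IH|].
    apply derivable_continuous.
    apply (derivable_scal (fun x => x * x ^ N)).
    apply (derivable_mult (fun x => x) (fun x => x ^ N)).
    apply derivable_id. apply derivable_pow.
Qed.

(** The coefficients of c(x) / (1 - a x) as a formal power series, so that
    synthetic division is the observation that they vanish eventually when 1/a
    is a root. *)
Fixpoint divide_linear (a : R) (c : nat -> R) (n : nat) : R :=
  match n with
  | O => c O
  | S k => c (S k) + a * divide_linear a c k
  end.

Lemma mul_linear_divide a c n : c n = mul_linear a (divide_linear a c) n.
Proof. destruct n; simpl; ring. Qed.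

Lemma divide_linear_partial a c N : a <> 0 ->
  divide_linear a c N = a ^ N * polynomial c N (/ a).
Proof.
  intros Ha. unfold polynomial. induction N as [|N IH]; simpl.
  - ring.
  - rewrite IH. rewrite pow_inv. field. split; [apply pow_nonzero|]; assumption.
Qed.

Lemma divide_linear_vanish a c N : a <> 0 ->
  (forall m, (N < m)%nat -> c m = 0) -> polynomial c N (/ a) = 0 ->
  forall m, (N <= m)%nat -> divide_linear a c m = 0.
Proof.
  intros Ha Hc H0 m Hm. induction Hm as [|m Hm IH].
  - rewrite divide_linear_partial, H0 by assumption. ring.
  - simpl. rewrite IH, Hc by lia. ring.
Qed.

(** N sign changes give N positive roots, all the roots of a polynomial of
    degree N. The induction divides by the root between the last two points:
    the factor 1 - x/r is positive at the points that remain, so their signs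
    still alternate. *)
Lemma alternating_positive_rooted N : forall c s,
  c O = 1 -> (forall m, (N < m)%nat -> c m = 0) ->
  0 < s O -> (forall i, (i < N)%nat -> s i < s (S i)) ->
  (forall i, (i <= N)%nat -> 0 < (-1) ^ i * polynomial c N (s i)) ->
  positive_rooted c.
Proof.
  induction N as [|N IH]; intros c s c0 cN s0 smono alt.
  - apply positive_rooted_one; [exact c0|]. intros m. apply cN. lia.
  - assert (spos : forall i, (i <= S N)%nat -> 0 < s i).
    { induction i as [|i IHi]; intros Hi; [exact s0|].
      specialize (smono i ltac:(lia)). specialize (IHi ltac:(lia)). lra. }
    assert (Hs : s N < s (S N)) by (apply smono; lia).
    assert (Hroot : exists r, s N < r < s (S N) /\ polynomial c (S N) r = 0).
    { pose proof (alt N ltac:(lia)) as H1. pose proof (alt (S N) ltac:(lia)) as H2.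
      simpl in H2.
      destruct (IVT_cor (polynomial c (S N)) (s N) (s (S N))) as [r [Hr1 Hr2]].
      - apply polynomial_continuity.
      - lra.
      - assert (((-1) ^ N * polynomial c (S N) (s N)) *
                (-1 * (-1) ^ N * polynomial c (S N) (s (S N))) > 0) by (apply Rmult_gt_0_compat; lra).
        assert (E : (-1) ^ N * (-1) ^ N = 1).
        { rewrite <- pow_add. replace (N + N)%nat with (2 * N)%nat by lia. apply pow_1_even. }
        nra.
      - exists r. split; [|exact Hr2].
        destruct (Req_dec r (s N)) as [E|E]; [subst; rewrite Hr2 in H1; lra|].
        destruct (Req_dec r (s (S N))) as [E'|E']; [subst; rewrite Hr2 in H2; lra|].
        lra. }
    destruct Hroot as [r [Hr Hr0]].
    assert (Hsn : 0 < s N) by (apply spos; lia).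
    assert (rpos : 0 < r) by lra.
    assert (apos : 0 < / r) by (apply Rinv_0_lt_compat; lra).
    assert (Hvan : forall m, (S N <= m)%nat -> divide_linear (/ r) c m = 0).
    { apply divide_linear_vanish; [lra|exact cN|]. rewrite Rinv_inv. exact Hr0. }
    apply (positive_rooted_mul (/ r) (divide_linear (/ r) c)); [exact apos| |apply mul_linear_divide].
    apply (IH _ s); [exact c0| |exact s0| |].
    + intros m Hm. apply Hvan. lia.
    + intros i Hi. apply smono. lia.
    + intros i Hi.
      assert (si : s i <= s N).
      { assert (forall k, (i + k <= N)%nat -> s i <= s (i + k)%nat).
        { induction k as [|k IHk]; intros Hk.
          - rewrite Nat.add_0_r. lra.
          - specialize (IHk ltac:(lia)). rewrite Nat.add_succ_r.
            specialize (smono (i + k)%nat ltac:(lia)). lra. }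
        replace N with (i + (N - i))%nat by lia. apply H. lia. }
      specialize (alt i ltac:(lia)).
      assert (E : polynomial c (S N) (s i)
                  = (1 - / r * s i) * polynomial (divide_linear (/ r) c) N (s i)).
      { rewrite <- polynomial_mul_linear by (apply Hvan; lia).
        unfold polynomial. apply sum_eq. intros k _. rewrite <- mul_linear_divide. reflexivity. }
      rewrite E in alt.
      assert (0 < 1 - / r * s i).
      { assert (/ r * s i < / r * r) by (apply Rmult_lt_compat_l; lra).
        rewrite Rinv_l in H by lra. lra. }
      apply Rmult_lt_reg_l with (1 - / r * s i); [assumption|]. lra.
Qed.

Lemma PS_mult_mul_linear p a c n :
  PS_mult p (mul_linear a c) (S n)
  = PS_mult p c (S n) - a * PS_mult p c n.
Proof.
  unfold PS_mult. rewrite !tech5.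
  rewrite (sum_eq _ (fun i => p i * c (S n - i)%nat + - (a * (p i * c (n - i)%nat)))).
  2:{ intros i Hi. replace (S n - i)%nat with (S (n - i)) by lia. simpl. ring. }
  rewrite sum_plus.
  replace (S n - S n)%nat with O by lia. simpl (mul_linear a c 0).
  rewrite <- (Ropp_involutive (a * sum_f_R0 _ n)).
  rewrite scal_sum.
  rewrite (sum_eq (fun i => - (a * (p i * c (n - i)%nat)))
     (fun i => (- a) * (p i * c (n - i)%nat))) by (intros; ring).
  rewrite (sum_eq (fun i => - a * (p i * c (n - i)%nat)) (fun i => (p i * c (n - i)%nat) * (-a))) by (intros; ring).
  rewrite <- !scal_sum. ring.
Qed.

Lemma PS_mult_geometric a c n :
  PS_mult (fun i => a ^ S i) c (S n)
  = a * c (S n) + a * PS_mult (fun i => a ^ S i) c n.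
Proof.
  unfold PS_mult. rewrite decomp_sum by lia.
  rewrite scal_sum. simpl pred. rewrite Nat.sub_0_r. simpl (a ^ 1).
  f_equal; [ring|]. apply sum_eq. intros i Hi. simpl. ring.
Qed.

Lemma PS_mult_plus p q c n :
  PS_mult (fun i => p i + q i) c n = PS_mult p c n + PS_mult q c n.
Proof.
  unfold PS_mult. rewrite <- sum_plus. apply sum_eq. intros; ring.
Qed.

Lemma positive_rooted_start c : positive_rooted c -> c O = 1.
Proof. induction 1 as [|a c' c Ha Hc IH E]; [assumption|]. rewrite E. exact IH. Qed.

(** For f = prod (1 - a_j x) the sequence is p_k = sum a_j^(k+1), and its
    power series is -f'/f. The last clause bounds the partial sums of the
    series up to the first root. It is an inequality between finite quantities,
    so it survives a limit of polynomials, and this is how the radius of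
    convergence of the limit series is controlled. *)
Lemma positive_rooted_log_derivative c : positive_rooted c ->
  exists (p : nat -> R) (f f' : R -> R) (N : nat),
    (forall k, 0 <= p k) /\
    (forall n, INR (S n) * c (S n) = - PS_mult p c n) /\
    (forall m, (N < m)%nat -> c m = 0) /\
    (forall x, f x = polynomial c N x) /\
    (forall x, is_derive f x (f' x)) /\
    (forall x, 0 <= x -> (forall y, 0 <= y <= x -> 0 < f y) ->
       forall M, sum_f_R0 (fun k => p k * x ^ k) M * f x <= - f' x).
Proof.
  induction 1 as [c c0 cS|a c' c Ha Hc IH E].
  - exists (fun _ => 0), (fun _ => 1), (fun _ => 0), O.
    split; [intros; lra|]. split; [|split; [|split; [|split]]].
    + intros n. rewrite cS. unfold PS_mult.
      rewrite (sum_eq _ (fun _ => 0)) by (intros; ring). rewrite sum_cte. ring.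
    + intros [|m] Hm; [lia|apply cS].
    + intros x. unfold polynomial. simpl. rewrite c0. ring.
    + intros x. auto_derive; auto.
    + intros x _ _ M. rewrite (sum_eq _ (fun _ => 0)) by (intros; ring).
      rewrite sum_cte. lra.
  - destruct IH as (p & f & f' & N & Hp & Hnewton & HN & Hf & Hd & Hb).
    (* The new factor contributes the geometric series a / (1 - a x). *)
    exists (fun k => p k + a ^ S k), (fun x => (1 - a * x) * f x),
      (fun x => (1 - a * x) * f' x - a * f x), (S N).
    split; [|split; [|split; [|split; [|split]]]].
    + intros k. specialize (Hp k). pose proof (pow_lt a (S k) Ha). lra.
    + intros n.
      assert (C : forall q, PS_mult q c n = PS_mult q (mul_linear a c') n).
      { intros q. unfold PS_mult. apply sum_eq. intros. rewrite E. reflexivity. }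
      rewrite C, PS_mult_plus, E. simpl mul_linear.
      destruct n as [|n].
      * specialize (Hnewton O). revert Hnewton. unfold PS_mult. simpl. lra.
      * rewrite !PS_mult_mul_linear, PS_mult_geometric.
        pose proof (Hnewton (S n)) as H1. pose proof (Hnewton n) as H2.
        rewrite (S_INR (S n)) in *.
        replace (PS_mult p c' (S n)) with (- ((INR (S n) + 1) * c' (S (S n)))) by lra.
        replace (PS_mult p c' n) with (- (INR (S n) * c' (S n))) by lra.
        ring.
    + intros m Hm. rewrite E. destruct m as [|m]; [lia|]. simpl.
      rewrite !HN by lia. ring.
    + intros x. rewrite Hf, <- polynomial_mul_linear by (apply HN; lia).
      unfold polynomial. apply sum_eq. intros. rewrite E. reflexivity.
    + intros x. evar_last.
      { apply (is_derive_mult (fun x => 1 - a * x) f x (- a) (f' x)).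
        - auto_derive; auto. ring.
        - apply Hd.
        - intros; apply Rmult_comm. }
      unfold plus, mult; simpl. unfold mult; simpl. ring.
    + intros x Hx Hpos M.
      (* Otherwise 1/a would be a zero of f in [0,x]. *)
      assert (ax : a * x < 1).
      { destruct (Rlt_le_dec (a * x) 1) as [h|h]; [exact h|exfalso].
        assert (0 < / a) by (apply Rinv_0_lt_compat; lra).
        assert (/ a <= x).
        { apply Rmult_le_reg_l with a; [lra|]. rewrite Rinv_r by lra. lra. }
        specialize (Hpos (/ a) ltac:(lra)). rewrite Rinv_r in Hpos by lra. lra. }
      assert (fpos : forall y, 0 <= y <= x -> 0 < f y).
      { intros y Hy. specialize (Hpos y Hy).
        assert (a * y <= a * x) by (apply Rmult_le_compat_l; lra).
        apply Rmult_lt_reg_l with (1 - a * y); lra. }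
      specialize (Hb x Hx fpos M).
      rewrite (sum_eq _ (fun k => p k * x ^ k + a * (a * x) ^ k)).
      2:{ intros k _. rewrite Rpow_mult_distr. simpl. ring. }
      rewrite sum_plus, (sum_eq (fun k => a * (a * x) ^ k) (fun k => (a * x) ^ k * a)) by (intros; ring).
      rewrite <- scal_sum.
      assert (G : sum_f_R0 (fun k => (a * x) ^ k) M * (1 - a * x) = 1 - (a * x) ^ S M).
      { rewrite tech3 by lra. field. lra. }
      assert (0 <= (a * x) ^ S M) by (apply pow_le; apply Rmult_le_pos; lra).
      assert (fx : 0 < f x) by (apply fpos; lra).
      set (A := sum_f_R0 (fun k => p k * x ^ k) M) in *.
      set (B := sum_f_R0 (fun k => (a * x) ^ k) M) in *.
      replace ((A + a * B) * ((1 - a * x) * f x))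
        with ((1 - a * x) * (A * f x) + a * f x * (B * (1 - a * x))) by ring.
      rewrite G.
      assert ((1 - a * x) * (A * f x) <= (1 - a * x) * (- f' x)) by (apply Rmult_le_compat_l; lra).
      assert (0 <= a * f x * (a * x) ^ S M) by (apply Rmult_le_pos; [apply Rmult_le_pos; lra|lra]).
      lra.
Qed.

(** * Sine sums with increasing weights *)

(** The product of (x - i + 1) (x + i) over 1 <= i <= m; for x = j a natural
    number this is (j + m)! / (j - m)!, which vanishes for m > j. *)
Fixpoint central_factorial (x : R) (m : nat) : R :=
  match m with
  | O => 1
  | S k => central_factorial x k * (x * (x + 1) - INR k * (INR k + 1))
  end.

(** The coefficients of 2F1(-x, x+1; 3/2; S). At x = j this is the polynomial
    sin((2j+1) t) / ((2j+1) sin t) of S = sin^2 t. *)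
Definition sine_coef (x : R) (m : nat) : R :=
  (-4) ^ m * central_factorial x m / INR (fact (2 * m + 1)).

Lemma central_factorial_vanish j m : (j < m)%nat -> central_factorial (INR j) m = 0.
Proof.
  intros H. induction H as [|m H IH]; simpl; [ring|]. rewrite IH. ring.
Qed.

Lemma central_factorial_up x m :
  central_factorial (x + 1) (S m)
  = central_factorial x m * (x + INR (S m)) * (x + INR (S m) + 1).
Proof.
  induction m as [|m IH].
  - simpl. ring.
  - change (central_factorial (x + 1) (S (S m)))
      with (central_factorial (x + 1) (S m) * ((x + 1) * (x + 1 + 1) - INR (S m) * (INR (S m) + 1))).
    rewrite IH. change (central_factorial x (S m)) with (central_factorial x m * (x * (x + 1) - INR m * (INR m + 1))).
    rewrite !S_INR. ring.
Qed.

Lemma central_factorial_down x m :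
  central_factorial (x - 1) (S m)
  = central_factorial x m * (x - INR (S m)) * (x - INR (S m) + 1).
Proof.
  induction m as [|m IH].
  - simpl. ring.
  - change (central_factorial (x - 1) (S (S m)))
      with (central_factorial (x - 1) (S m) * ((x - 1) * (x - 1 + 1) - INR (S m) * (INR (S m) + 1))).
    rewrite IH. change (central_factorial x (S m)) with (central_factorial x m * (x * (x + 1) - INR m * (INR m + 1))).
    rewrite !S_INR. ring.
Qed.

Lemma sine_coef_recursion x m :
  (2 * x + 3) * sine_coef (x + 1) (S m)
  = (2 * x + 1) * (2 * sine_coef x (S m) - 4 * sine_coef x m)
    - (2 * x - 1) * sine_coef (x - 1) (S m).
Proof.
  unfold sine_coef. rewrite central_factorial_up, central_factorial_down.
  change (central_factorial x (S m)) with (central_factorial x m * (x * (x + 1) - INR m * (INR m + 1))).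
  replace (2 * S m + 1)%nat with (S (S (2 * m + 1))) by lia.
  rewrite !fact_simpl, !mult_INR.
  pose proof (INR_fact_neq_0 (2 * m + 1)) as Hf. set (F := INR (fact (2 * m + 1))) in *.
  pose proof (pos_INR m).
  rewrite !S_INR, plus_INR, mult_INR. simpl (INR 2). simpl (INR 1).
  change ((-4) ^ S m) with (-4 * (-4) ^ m).
  field. repeat split; try lra.
Qed.

(** The recursion of the coefficients is that of
    sin((2j+3) t) + sin((2j-1) t) = 2 cos(2t) sin((2j+1) t) with
    cos 2t = 1 - 2 S. Since both sides are odd in 2x+1, the case j = 0
    also gives x = -1, the second value that the recursion needs. *)
Lemma sin_odd_multiple phi j M : (j <= M)%nat ->
  sin ((2 * INR j + 1) * phi)
  = (2 * INR j + 1) * sin phi * polynomial (sine_coef (INR j)) M (sin phi ^ 2).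
Proof.
  set (F := fun x M => sin ((2 * x + 1) * phi)
     = (2 * x + 1) * sin phi * polynomial (sine_coef x) M (sin phi ^ 2)).
  assert (Z0 : forall M, F 0 M).
  { intros K. unfold F.
    assert (E : polynomial (sine_coef 0) K (sin phi ^ 2) = 1).
    { unfold polynomial. induction K as [|K IH].
      - simpl. unfold sine_coef. simpl. field.
      - rewrite tech5, IH. unfold sine_coef.
        rewrite (central_factorial_vanish 0 (S K) ltac:(lia) : central_factorial 0 (S K) = 0). unfold Rdiv. ring. }
    rewrite E. replace ((2 * 0 + 1) * phi) with phi by ring. ring. }
  assert (Zm : forall M, F (0 - 1) M).
  { intros K. unfold F.
    assert (E : polynomial (sine_coef (0 - 1)) K (sin phi ^ 2) = polynomial (sine_coef 0) K (sin phi ^ 2)).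
    { unfold polynomial. apply sum_eq. intros i _. unfold sine_coef. do 3 f_equal.
      induction i as [|i IH]; [reflexivity|]. simpl. rewrite IH. ring. }
    rewrite E. replace ((2 * (0 - 1) + 1) * phi) with (- ((2 * 0 + 1) * phi)) by ring.
    rewrite sin_neg. rewrite (Z0 K). ring. }
  assert (main : forall j, (forall M, (j <= M)%nat -> F (INR j) M) /\ (forall M, (j <= M)%nat -> F (INR j - 1) M)).
  { clear j M. induction j as [|j [IH1 IH2]].
    - split; intros; [apply Z0|apply Zm].
    - split; intros M HM.
      + destruct M as [|M]; [lia|].
        rewrite S_INR. set (x := INR j) in *.
        pose proof (IH1 (S M) ltac:(lia)) as A1. pose proof (IH1 M ltac:(lia)) as A2.
        pose proof (IH2 (S M) ltac:(lia)) as A3. unfold F in *.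
        set (P := fun y K => polynomial (sine_coef y) K (sin phi ^ 2)) in *.
        change (sin ((2 * (x + 1) + 1) * phi) = (2 * (x + 1) + 1) * sin phi * P (x + 1) (S M)).
        change (sin ((2 * x + 1) * phi) = (2 * x + 1) * sin phi * P x (S M)) in A1.
        change (sin ((2 * x + 1) * phi) = (2 * x + 1) * sin phi * P x M) in A2.
        change (sin ((2 * (x - 1) + 1) * phi) = (2 * (x - 1) + 1) * sin phi * P (x - 1) (S M)) in A3.
        assert (R0 : forall y K, (2 * y + 3) * P (y + 1) (S K)
            = (2 * y + 1) * (2 * P y (S K) - 4 * sin phi ^ 2 * P y K) - (2 * y - 1) * P (y - 1) (S K)).
        { intros y K. unfold P, polynomial. induction K as [|K IHK].
          - simpl sum_f_R0. pose proof (sine_coef_recursion y 0) as E.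
            assert (E0 : forall z, sine_coef z 0 = 1) by (intros z; unfold sine_coef; simpl; field).
            rewrite !E0 in *. set (s := sin phi) in *. simpl pow.
            replace ((2 * y + 3) * (1 * 1 + sine_coef (y + 1) 1 * (s * (s * 1) * 1)))
              with ((2 * y + 3) + (2 * y + 3) * sine_coef (y + 1) 1 * (s * s)) by ring.
            rewrite E. ring.
          - rewrite (tech5 _ (S K)), Rmult_plus_distr_l, IHK.
            rewrite <- Rmult_assoc, sine_coef_recursion.
            rewrite !(tech5 _ (S K)), (tech5 (fun m => sine_coef y m * (sin phi ^ 2) ^ m) K).
            simpl pow. ring. }
        specialize (R0 x M).
        replace (2 * (x + 1) + 1) with (2 * x + 3) in * by ring.
        replace (2 * (x - 1) + 1) with (2 * x - 1) in * by ring.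
        replace ((2 * x + 3) * sin phi * P (x + 1) (S M)) with (sin phi * ((2 * x + 3) * P (x + 1) (S M))) by ring.
        rewrite R0.
        replace (sin phi * ((2 * x + 1) * (2 * P x (S M) - 4 * sin phi ^ 2 * P x M) - (2 * x - 1) * P (x - 1) (S M)))
          with (2 * ((2 * x + 1) * sin phi * P x (S M)) - 4 * sin phi ^ 2 * ((2 * x + 1) * sin phi * P x M)
                - (2 * x - 1) * sin phi * P (x - 1) (S M)) by ring.
        rewrite <- A1, <- A2, <- A3.
        replace ((2 * x + 3) * phi) with ((2 * x + 1) * phi + 2 * phi) by ring.
        replace ((2 * x - 1) * phi) with ((2 * x + 1) * phi - 2 * phi) by ring.
        rewrite sin_plus, sin_minus, cos_2a_sin. simpl. ring.
      + rewrite S_INR. replace (INR j + 1 - 1) with (INR j) by ring. apply IH1. lia. }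
  intros H. apply (proj1 (main j) M H).
Qed.

(** The connection coefficients, divided by 2j+1, that expand the Jacobi
    polynomial 2F1(-N, N+lam+1; lam+1; x) in shifted Legendre polynomials,
    normalized to start at 1. *)
Fixpoint weight (lam : R) (N j : nat) : R :=
  match j with
  | O => 1
  | S k => weight lam N k
     * ((INR N - INR k) * (INR N + INR k + 1 + lam))
     / ((INR N - INR k - 1 + lam) * (INR N + INR k + 2))
  end.

Lemma weight_step lam N k : 0 < lam < 1 -> (k <= N)%nat ->
  weight lam N (S k) * ((INR N - INR k - 1 + lam) * (INR N + INR k + 2))
  = weight lam N k * ((INR N - INR k) * (INR N + INR k + 1 + lam)).
Proof.
  intros Hl Hk. simpl. pose proof (pos_INR N). pose proof (pos_INR k). field. split; [lra|].
  destruct (Nat.eq_dec k N) as [->|E]; [lra|].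
  assert (INR k + 1 <= INR N) by (rewrite <- S_INR; apply le_INR; lia). lra.
Qed.

(** The ratio of consecutive weights exceeds 1 because
    (N-k)(N+k+1+lam) - (N-k-1+lam)(N+k+2) = (1-lam)(2k+2). *)
Lemma weight_pos_incr lam N k : 0 < lam < 1 -> (k <= N)%nat ->
  0 < weight lam N k /\ ((k < N)%nat -> weight lam N k < weight lam N (S k)).
Proof.
  intros Hl.
  assert (step : forall k, (k < N)%nat -> 0 < weight lam N k -> weight lam N k < weight lam N (S k)).
  { clear k. intros k Hk Hp. pose proof (weight_step lam N k Hl ltac:(lia)) as E.
    assert (INR k + 1 <= INR N) by (rewrite <- S_INR; apply le_INR; lia).
    pose proof (pos_INR k).
    set (D := (INR N - INR k - 1 + lam) * (INR N + INR k + 2)) in *.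
    assert (0 < D) by (apply Rmult_lt_0_compat; lra).
    apply Rmult_lt_reg_r with D; [assumption|]. rewrite E.
    apply Rmult_lt_compat_l; [exact Hp|]. unfold D. nra. }
  induction k as [|k IH]; intros Hk.
  - simpl weight at 1. split; [lra|]. intros. apply step; [assumption|simpl; lra].
  - assert (0 < weight lam N (S k)).
    { destruct (IH ltac:(lia)) as [A B]. specialize (B ltac:(lia)). lra. }
    split; [assumption|]. intros. apply step; assumption.
Qed.

(** Up to the factor (-4)^m / (2m+1)!, the coefficient of S^m in the sum of
    (2j+1) weight_j 2F1(-j, j+1; 3/2; S). *)
Definition moment (lam : R) (N m : nat) : R :=
  sum_f_R0 (fun j => (2 * INR j + 1) * weight lam N j * central_factorial (INR j) m) N.

(** The connection formula in the form of a recursion in m. It is a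
    telescoping sum: with the certificate D below, the summand of the
    difference of both sides is D_j - D_(j+1), while D_0 = D_(N+1) = 0. *)
Lemma moment_step lam N m : 0 < lam < 1 ->
  (lam + 1 + INR m) * moment lam N (S m)
  = (INR m + 1) * (INR N - INR m) * (INR N + lam + 1 + INR m) * moment lam N m.
Proof.
  intros Hl.
  (* The factor j makes D odd under j -> -1-j, as the factor 2j+1 of the
     summands requires. *)
  set (D := fun j : nat => (INR N - INR j + lam) * (INR N + INR j + 1) * weight lam N j
               * central_factorial (INR j) m * (INR j - INR m) * INR j).
  assert (tel : forall n, (n <= N)%nat ->
    sum_f_R0 (fun j => (2 * INR j + 1) * weight lam N j * central_factorial (INR j) (S m)) n * (lam + 1 + INR m)
    - (INR m + 1) * (INR N - INR m) * (INR N + lam + 1 + INR m)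
      * sum_f_R0 (fun j => (2 * INR j + 1) * weight lam N j * central_factorial (INR j) m) n
    = - D (S n)).
  { assert (step : forall j, (j <= N)%nat ->
      (2 * INR j + 1) * weight lam N j * central_factorial (INR j) (S m) * (lam + 1 + INR m)
      - (INR m + 1) * (INR N - INR m) * (INR N + lam + 1 + INR m)
        * ((2 * INR j + 1) * weight lam N j * central_factorial (INR j) m) = D j - D (S j)).
    { intros j Hj. unfold D. 
      pose proof (weight_step lam N j Hl Hj) as W.
      assert (T : central_factorial (INR (S j)) m * (INR (S j) - INR m)
                  = central_factorial (INR j) m * (INR j + INR m + 1)).
      { destruct m as [|k]; [rewrite S_INR; simpl; ring|].
        rewrite (S_INR j), central_factorial_up. 
        change (central_factorial (INR j) (S k)) with (central_factorial (INR j) k * (INR j * (INR j + 1) - INR k * (INR k + 1))).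
        rewrite !S_INR. ring. }
      replace ((INR N - INR (S j) + lam) * (INR N + INR (S j) + 1) * weight lam N (S j) * central_factorial (INR (S j)) m * (INR (S j) - INR m) * INR (S j))
        with ((weight lam N (S j) * ((INR N - INR j - 1 + lam) * (INR N + INR j + 2))) * (central_factorial (INR (S j)) m * (INR (S j) - INR m)) * INR (S j)) by (rewrite !S_INR; ring).
      rewrite W, T. 
      change (central_factorial (INR j) (S m)) with (central_factorial (INR j) m * (INR j * (INR j + 1) - INR m * (INR m + 1))).
      rewrite S_INR. ring. }
    induction n as [|n IH]; intros Hn.
    - cbn [sum_f_R0]. rewrite (step 0%nat Hn). unfold D at 1. simpl (INR 0). ring.
    - rewrite !tech5. specialize (IH ltac:(lia)). specialize (step (S n) Hn). lra. }
  specialize (tel N (le_n N)).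
  assert (Z : D (S N) = 0).
  { unfold D. simpl weight. replace (INR N - INR N) with 0 by ring. unfold Rdiv. ring. }
  rewrite Z in tel. unfold moment. lra.
Qed.

Lemma moment_0_pos lam N : 0 < lam < 1 -> 0 < moment lam N 0.
Proof.
  intros Hl. unfold moment.
  assert (H : forall n, (n <= N)%nat ->
    0 < sum_f_R0 (fun j => (2 * INR j + 1) * weight lam N j * central_factorial (INR j) 0) n).
  { induction n as [|n IH]; intros Hn.
    - simpl. lra.
    - rewrite tech5. specialize (IH ltac:(lia)).
      destruct (weight_pos_incr lam N (S n) Hl Hn) as [A _]. pose proof (pos_INR (S n)).
      assert (0 < (2 * INR (S n) + 1) * weight lam N (S n) * central_factorial (INR (S n)) 0).
      { simpl central_factorial. rewrite Rmult_1_r. apply Rmult_lt_0_compat; lra. }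
      lra. }
  apply H. lia.
Qed.

Lemma sum_exchange (F : nat -> nat -> R) N M :
  sum_f_R0 (fun m => sum_f_R0 (F m) N) M = sum_f_R0 (fun j => sum_f_R0 (fun m => F m j) M) N.
Proof.
  induction M as [|M IH]; simpl; [apply sum_eq; reflexivity|].
  rewrite IH, <- sum_plus. apply sum_eq. intros. reflexivity.
Qed.

Definition sine_sum_coef (lam : R) (N m : nat) : R :=
  (-4) ^ m / INR (fact (2 * m + 1)) * moment lam N m.

(** The product formula 2 sin t sin((2j+1) t) = cos 2jt - cos (2j+2)t. *)
Lemma sine_sum_polynomial lam N phi :
  2 * sin phi ^ 2 * polynomial (sine_sum_coef lam N) N (sin phi ^ 2)
  = sum_f_R0 (fun j => weight lam N j * (cos (2 * INR j * phi) - cos (2 * (INR j + 1) * phi))) N.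
Proof.
  assert (E : sin phi * polynomial (sine_sum_coef lam N) N (sin phi ^ 2)
      = sum_f_R0 (fun j => weight lam N j * sin ((2 * INR j + 1) * phi)) N).
  { unfold polynomial. rewrite scal_sum.
    rewrite (sum_eq _ (fun m => sum_f_R0 (fun j => sin phi * ((2 * INR j + 1) * weight lam N j * (sine_coef (INR j) m * (sin phi ^ 2) ^ m))) N)).
    2:{ intros m _. unfold sine_sum_coef, moment.
        match goal with |- (_ * ?S) * _ * _ = _ =>
          transitivity ((-4) ^ m / INR (fact (2 * m + 1)) * (sin phi ^ 2) ^ m * sin phi * S); [ring|] end.
        rewrite scal_sum.
        apply sum_eq. intros j _. unfold sine_coef, Rdiv. ring. }
    rewrite sum_exchange. apply sum_eq. intros j Hj.
    rewrite (sin_odd_multiple phi j N Hj). unfold polynomial.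
    rewrite (sum_eq _ (fun m => (sine_coef (INR j) m * (sin phi ^ 2) ^ m) * (sin phi * ((2 * INR j + 1) * weight lam N j)))) by (intros; ring).
    rewrite <- scal_sum. ring. }
  replace (2 * sin phi ^ 2 * polynomial (sine_sum_coef lam N) N (sin phi ^ 2))
    with (2 * sin phi * (sin phi * polynomial (sine_sum_coef lam N) N (sin phi ^ 2))) by ring.
  rewrite E, scal_sum. apply sum_eq. intros j _.
  replace (2 * INR j * phi) with ((2 * INR j + 1) * phi - phi) by ring.
  replace (2 * (INR j + 1) * phi) with ((2 * INR j + 1) * phi + phi) by ring.
  rewrite cos_plus, cos_minus. ring.
Qed.

(** * Polynomial approximants of the Struve series *)

(** Summation by parts turns the sum into weight_0 plus the nonnegative
    increments of the weights times cosines, which is at most weight_n in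
    modulus; the inequalities are strict since the increments are positive and
    cos 2t < 1. *)
Lemma cosine_sum_bounds lam N phi n : 0 < lam < 1 -> (S n <= N)%nat -> cos (2 * phi) < 1 ->
  - weight lam N (S n)
  < sum_f_R0 (fun j => weight lam N j * (cos (2 * INR j * phi) - cos (2 * (INR j + 1) * phi))) (S n)
    + weight lam N (S n) * cos (2 * (INR (S n) + 1) * phi)
  < weight lam N (S n).
Proof.
  intros Hl Hn Hc.
  set (s := fun n => sum_f_R0 (fun j => weight lam N j * (cos (2 * INR j * phi) - cos (2 * (INR j + 1) * phi))) n
    + weight lam N n * cos (2 * (INR n + 1) * phi)).
  change (- weight lam N (S n) < s (S n) < weight lam N (S n)).
  assert (step : forall k, s (S k) = s k + (weight lam N (S k) - weight lam N k) * cos (2 * (INR k + 1) * phi)).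
  { intros k. unfold s. rewrite tech5, (S_INR k). ring. }
  assert (s0 : s O = weight lam N 0).
  { unfold s. cbn [sum_f_R0]. simpl (INR 0).
    replace (2 * 0 * phi) with 0 by ring. rewrite cos_0. ring. }
  induction n as [|n IH].
  - rewrite step, s0. destruct (weight_pos_incr lam N 0 Hl ltac:(lia)) as [A B].
    specialize (B ltac:(lia)). simpl (INR 0). replace (2 * (0 + 1) * phi) with (2 * phi) by ring.
    pose proof (COS_bound (2 * phi)). nra.
  - specialize (IH ltac:(lia)). rewrite step.
    destruct (weight_pos_incr lam N (S n) Hl ltac:(lia)) as [A B].
    specialize (B ltac:(lia)). pose proof (COS_bound (2 * (INR (S n) + 1) * phi)). nra.
Qed.

(** The points where cos (2N+2)t takes the values -1 and 1 alternately. *)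
Definition node (N i : nat) : R := INR (S i) * PI / (2 * INR N + 2).

Lemma node_range N i : (i <= N)%nat -> 0 < node N i <= PI / 2.
Proof.
  intros Hi. pose proof PI_RGT_0. pose proof (pos_INR N). pose proof (pos_INR i).
  assert (INR i <= INR N) by (apply le_INR; lia).
  unfold node. rewrite S_INR. split.
  - apply Rdiv_lt_0_compat; [apply Rmult_lt_0_compat; lra|lra].
  - apply Rmult_le_reg_r with (2 * INR N + 2); [lra|].
    replace ((INR i + 1) * PI / (2 * INR N + 2) * (2 * INR N + 2)) with ((INR i + 1) * PI) by (field; lra).
    nra.
Qed.

Lemma sine_sum_alternates lam N i : 0 < lam < 1 -> (1 <= N)%nat -> (i <= N)%nat ->
  0 < (-1) ^ i * polynomial (sine_sum_coef lam N) N (sin (node N i) ^ 2).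
Proof.
  intros Hl HN Hi. set (phi := node N i).
  pose proof (node_range N i Hi) as Hphi. fold phi in Hphi.
  assert (sp : 0 < sin phi) by (apply sin_gt_0; lra).
  assert (c2 : cos (2 * phi) < 1) by (rewrite cos_2a_sin; nra).
  pose proof (sine_sum_polynomial lam N phi) as E.
  destruct N as [|n]; [lia|].
  pose proof (cosine_sum_bounds lam (S n) phi n Hl (le_n _) c2) as B.
  rewrite <- E in B.
  assert (Ec : cos (2 * (INR (S n) + 1) * phi) = - (-1) ^ i).
  { unfold phi, node.
    replace (2 * (INR (S n) + 1) * (INR (S i) * PI / (2 * INR (S n) + 2))) with (INR (S i) * PI)
      by (field; pose proof (pos_INR (S n)); lra).
    clear. induction i as [|i IH].
    - simpl. rewrite Rmult_1_l, cos_PI. ring.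
    - rewrite S_INR, Rmult_plus_distr_r, Rmult_1_l, neg_cos, IH. simpl. ring. }
  rewrite Ec in B.
  destruct (weight_pos_incr lam (S n) (S n) Hl (le_n _)) as [A _].
  set (Q := polynomial _ _ _) in *. set (a := weight _ _ _) in *.
  assert (S2 : 0 < 2 * sin phi ^ 2) by (pose proof (pow_lt _ 2 sp); lra).
  assert (P : (-1) ^ i = 1 \/ (-1) ^ i = -1).
  { clear. induction i as [|i [IH|IH]]; simpl; rewrite ?IH; lra. }
  destruct P as [P|P]; rewrite P in *; apply Rmult_lt_reg_l with (2 * sin phi ^ 2); lra.
Qed.

(** The coefficients of 3F2(-N, N+lam+1, 1; 3/2, lam+1; w / (4 N^2)). *)
Fixpoint approximant (lam : R) (N m : nat) : R :=
  match m with
  | O => 1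
  | S k => approximant lam N k
     * (- (INR N - INR k) * (INR N + lam + 1 + INR k)
        / (4 * INR N ^ 2 * (3 / 2 + INR k) * (lam + 1 + INR k)))
  end.

Lemma approximant_sine_sum lam N m : 0 < lam < 1 -> (1 <= N)%nat ->
  approximant lam N m
  = sine_sum_coef lam N m * (/ (4 * INR N ^ 2)) ^ m / moment lam N 0.
Proof.
  intros Hl HN. pose proof (moment_0_pos lam N Hl) as M0.
  assert (HN' : 0 < INR N) by (apply lt_0_INR; lia).
  assert (HN2 : 0 < INR N ^ 2) by (apply pow_lt; lra).
  induction m as [|m IH].
  - simpl approximant. unfold sine_sum_coef. simpl. field. lra.
  - cbn [approximant]. rewrite IH. unfold sine_sum_coef.
    pose proof (moment_step lam N m Hl) as E. pose proof (pos_INR m).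
    replace (moment lam N (S m)) with ((INR m + 1) * (INR N - INR m) * (INR N + lam + 1 + INR m) * moment lam N m / (lam + 1 + INR m)).
    2:{ rewrite <- E. field. lra. }
    replace (2 * S m + 1)%nat with (S (S (2 * m + 1))) by lia.
    rewrite !fact_simpl, !mult_INR.
    pose proof (INR_fact_neq_0 (2 * m + 1)) as Hf. set (F := INR (fact (2 * m + 1))) in *.
    rewrite !S_INR, plus_INR, mult_INR. simpl (INR 2). simpl (INR 1).
    change ((-4) ^ S m) with (-4 * (-4) ^ m).
    change ((/ (4 * INR N ^ 2)) ^ S m) with ((/ (4 * INR N ^ 2)) * (/ (4 * INR N ^ 2)) ^ m).
    set (K := (/ (4 * INR N ^ 2)) ^ m). field. repeat split; lra.
Qed.

Lemma approximant_vanish lam N m : (N < m)%nat -> approximant lam N m = 0.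
Proof.
  intros H. induction H as [|m H IH]; cbn [approximant].
  - replace (INR N - INR N) with 0 by ring. unfold Rdiv. ring.
  - rewrite IH. ring.
Qed.

Definition scaled_node (N i : nat) : R := 4 * INR N ^ 2 * sin (node N i) ^ 2.

Lemma approximant_alternates lam N i : 0 < lam < 1 -> (1 <= N)%nat -> (i <= N)%nat ->
  0 < (-1) ^ i * polynomial (approximant lam N) N (scaled_node N i).
Proof.
  intros Hl HN Hi. pose proof (sine_sum_alternates lam N i Hl HN Hi) as A.
  pose proof (moment_0_pos lam N Hl) as M0.
  assert (HN' : 0 < INR N) by (apply lt_0_INR; lia).
  assert (HN2 : 0 < INR N ^ 2) by (apply pow_lt; lra).
  replace (polynomial (approximant lam N) N (scaled_node N i))
    with (/ moment lam N 0 * polynomial (sine_sum_coef lam N) N (sin (node N i) ^ 2)).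
  - assert (0 < / moment lam N 0) by (apply Rinv_0_lt_compat; lra).
    replace ((-1) ^ i * (/ moment lam N 0 * polynomial (sine_sum_coef lam N) N (sin (node N i) ^ 2)))
      with (/ moment lam N 0 * ((-1) ^ i * polynomial (sine_sum_coef lam N) N (sin (node N i) ^ 2))) by ring.
    apply Rmult_lt_0_compat; assumption.
  - unfold polynomial. rewrite scal_sum. apply sum_eq. intros m _.
    rewrite approximant_sine_sum by assumption. unfold scaled_node.
    rewrite (Rpow_mult_distr (4 * INR N ^ 2)), pow_inv.
    assert ((4 * INR N ^ 2) ^ m <> 0) by (apply pow_nonzero; lra).
    set (K := (4 * INR N ^ 2) ^ m) in *. field. split; lra.
Qed.

Lemma approximant_positive_rooted lam N : 0 < lam < 1 -> (1 <= N)%nat ->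
  positive_rooted (approximant lam N).
Proof.
  intros Hl HN.
  assert (HN' : 0 < INR N) by (apply lt_0_INR; lia).
  assert (HN2 : 0 < INR N ^ 2) by (apply pow_lt; lra).
  apply (alternating_positive_rooted N _ (scaled_node N)).
  - reflexivity.
  - intros m. apply approximant_vanish.
  - unfold scaled_node. pose proof (node_range N 0 ltac:(lia)).
    assert (0 < sin (node N 0)) by (apply sin_gt_0; pose proof PI_RGT_0; lra).
    pose proof (pow_lt _ 2 H0). apply Rmult_lt_0_compat; [lra|assumption].
  - intros i Hi. unfold scaled_node.
    pose proof (node_range N i ltac:(lia)). pose proof (node_range N (S i) ltac:(lia)).
    pose proof PI_RGT_0.
    assert (node N i < node N (S i)).
    { unfold node. rewrite (S_INR (S i)). apply Rmult_lt_compat_r.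
      - apply Rinv_0_lt_compat. lra.
      - nra. }
    assert (0 < sin (node N i)) by (apply sin_gt_0; lra).
    assert (sin (node N i) < sin (node N (S i))) by (apply sin_increasing_1; lra).
    apply Rmult_lt_compat_l; [lra|]. nra.
  - intros i Hi. apply approximant_alternates; assumption.
Qed.

(** The second node lies below 2 pi on the scale of sqrt w, uniformly in N;
    this later forces a zero of the limit. *)
Lemma approximant_negative_value lam N : 0 < lam < 1 -> (1 <= N)%nat ->
  exists x, 0 <= x <= 4 * PI ^ 2 /\ polynomial (approximant lam N) N x < 0.
Proof.
  intros Hl HN. exists (scaled_node N 1). split.
  - unfold scaled_node. pose proof (node_range N 1 HN).
    pose proof PI_RGT_0.
    assert (HN' : 0 < INR N) by (apply lt_0_INR; lia).
    assert (0 < sin (node N 1)) by (apply sin_gt_0; lra).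
    assert (sin (node N 1) < node N 1) by (apply sin_lt_x; lra).
    assert (INR N * node N 1 <= PI).
    { unfold node. simpl (INR 2).
      apply Rmult_le_reg_r with (2 * INR N + 2); [lra|].
      replace (INR N * ((1 + 1) * PI / (2 * INR N + 2)) * (2 * INR N + 2)) with (2 * INR N * PI) by (field; lra).
      nra. }
    assert (0 < INR N * sin (node N 1) <= PI) by nra.
    replace (4 * INR N ^ 2 * sin (node N 1) ^ 2) with (4 * (INR N * sin (node N 1)) ^ 2) by ring.
    split; [nra|]. assert ((INR N * sin (node N 1)) ^ 2 <= PI ^ 2) by (apply pow_incr; lra). lra.
  - pose proof (approximant_alternates lam N 1 Hl HN HN). simpl in H. lra.
Qed.

Lemma approximant_bound lam N m : 0 < lam < 1 -> (1 <= N)%nat ->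
  Rabs (approximant lam N m) <= / INR (fact m).
Proof.
  intros Hl HN.
  assert (HN1 : 1 <= INR N) by (change 1 with (INR 1); apply le_INR; lia).
  induction m as [|m IH].
  - simpl. rewrite Rabs_R1. lra.
  - destruct (Nat.le_gt_cases (S m) N) as [Hm|Hm].
    2:{ rewrite approximant_vanish by lia. rewrite Rabs_R0.
        left. apply Rinv_0_lt_compat, INR_fact_lt_0. }
    cbn [approximant]. rewrite Rabs_mult, fact_simpl, mult_INR, Rinv_mult, Rmult_comm.
    assert (INR m <= INR N) by (apply le_INR; lia). pose proof (pos_INR m).
    apply Rmult_le_compat; [apply Rabs_pos|apply Rabs_pos| |exact IH].
    rewrite S_INR. rewrite Rabs_left1.
    2:{ replace (- (INR N - INR m) * (INR N + lam + 1 + INR m) / (4 * INR N ^ 2 * (3 / 2 + INR m) * (lam + 1 + INR m)))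
         with (- ((INR N - INR m) * (INR N + lam + 1 + INR m) / (4 * INR N ^ 2 * (3 / 2 + INR m) * (lam + 1 + INR m))))
         by (field; repeat split; nra).
        assert (0 <= (INR N - INR m) * (INR N + lam + 1 + INR m) / (4 * INR N ^ 2 * (3 / 2 + INR m) * (lam + 1 + INR m))); [|lra].
        apply Rdiv_le_0_compat; [apply Rmult_le_pos; lra|].
        repeat apply Rmult_lt_0_compat; nra. }
    apply Rmult_le_reg_r with (4 * INR N ^ 2 * (3 / 2 + INR m) * (lam + 1 + INR m) * (INR m + 1)).
    { repeat apply Rmult_lt_0_compat; nra. }
    replace (- (- (INR N - INR m) * (INR N + lam + 1 + INR m) / (4 * INR N ^ 2 * (3 / 2 + INR m) * (lam + 1 + INR m))) *
      (4 * INR N ^ 2 * (3 / 2 + INR m) * (lam + 1 + INR m) * (INR m + 1)))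
      with ((INR N - INR m) * (INR N + lam + 1 + INR m) * (INR m + 1)) by (field; repeat split; nra).
    replace (/ (INR m + 1) * (4 * INR N ^ 2 * (3 / 2 + INR m) * (lam + 1 + INR m) * (INR m + 1)))
      with (4 * INR N ^ 2 * (3 / 2 + INR m) * (lam + 1 + INR m)) by (field; lra).
    assert (A : (INR N - INR m) * (INR N + lam + 1 + INR m) <= 3 * INR N ^ 2) by nra.
    assert (B : INR m + 1 <= (3 / 2 + INR m) * (lam + 1 + INR m)) by nra.
    apply Rle_trans with (3 * INR N ^ 2 * (INR m + 1)).
    + apply Rmult_le_compat_r; lra.
    + assert (0 < INR N ^ 2) by nra. nra.
Qed.

(** * Limits of polynomials with positive roots *)

(** A bound on coefficients that is stable under differentiation and makes
    all the convergence below uniform on compact sets. *)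
Definition factorially_bounded (A : R) (c : nat -> R) : Prop :=
  forall m, Rabs (c m) <= A / INR (fact m).

Lemma ex_series_exp x : ex_series (fun m => x ^ m / INR (fact m)).
Proof.
  apply ex_series_ext with (fun n => scal (pow_n x n) (/ INR (fact n))).
  - intros n. rewrite pow_n_pow. reflexivity.
  - exists (exp x). apply is_exp_Reals.
Qed.

Lemma factorially_bounded_disk A c r : factorially_bounded A c ->
  ex_series (fun m => Rabs (c m * r ^ m)).
Proof.
  intros H. apply (@ex_series_le R_AbsRing R_CompleteNormedModule) with (fun m => A * (Rabs r ^ m / INR (fact m))).
  - intros m. unfold norm; simpl; unfold abs; simpl. rewrite Rabs_Rabsolu, Rabs_mult, <- RPow_abs.
    pose proof (H m). unfold Rdiv in *. 
    replace (A * (Rabs r ^ m * / INR (fact m))) with ((A * / INR (fact m)) * Rabs r ^ m) by ring.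
    apply Rmult_le_compat_r; [apply pow_le, Rabs_pos|assumption].
  - apply (@ex_series_scal_l R_AbsRing). apply ex_series_exp.
Qed.

Lemma CV_radius_ge_disk c r : ex_series (fun m => Rabs (c m * r ^ m)) -> Rbar_le r (CV_radius c).
Proof.
  intros H. destruct (Lub_Rbar_correct (CV_disk c)) as [U _]. apply U. exact H.
Qed.

Lemma factorially_bounded_radius A c : factorially_bounded A c -> CV_radius c = p_infty.
Proof.
  intros H. assert (G : forall r : R, Rbar_le r (CV_radius c)).
  { intros r. apply CV_radius_ge_disk. apply (factorially_bounded_disk A); assumption. }
  destruct (CV_radius c) as [l| |]; [|reflexivity|].
  - specialize (G (l + 1)). simpl in G. lra.
  - specialize (G 0). simpl in G. contradiction.
Qed.

Lemma factorially_bounded_derive A c :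
  factorially_bounded A c -> factorially_bounded A (PS_derive c).
Proof.
  intros H m. unfold PS_derive. rewrite Rabs_mult.
  specialize (H (S m)). rewrite fact_simpl, mult_INR in H.
  rewrite (Rabs_pos_eq (INR (S m))) by apply pos_INR.
  assert (0 < INR (S m)) by (apply lt_0_INR; lia).
  assert (0 < INR (fact m)) by apply INR_fact_lt_0.
  replace (A / INR (fact m)) with (INR (S m) * (A / (INR (S m) * INR (fact m)))) by (field; lra).
  apply Rmult_le_compat_l; lra.
Qed.

Lemma factorially_bounded_lim A (c : nat -> nat -> R) (b : nat -> R) :
  (forall n, factorially_bounded A (c n)) -> (forall m, is_lim_seq (fun n => c n m) (b m)) ->
  factorially_bounded A b.
Proof.
  intros H L m.
  apply (is_lim_seq_le (fun n => Rabs (c n m)) (fun _ => A / INR (fact m)) (Rabs (b m)) (A / INR (fact m))).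
  - intros n. apply H.
  - apply (is_lim_seq_abs _ (b m)). apply L.
  - apply is_lim_seq_const.
Qed.

Lemma is_lim_seq_opp_finite (u : nat -> R) (l : R) :
  is_lim_seq u l -> is_lim_seq (fun n => - u n) (- l).
Proof. intros H. apply (is_lim_seq_opp u l). exact H. Qed.

Lemma sum_f_R0_lim (u : nat -> nat -> R) (l : nat -> R) K :
  (forall m, (m <= K)%nat -> is_lim_seq (fun n => u n m) (l m)) ->
  is_lim_seq (fun n => sum_f_R0 (u n) K) (sum_f_R0 l K).
Proof.
  induction K as [|K IH]; intros H; cbn [sum_f_R0].
  - apply H. lia.
  - apply is_lim_seq_plus'; [apply IH; intros; apply H; lia|apply H; lia].
Qed.

(** Dominated convergence for series: the tail is controlled by the common
    bound, and finitely many coefficients converge. *)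
Lemma factorially_bounded_uniform A (c : nat -> nat -> R) (b : nat -> R) X eps :
  (forall n, factorially_bounded A (c n)) -> (forall m, is_lim_seq (fun n => c n m) (b m)) ->
  0 <= X -> 0 < eps ->
  exists n0, forall n, (n0 <= n)%nat -> forall x, Rabs x <= X ->
    Rabs (PSeries (c n) x - PSeries b x) < eps.
Proof.
  intros H L HX He.
  pose proof (factorially_bounded_lim A c b H L) as Hb.
  set (g := fun m => 2 * A * (X ^ m / INR (fact m))).
  assert (eg : ex_series g) by (apply (@ex_series_scal_l R_AbsRing), ex_series_exp).
  assert (tail : exists K, Rabs (Series (fun k => g (S K + k)%nat)) < eps / 2).
  { destruct eg as [l Hl].
    assert (Hl' : is_lim_seq (sum_n g) l) by exact Hl.
    apply is_lim_seq_spec in Hl'. destruct (Hl' (mkposreal (eps / 2) ltac:(lra))) as [K HK].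
    exists K. specialize (HK K (le_n K)). simpl in HK.
    rewrite sum_n_Reals in HK.
    assert (E : Series g = sum_f_R0 g K + Series (fun k => g (S K + k)%nat)).
    { rewrite (Series_incr_n g (S K)); [reflexivity|lia|exists l; exact Hl]. }
    rewrite (is_series_unique g l Hl) in E.
    replace (Series (fun k => g (S K + k)%nat)) with (- (sum_f_R0 g K - l)) by lra.
    rewrite Rabs_Ropp. exact HK. }
  destruct tail as [K HK].
  assert (fin : is_lim_seq (fun n => sum_f_R0 (fun m => Rabs (c n m - b m) * X ^ m) K) 0).
  { replace (Finite 0) with (Finite (sum_f_R0 (fun _ => 0) K)).
    - apply sum_f_R0_lim. intros m _.
      replace (Finite 0) with (Finite (Rabs (b m - b m) * X ^ m)).
      + apply is_lim_seq_mult'; [|apply is_lim_seq_const].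
        apply (is_lim_seq_abs _ (b m - b m)). apply is_lim_seq_minus'; [apply L|apply is_lim_seq_const].
      + rewrite Rminus_diag, Rabs_R0. f_equal. ring.
    - rewrite sum_cte. f_equal. ring. }
  apply is_lim_seq_spec in fin. destruct (fin (mkposreal (eps / 2) ltac:(lra))) as [n0 Hn0].
  exists n0. intros n Hn x Hx. specialize (Hn0 n Hn). simpl in Hn0. rewrite Rminus_0_r in Hn0.
  set (d := fun m => Rabs (c n m - b m) * X ^ m) in *.
  assert (dg : forall m, 0 <= d m <= g m).
  { intros m. unfold d, g. split; [apply Rmult_le_pos; [apply Rabs_pos|apply pow_le; lra]|].
    replace (2 * A * (X ^ m / INR (fact m))) with ((A / INR (fact m) + A / INR (fact m)) * X ^ m) by (unfold Rdiv; ring).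
    apply Rmult_le_compat_r; [apply pow_le; lra|].
    pose proof (H n m). pose proof (Hb m).
    unfold Rminus. eapply Rle_trans; [apply Rabs_triang|]. rewrite Rabs_Ropp. lra. }
  assert (ed : ex_series d).
  { apply (@ex_series_le R_AbsRing R_CompleteNormedModule) with g; [|exact eg].
    intros m. unfold norm; simpl; unfold abs; simpl. rewrite Rabs_pos_eq; apply dg. }
  assert (exc : ex_series (fun m => c n m * x ^ m)).
  { apply ex_series_Rabs. apply (factorially_bounded_disk A). apply H. }
  assert (exb : ex_series (fun m => b m * x ^ m)).
  { apply ex_series_Rabs. apply (factorially_bounded_disk A). apply Hb. }
  unfold PSeries. rewrite <- Series_minus by assumption.
  assert (cmp : forall m, 0 <= Rabs (c n m * x ^ m - b m * x ^ m) <= d m).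
  { intros m. split; [apply Rabs_pos|]. rewrite <- Rmult_minus_distr_r, Rabs_mult, <- RPow_abs.
    unfold d. apply Rmult_le_compat_l; [apply Rabs_pos|].
    apply pow_incr. split; [apply Rabs_pos|assumption]. }
  eapply Rle_lt_trans.
  { apply Series_Rabs. apply (@ex_series_le R_AbsRing R_CompleteNormedModule) with d; [|exact ed].
    intros m. unfold norm; simpl; unfold abs; simpl. rewrite Rabs_Rabsolu. apply cmp. }
  eapply Rle_lt_trans; [apply Series_le; [exact cmp|exact ed]|].
  rewrite (Series_incr_n d (S K)); [|lia|exact ed]. simpl pred.
  assert (Series (fun k => d (S K + k)%nat) <= Series (fun k => g (S K + k)%nat)).
  { apply Series_le; [intros; apply dg|]. apply (ex_series_incr_n g (S K)). exact eg. }
  pose proof (Rle_abs (Series (fun k => g (S K + k)%nat))).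
  pose proof (Rle_abs (sum_f_R0 d K)). lra.
Qed.

Lemma factorially_bounded_lim_value A (c : nat -> nat -> R) (b : nat -> R) x :
  (forall n, factorially_bounded A (c n)) -> (forall m, is_lim_seq (fun n => c n m) (b m)) ->
  is_lim_seq (fun n => PSeries (c n) x) (PSeries b x).
Proof.
  intros H L. apply is_lim_seq_spec. intros [eps He].
  destruct (factorially_bounded_uniform A c b (Rabs x) eps H L (Rabs_pos x) He) as [n0 Hn0].
  exists n0. intros n Hn. apply Hn0; [exact Hn|apply Rle_refl].
Qed.

Lemma PSeries_polynomial A c N x : factorially_bounded A c ->
  (forall m, (N < m)%nat -> c m = 0) -> PSeries c x = polynomial c N x.
Proof.
  intros H Hv. unfold PSeries, polynomial.
  rewrite (Series_incr_n _ (S N)).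
  - rewrite (Series_ext _ (fun _ => 0 * 0)).
    + rewrite Series_scal_l. simpl pred. ring.
    + intros k. rewrite Hv by lia. ring.
  - lia.
  - apply ex_series_Rabs. apply (factorially_bounded_disk A). exact H.
Qed.

(** Stage n of the recursion stores the first n values, so that the rule F has
    access to all of them. *)
Lemma course_of_values (F : nat -> (nat -> R) -> R) :
  (forall n g h, (forall i, (i < n)%nat -> g i = h i) -> F n g = F n h) ->
  exists s, forall n, s n = F n s.
Proof.
  intros HF.
  set (cov := fix cov (n : nat) : nat -> R :=
    match n with
    | O => fun _ => 0
    | S k => fun j => if Nat.ltb j k then cov k j else F k (cov k)
    end).
  assert (E : forall n j, (j < n)%nat -> cov n j = cov (S j) j).
  { induction n as [|n IH]; intros j Hj; [lia|].
    destruct (Nat.eq_dec j n) as [->|Hne]; [reflexivity|].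
    rewrite <- IH by lia. simpl. destruct (Nat.ltb_spec j n); [reflexivity|lia]. }
  exists (fun n => cov (S n) n). intros n. simpl cov at 1.
  rewrite Nat.ltb_irrefl. apply HF. intros i Hi. apply E. exact Hi.
Qed.

(** The recursion of the Cauchy product determines p from b continuously, so
    nonnegativity passes to the limit. For the partial sums, uniform
    convergence makes the approximating polynomials positive on [0,x] when the
    limit is, hence the inequality is available for them. *)
Theorem positive_rooted_limit A (c : nat -> nat -> R) (b : nat -> R) :
  (forall n, positive_rooted (c n)) -> (forall n, factorially_bounded A (c n)) ->
  (forall m, is_lim_seq (fun n => c n m) (b m)) ->
  exists p : nat -> R,
    (forall k, 0 <= p k) /\
    (forall n, INR (S n) * b (S n) = - PS_mult p b n) /\
    (forall x, 0 <= x -> (forall y, 0 <= y <= x -> 0 < PSeries b y) ->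
       forall M, sum_f_R0 (fun k => p k * x ^ k) M * PSeries b x <= - PSeries (PS_derive b) x).
Proof.
  intros Hc HA L.
  pose proof (factorially_bounded_lim A c b HA L) as Hb.
  assert (b0 : b O = 1).
  { assert (E : Finite (b O) = Finite 1); [|congruence].
    rewrite <- (is_lim_seq_unique _ _ (L O)). apply is_lim_seq_unique.
    apply is_lim_seq_ext with (fun _ => 1); [|apply is_lim_seq_const].
    intros n. symmetry. apply positive_rooted_start, Hc. }
  assert (Hq : forall n, exists p : nat -> R,
    (forall k, 0 <= p k) /\ (forall m, INR (S m) * c n (S m) = - PS_mult p (c n) m) /\
    (forall x, 0 <= x -> (forall y, 0 <= y <= x -> 0 < PSeries (c n) y) ->
       forall M, sum_f_R0 (fun k => p k * x ^ k) M * PSeries (c n) x <= - PSeries (PS_derive (c n)) x)).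
  { intros n. destruct (positive_rooted_log_derivative _ (Hc n)) as (p & f & f' & N & P1 & P2 & P3 & P4 & P5 & P6).
    assert (Ef : forall y, f y = PSeries (c n) y).
    { intros y. rewrite P4. symmetry. apply (PSeries_polynomial A); auto. }
    exists p. split; [exact P1|]. split; [exact P2|].
    intros x Hx Hpos M.
    replace (PSeries (PS_derive (c n)) x) with (f' x).
    - rewrite <- Ef. apply P6; [exact Hx|]. intros y Hy. rewrite Ef. apply Hpos, Hy.
    - rewrite <- Derive_PSeries by (rewrite (factorially_bounded_radius A); [exact I|apply HA]).
      symmetry. apply is_derive_unique. apply is_derive_ext with f; [exact Ef|apply P5]. }
  apply functional_choice in Hq. destruct Hq as [q Hq].
  destruct (course_of_values (fun n p =>
    - (INR (S n) * b (S n) + match n with O => 0 | S k => sum_f_R0 (fun i => p i * b (n - i)%nat) k end)))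
    as [p Hp].
  { intros n g h Hgh. do 2 f_equal. destruct n as [|k]; [reflexivity|].
    apply sum_eq. intros i Hi. rewrite Hgh by lia. reflexivity. }
  assert (Hlim : forall k, is_lim_seq (fun n => q n k) (p k)).
  { intros k. induction k as [k IH] using (well_founded_induction Wf_nat.lt_wf).
    rewrite Hp.
    apply is_lim_seq_ext with (fun n =>
      - (INR (S k) * c n (S k) + match k with O => 0 | S j => sum_f_R0 (fun i => q n i * c n (k - i)%nat) j end)).
    - intros n. destruct (Hq n) as (_ & Q & _). specialize (Q k). unfold PS_mult in Q.
      pose proof (positive_rooted_start _ (Hc n)) as c0.
      destruct k as [|j].
      + simpl in Q. rewrite c0 in Q. simpl. lra.
      + rewrite tech5 in Q. rewrite Nat.sub_diag, c0 in Q. lra.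
    - apply is_lim_seq_opp_finite.
      apply is_lim_seq_plus'.
      + apply is_lim_seq_mult'; [apply is_lim_seq_const|apply L].
      + destruct k as [|j]; [apply is_lim_seq_const|].
        apply sum_f_R0_lim. intros m Hm. apply is_lim_seq_mult'; [apply IH; lia|apply L]. }
  exists p. split; [|split].
  - intros k. apply (is_lim_seq_le (fun _ => 0) (fun n => q n k) 0 (p k)).
    + intros n. apply (Hq n).
    + apply is_lim_seq_const.
    + apply Hlim.
  - intros n. unfold PS_mult. pose proof (Hp n) as E. destruct n as [|k].
    + simpl. rewrite b0. simpl in E. lra.
    + rewrite tech5. rewrite Nat.sub_diag, b0. lra.
  - intros x Hx Hpos M.
    assert (Hmin : exists e, 0 < e /\ forall y, 0 <= y <= x -> e <= PSeries b y).
    { destruct (continuity_ab_min (PSeries b) 0 x Hx) as [m [Hm1 Hm2]].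
      - intros y _. apply PSeries_continuity. rewrite (factorially_bounded_radius A); [exact I|exact Hb].
      - exists (PSeries b m). split; [apply Hpos; exact Hm2|exact Hm1]. }
    destruct Hmin as [e [He Hmin]].
    destruct (factorially_bounded_uniform A c b x e HA L Hx He) as [n0 Hn0].
    apply (is_lim_seq_le_loc
      (fun n => sum_f_R0 (fun k => q n k * x ^ k) M * PSeries (c n) x)
      (fun n => - PSeries (PS_derive (c n)) x)
      (sum_f_R0 (fun k => p k * x ^ k) M * PSeries b x) (- PSeries (PS_derive b) x)).
    + exists n0. intros n Hn. apply (Hq n); [exact Hx|]. intros y Hy.
      specialize (Hn0 n Hn y). specialize (Hmin y Hy).
      rewrite (Rabs_pos_eq y) in Hn0 by lra. specialize (Hn0 ltac:(lra)).
      apply Rabs_def2 in Hn0. lra.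
    + apply is_lim_seq_mult'.
      * apply sum_f_R0_lim. intros m _. apply is_lim_seq_mult'; [apply Hlim|apply is_lim_seq_const].
      * apply (factorially_bounded_lim_value A); assumption.
    + apply is_lim_seq_opp_finite.
      apply (factorially_bounded_lim_value A).
      * intros n. apply factorially_bounded_derive, HA.
      * intros m. unfold PS_derive. apply is_lim_seq_mult'; [apply is_lim_seq_const|apply L].
Qed.

(** The coefficients of 1F2(1; 3/2, nu + 3/2; -w/4) in powers of w. *)
Definition struve_coef (nu : R) (m : nat) : R :=
  coef_1F2 1 (3 / 2) (nu + 3 / 2) m * (- / 4) ^ m.

Lemma pochhammer_pos a n : 0 < a -> 0 < pochhammer a n.
Proof.
  intros Ha. induction n as [|n IH]; simpl; [lra|].
  pose proof (pos_INR n). apply Rmult_lt_0_compat; lra.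
Qed.

Lemma struve_coef_step nu m : Rabs nu <= 1 / 2 ->
  struve_coef nu (S m)
  = struve_coef nu m * (- 1 / (4 * (3 / 2 + INR m) * (nu + 3 / 2 + INR m))).
Proof.
  intros Hnu. apply Rabs_le_between in Hnu. unfold struve_coef, coef_1F2.
  pose proof (pochhammer_pos (3 / 2) m ltac:(lra)).
  pose proof (pochhammer_pos (nu + 3 / 2) m ltac:(lra)).
  pose proof (INR_fact_lt_0 m). pose proof (pos_INR m).
  rewrite fact_simpl, mult_INR, S_INR. simpl pochhammer. simpl pow.
  field. repeat split; lra.
Qed.

(** Values in the open interval (0,1) that tend to nu + 1/2; strictly
    increasing weights need an interior value also when nu = 1/2 or -1/2. *)
Definition interior_lambda (nu : R) (n : nat) : R := nu + 1 / 2 - nu / (INR n + 2).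

Lemma interior_lambda_range nu n : Rabs nu <= 1 / 2 -> 0 < interior_lambda nu n < 1.
Proof.
  intros Hnu. apply Rabs_le_between in Hnu. unfold interior_lambda.
  pose proof (pos_INR n).
  assert (0 < / (INR n + 2) < 1).
  { split; [apply Rinv_0_lt_compat; lra|]. rewrite <- Rinv_1. apply Rinv_lt_contravar; lra. }
  unfold Rdiv. nra.
Qed.

Lemma lim_inv_INR_plus a : 0 <= a -> is_lim_seq (fun n => / (INR n + a)) 0.
Proof.
  intros Ha. replace (Finite 0) with (Rbar_inv p_infty) by reflexivity.
  apply is_lim_seq_inv; [|discriminate].
  apply (is_lim_seq_plus _ _ p_infty a); [apply is_lim_seq_INR|apply is_lim_seq_const|reflexivity].
Qed.

Lemma approximant_lim nu m : Rabs nu <= 1 / 2 ->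
  is_lim_seq (fun n => approximant (interior_lambda nu n) (S n) m) (struve_coef nu m).
Proof.
  intros Hnu. assert (Hnu' := Hnu). apply Rabs_le_between in Hnu'.
  assert (Ld : is_lim_seq (interior_lambda nu) (nu + 1 / 2)).
  { unfold interior_lambda. replace (Finite (nu + 1 / 2)) with (Finite (nu + 1 / 2 - nu * 0)) by (f_equal; ring).
    apply is_lim_seq_minus'; [apply is_lim_seq_const|].
    apply is_lim_seq_mult'; [apply is_lim_seq_const|apply lim_inv_INR_plus; lra]. }
  assert (Li : is_lim_seq (fun n => / INR (S n)) 0).
  { apply is_lim_seq_ext with (fun n => / (INR n + 1)); [intros n; rewrite S_INR; reflexivity|].
    apply lim_inv_INR_plus. lra. }
  induction m as [|m IH].
  - cbn [approximant]. replace (struve_coef nu 0) with 1; [apply is_lim_seq_const|].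
    unfold struve_coef, coef_1F2. simpl. field.
  - rewrite struve_coef_step by assumption. cbn [approximant]. pose proof (pos_INR m).
    apply is_lim_seq_mult'; [exact IH|].
    apply is_lim_seq_ext with (fun n =>
      - ((1 - INR m * / INR (S n)) * (1 + (interior_lambda nu n + (1 + INR m)) * / INR (S n)))
      / ((4 * (3 / 2 + INR m)) * (interior_lambda nu n + (1 + INR m)))).
    { intros n. pose proof (interior_lambda_range nu n Hnu).
      assert (0 < INR (S n)) by (apply lt_0_INR; lia). field. repeat split; lra. }
    replace (- 1 / (4 * (3 / 2 + INR m) * (nu + 3 / 2 + INR m)))
      with (- ((1 - INR m * 0) * (1 + (nu + 1 / 2 + (1 + INR m)) * 0)) / ((4 * (3 / 2 + INR m)) * (nu + 1 / 2 + (1 + INR m))))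
      by (field; repeat split; lra).
    apply is_lim_seq_div'.
    + apply is_lim_seq_opp_finite. apply is_lim_seq_mult'.
      * apply is_lim_seq_minus'; [apply is_lim_seq_const|].
        apply is_lim_seq_mult'; [apply is_lim_seq_const|exact Li].
      * apply is_lim_seq_plus'; [apply is_lim_seq_const|].
        apply is_lim_seq_mult'; [|exact Li].
        apply is_lim_seq_plus'; [exact Ld|apply is_lim_seq_const].
    + apply is_lim_seq_mult'; [apply is_lim_seq_const|].
      apply is_lim_seq_plus'; [exact Ld|apply is_lim_seq_const].
    + apply Rgt_not_eq, Rmult_lt_0_compat; lra.
Qed.

Lemma approximant_factorially_bounded nu n : Rabs nu <= 1 / 2 ->
  factorially_bounded 1 (approximant (interior_lambda nu n) (S n)).
Proof.
  intros H m. unfold Rdiv. rewrite Rmult_1_l.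
  apply approximant_bound; [apply interior_lambda_range, H|lia].
Qed.

Lemma struve_coef_factorially_bounded nu : Rabs nu <= 1 / 2 ->
  factorially_bounded 1 (struve_coef nu).
Proof.
  intros H. apply (factorially_bounded_lim _ (fun n => approximant (interior_lambda nu n) (S n))).
  - intros n. apply approximant_factorially_bounded, H.
  - intros m. apply approximant_lim, H.
Qed.

Theorem struve_log_derivative nu : Rabs nu <= 1 / 2 ->
  exists p : nat -> R,
    (forall k, 0 <= p k) /\
    (forall n, INR (S n) * struve_coef nu (S n) = - PS_mult p (struve_coef nu) n) /\
    (forall x, 0 <= x -> (forall y, 0 <= y <= x -> 0 < PSeries (struve_coef nu) y) ->
       forall M, sum_f_R0 (fun k => p k * x ^ k) M * PSeries (struve_coef nu) x
                 <= - PSeries (PS_derive (struve_coef nu)) x).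
Proof.
  intros H. apply (positive_rooted_limit 1 (fun n => approximant (interior_lambda nu n) (S n))).
  - intros n. apply approximant_positive_rooted; [apply interior_lambda_range, H|lia].
  - intros n. apply approximant_factorially_bounded, H.
  - intros m. apply approximant_lim, H.
Qed.

(** The approximants take negative values at points of [0, 4 pi^2], which a
    positive minimum of the limit on this interval would exclude. *)
Lemma struve_series_nonpos nu : Rabs nu <= 1 / 2 ->
  exists x, 0 <= x /\ PSeries (struve_coef nu) x <= 0.
Proof.
  intros H. destruct (Classical_Prop.classic (exists x, 0 <= x /\ PSeries (struve_coef nu) x <= 0)) as [E|E]; [exact E|exfalso].
  assert (Hpos : forall y, 0 <= y -> 0 < PSeries (struve_coef nu) y).
  { intros y Hy. destruct (Rlt_le_dec 0 (PSeries (struve_coef nu) y)) as [h|h]; [exact h|].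
    exfalso. apply E. exists y. split; assumption. }
  assert (HX : 0 <= 4 * PI ^ 2) by (pose proof (pow2_ge_0 PI); lra).
  destruct (continuity_ab_min (PSeries (struve_coef nu)) 0 (4 * PI ^ 2) HX) as [m [Hm1 Hm2]].
  - intros y _. apply PSeries_continuity.
    rewrite (factorially_bounded_radius 1); [exact I|apply struve_coef_factorially_bounded, H].
  - destruct (factorially_bounded_uniform 1 (fun n => approximant (interior_lambda nu n) (S n)) (struve_coef nu)
      (4 * PI ^ 2) (PSeries (struve_coef nu) m)) as [n0 Hn0].
    + intros n. apply approximant_factorially_bounded, H.
    + intros k. apply approximant_lim, H.
    + exact HX.
    + apply Hpos. apply Hm2.
    (* At index n0 the approximant differs from the limit by less than the
       minimum of the limit. *)
    + destruct (approximant_negative_value (interior_lambda nu n0) (S n0) (interior_lambda_range nu n0 H) ltac:(lia)) as [x [Hx1 Hx2]].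
      specialize (Hn0 n0 (le_n _) x). rewrite Rabs_pos_eq in Hn0 by lra.
      specialize (Hn0 (proj2 Hx1)). specialize (Hm1 x Hx1).
      rewrite (PSeries_polynomial 1 (approximant (interior_lambda nu n0) (S n0)) (S n0)) in Hn0.
      * apply Rabs_def2 in Hn0. lra.
      * apply approximant_factorially_bounded, H.
      * intros k. apply approximant_vanish.
Qed.

(** * Complex derivatives and the complex exponential *)

(** Complex differentiability with derivative l, for the topology given by
    the modulus, for which the general rules of differentiation hold. *)
Definition holomorphic_at (f : C -> C) (z l : C) : Prop :=
  @is_derive C_AbsRing (AbsRing_NormedModule C_AbsRing) f z l.

Lemma holomorphic_C_derive f z l : holomorphic_at f z l -> C_derive f z = l.
Proof.
  intros [_ H]. apply is_C_derive_unique. split.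
  - apply (@is_linear_scal_l C_AbsRing C_NormedModule).
  - exact H.
Qed.

Lemma holomorphic_at_intro f z (l : C) :
  (forall eps, 0 < eps -> exists d, 0 < d /\ forall h : C, Cmod h < d ->
     Cmod (f (z + h) - f z - l * h)%C <= eps * Cmod h) -> holomorphic_at f z l.
Proof.
  intros H. split; [apply is_linear_scal_l|].
  intros x Hx. apply (@is_filter_lim_locally_unique C_AbsRing (AbsRing_NormedModule C_AbsRing)) in Hx. subst x.
  intros [eps He]. destruct (H eps He) as [d [Hd Hh]]. exists (mkposreal d Hd).
  intros y Hy. change C in y. change (Cmod (y - z)%C < d) in Hy. specialize (Hh (y - z)%C Hy).
  simpl. replace (z + (y - z))%C with y in Hh by ring.
  change (Cmod (f y - f z - (y - z) * l)%C <= eps * Cmod (y - z)%C).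
  replace ((y - z) * l)%C with (l * (y - z))%C by ring. exact Hh.
Qed.

Lemma holomorphic_at_elim f z (l : C) : holomorphic_at f z l ->
  forall eps, 0 < eps -> exists d, 0 < d /\ forall h : C, Cmod h < d ->
     Cmod (f (z + h) - f z - l * h)%C <= eps * Cmod h.
Proof.
  intros [_ H] eps He. specialize (H z (fun P HP => HP) (mkposreal eps He)).
  destruct H as [[d Hd] H]. exists d. split; [exact Hd|]. intros h Hh.
  assert (E : (z + h - z = h)%C) by ring.
  specialize (H (z + h)%C).
  change (Cmod (z + h - z)%C < d -> Cmod (f (z + h)%C - f z - (z + h - z) * l)%C <= eps * Cmod (z + h - z)%C) in H.
  rewrite E in H. specialize (H Hh).
  replace (l * h)%C with (h * l)%C by ring. exact H.
Qed.

Lemma holomorphic_at_ext f g z l r : Cmod z < r ->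
  (forall y, Cmod y < r -> f y = g y) -> holomorphic_at f z l -> holomorphic_at g z l.
Proof.
  intros Hz E H. apply (@is_derive_ext_loc C_AbsRing (AbsRing_NormedModule C_AbsRing) f g z l); [|exact H].
  assert (P : 0 < r - Cmod z) by lra. exists (mkposreal _ P).
  intros y Hy. change C in y. change (Cmod (y - z)%C < r - Cmod z) in Hy. apply E.
  replace y with (z + (y - z))%C by ring.
  eapply Rle_lt_trans; [apply Cmod_triangle|]. lra.
Qed.

Lemma holomorphic_at_mult f g z df dg :
  holomorphic_at f z df -> holomorphic_at g z dg ->
  holomorphic_at (fun x => f x * g x)%C z (df * g z + f z * dg)%C.
Proof.
  intros Hf Hg. apply (@is_derive_mult C_AbsRing f g z df dg Hf Hg). apply Cmult_comm.
Qed.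

Lemma holomorphic_at_comp f g z df dg :
  holomorphic_at f (g z) df -> holomorphic_at g z dg ->
  holomorphic_at (fun x => f (g x)) z (dg * df)%C.
Proof. intros Hf Hg. apply (@is_derive_comp C_AbsRing (AbsRing_NormedModule C_AbsRing) f g z df dg Hf Hg). Qed.

Lemma holomorphic_at_plus f g z df dg :
  holomorphic_at f z df -> holomorphic_at g z dg ->
  holomorphic_at (fun x => f x + g x)%C z (df + dg)%C.
Proof. intros Hf Hg. apply (@is_derive_plus C_AbsRing (AbsRing_NormedModule C_AbsRing) f g z df dg Hf Hg). Qed.

Lemma holomorphic_at_id z : holomorphic_at (fun x => x) z 1%C.
Proof. apply (@is_derive_id C_AbsRing). Qed.

Lemma holomorphic_at_const c z : holomorphic_at (fun _ => c) z 0%C.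
Proof. apply (@is_derive_const C_AbsRing (AbsRing_NormedModule C_AbsRing)). Qed.

Lemma Re_minus x y : Re (x - y)%C = Re x - Re y. Proof. reflexivity. Qed.
Lemma Im_minus x y : Im (x - y)%C = Im x - Im y. Proof. reflexivity. Qed.

Lemma im_le_Cmod c : Rabs (Im c) <= Cmod c.
Proof. eapply Rle_trans; [|apply Rmax_Cmod]. apply Rmax_r. Qed.

(** Restriction to a ray reduces questions about complex functions on discs
    to functions of one real variable. *)
Lemma holomorphic_ray f z l (t : R) : holomorphic_at f (RtoC t * z)%C l ->
  is_derive (fun s => Re (f (RtoC s * z)%C)) t (Re (l * z)%C) /\
  is_derive (fun s => Im (f (RtoC s * z)%C)) t (Im (l * z)%C).
Proof.
  intros H. pose proof (holomorphic_at_elim _ _ _ H) as E.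
  assert (K : forall eps, 0 < eps -> exists d, 0 < d /\ forall h : R, Rabs h < d ->
     Cmod (f (RtoC (t + h) * z) - f (RtoC t * z) - RtoC h * (l * z))%C <= eps * Rabs h).
  { intros eps He. pose proof (Cmod_ge_0 z).
    assert (P1 : 0 < / (Cmod z + 1)) by (apply Rinv_0_lt_compat; lra).
    destruct (E (eps * / (Cmod z + 1)) ltac:(apply Rmult_lt_0_compat; lra)) as [d [Hd Hh]].
    exists (d * / (Cmod z + 1)). split; [apply Rmult_lt_0_compat; lra|].
    intros h Hlt. specialize (Hh (RtoC h * z)%C).
    rewrite Cmod_mult, Cmod_R in Hh.
    assert (Rabs h * Cmod z < d).
    { apply Rle_lt_trans with (Rabs h * (Cmod z + 1)).
      - apply Rmult_le_compat_l; [apply Rabs_pos|lra].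
      - apply Rmult_lt_reg_r with (/ (Cmod z + 1)); [exact P1|].
        rewrite Rmult_assoc, Rinv_r, Rmult_1_r by lra. exact Hlt. }
    specialize (Hh H1).
    rewrite RtoC_plus. replace ((RtoC t + RtoC h) * z)%C with (RtoC t * z + RtoC h * z)%C by ring.
    replace (RtoC h * (l * z))%C with (l * (RtoC h * z))%C by ring.
    eapply Rle_trans; [exact Hh|].
    replace (eps * Rabs h) with (eps * / (Cmod z + 1) * (Rabs h * (Cmod z + 1))) by (field; lra).
    apply Rmult_le_compat_l; [left; apply Rmult_lt_0_compat; lra|].
    apply Rmult_le_compat_l; [apply Rabs_pos|lra]. }
  split; apply is_derive_Reals; intros eps He; destruct (K (eps / 2) ltac:(lra)) as [d [Hd Hh]];
    exists (mkposreal d Hd); intros h Hne Hlt; simpl in Hlt; specialize (Hh h Hlt).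
  - pose proof (Rle_trans _ _ _ (re_le_Cmod _) Hh) as B.
    rewrite !Re_minus, re_scal_l in B.
    assert (0 < Rabs h) by (apply Rabs_pos_lt; exact Hne).
    set (A := Re (f (RtoC (t + h) * z)%C)) in *. set (A0 := Re (f (RtoC t * z)%C)) in *. set (L := Re (l * z)%C) in *.
    replace ((A - A0) / h - L) with ((A - A0 - h * L) / h) by (field; exact Hne).
    unfold Rdiv. rewrite Rabs_mult, Rabs_inv. apply Rmult_lt_reg_r with (Rabs h); [assumption|].
    rewrite Rmult_assoc, Rinv_l, Rmult_1_r by lra. nra.
  - pose proof (Rle_trans _ _ _ (im_le_Cmod _) Hh) as B.
    rewrite !Im_minus, im_scal_l in B.
    assert (0 < Rabs h) by (apply Rabs_pos_lt; exact Hne).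
    set (A := Im (f (RtoC (t + h) * z)%C)) in *. set (A0 := Im (f (RtoC t * z)%C)) in *. set (L := Im (l * z)%C) in *.
    replace ((A - A0) / h - L) with ((A - A0 - h * L) / h) by (field; exact Hne).
    unfold Rdiv. rewrite Rabs_mult, Rabs_inv. apply Rmult_lt_reg_r with (Rabs h); [assumption|].
    rewrite Rmult_assoc, Rinv_l, Rmult_1_r by lra. nra.
Qed.

Lemma holomorphic_constant f r : (forall z, Cmod z < r -> holomorphic_at f z 0%C) ->
  forall z, Cmod z < r -> f z = f 0%C.
Proof.
  intros H z Hz.
  assert (D : forall t, 0 <= t <= 1 -> holomorphic_at f (RtoC t * z)%C 0%C).
  { intros t Ht. apply H. rewrite Cmod_mult, Cmod_R, Rabs_pos_eq by lra.
    pose proof (Cmod_ge_0 z). nra. }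
  assert (cst : forall g : R -> R, (forall t, 0 <= t <= 1 -> is_derive g t 0) -> g 1 = g 0).
  { intros g Hg. destruct (MVT_gen g 0 1 (fun _ => 0)) as [c [_ E]].
    - rewrite Rmin_left, Rmax_right by lra. intros; apply Hg; lra.
    - rewrite Rmin_left, Rmax_right by lra. intros x Hx.
      apply continuity_pt_filterlim, @ex_derive_continuous. exists 0. apply Hg; lra.
    - lra. }
  assert (Hr : Re (f (RtoC 1 * z)%C) = Re (f (RtoC 0 * z)%C)).
  { apply (cst (fun s => Re (f (RtoC s * z)%C))). intros t Ht.
    destruct (holomorphic_ray f z 0%C t (D t Ht)) as [A _].
    replace 0 with (Re (0 * z)%C); [exact A|]. rewrite Cmult_0_l. reflexivity. }
  assert (Hi : Im (f (RtoC 1 * z)%C) = Im (f (RtoC 0 * z)%C)).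
  { apply (cst (fun s => Im (f (RtoC s * z)%C))). intros t Ht.
    destruct (holomorphic_ray f z 0%C t (D t Ht)) as [_ A].
    replace 0 with (Im (0 * z)%C); [exact A|]. rewrite Cmult_0_l. reflexivity. }
  rewrite Cmult_1_l, Cmult_0_l in Hr, Hi.
  apply injective_projections; assumption.
Qed.

Lemma Cexp_plus x y : Cexp (x + y)%C = (Cexp x * Cexp y)%C.
Proof.
  unfold Cexp. rewrite re_plus, im_plus, exp_plus, cos_plus, sin_plus.
  apply injective_projections; simpl; ring.
Qed.

Lemma Cexp_0 : Cexp 0%C = 1%C.
Proof. unfold Cexp. simpl. rewrite exp_0, cos_0, sin_0. apply injective_projections; simpl; ring. Qed.

Lemma Cmod_Cexp z : Cmod (Cexp z) = exp (Re z).
Proof.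
  unfold Cexp, Cmod. simpl fst. simpl snd.
  replace ((exp (Re z) * cos (Im z)) ^ 2 + (exp (Re z) * sin (Im z)) ^ 2)
    with (exp (Re z) ^ 2 * ((sin (Im z))² + (cos (Im z))²)) by (unfold Rsqr; ring).
  rewrite sin2_cos2, Rmult_1_r. apply sqrt_pow2. left. apply exp_pos.
Qed.

Lemma Cexp_neq_0 z : Cexp z <> 0%C.
Proof. apply Cmod_gt_0. rewrite Cmod_Cexp. apply exp_pos. Qed.

Lemma Cexp_neg z : (Cexp z * Cexp (- z))%C = 1%C.
Proof. rewrite <- Cexp_plus. replace (z + - z)%C with (RtoC 0) by ring. apply Cexp_0. Qed.

Lemma Clog_Cexp z : Rabs (Im z) < PI / 2 -> Clog (Cexp z) = z.
Proof.
  intros H. apply Rabs_def2 in H. unfold Clog. rewrite Cmod_Cexp, ln_exp.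
  assert (c : 0 < cos (Im z)) by (apply cos_gt_0; lra).
  pose proof (exp_pos (Re z)).
  replace (Carg (Cexp z)) with (Im z); [apply injective_projections; reflexivity|].
  unfold Carg, Cexp. simpl Re. simpl Im.
  destruct (Rlt_dec 0 (exp (Re z) * cos (Im z))) as [h|h].
  - replace (exp (Re z) * sin (Im z) / (exp (Re z) * cos (Im z))) with (tan (Im z)).
    + symmetry. apply atan_tan. lra.
    + unfold tan. field. split; lra.
  - exfalso. apply h. apply Rmult_lt_0_compat; lra.
Qed.

Lemma Cmod_le_sum x y : Cmod (x, y) <= Rabs x + Rabs y.
Proof.
  unfold Cmod. simpl fst. simpl snd. pose proof (Rabs_pos x). pose proof (Rabs_pos y).
  apply Rsqr_incr_0_var; [|lra]. rewrite Rsqr_sqrt by nra.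
  rewrite <- (pow2_abs x), <- (pow2_abs y). unfold Rsqr. nra.
Qed.

Lemma small_quotient (f : R -> R) l : is_derive f 0 l -> forall eps, 0 < eps ->
  exists d, 0 < d /\ forall h, Rabs h < d -> Rabs (f h - f 0 - l * h) <= eps * Rabs h.
Proof.
  intros H eps He. apply is_derive_Reals in H. destruct (H eps He) as [[d Hd] Hh].
  exists d. split; [exact Hd|]. intros h Hlt.
  destruct (Req_dec h 0) as [->|Hne].
  - replace (f 0 - f 0 - l * 0) with 0 by ring. rewrite !Rabs_R0. lra.
  - specialize (Hh h Hne Hlt). rewrite Rplus_0_l in Hh.
    replace (f h - f 0 - l * h) with (((f h - f 0) / h - l) * h) by (field; exact Hne).
    rewrite Rabs_mult. apply Rmult_le_compat_r; [apply Rabs_pos|lra].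
Qed.

(** The functional equation reduces the claim to z = 0, where it amounts to
    the first order expansions of exp, cos and sin. *)
Lemma holomorphic_Cexp z : holomorphic_at Cexp z (Cexp z).
Proof.
  assert (H0 : holomorphic_at Cexp 0%C 1%C).
  { apply holomorphic_at_intro. intros eps He.
    destruct (small_quotient exp 1 ltac:(evar_last; [apply is_derive_exp|apply exp_0]) (Rmin (eps / 16) 1) ltac:(apply Rmin_glb_lt; lra)) as [d1 [P1 Q1]].
    destruct (small_quotient cos 0 ltac:(evar_last; [apply is_derive_cos|rewrite sin_0; apply Ropp_0]) (Rmin (eps / 16) 1) ltac:(apply Rmin_glb_lt; lra)) as [d2 [P2 Q2]].
    destruct (small_quotient sin 1 ltac:(evar_last; [apply is_derive_sin|apply cos_0]) (Rmin (eps / 16) 1) ltac:(apply Rmin_glb_lt; lra)) as [d3 [P3 Q3]].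
    set (d := Rmin (Rmin d1 d2) (Rmin d3 (Rmin (eps / 16) 1))).
    assert (B : d <= d1 /\ d <= d2 /\ d <= d3 /\ d <= eps / 16 /\ d <= 1).
    { unfold d. pose proof (Rmin_l d1 d2). pose proof (Rmin_r d1 d2).
      pose proof (Rmin_l (Rmin d1 d2) (Rmin d3 (Rmin (eps / 16) 1))).
      pose proof (Rmin_r (Rmin d1 d2) (Rmin d3 (Rmin (eps / 16) 1))).
      pose proof (Rmin_l d3 (Rmin (eps / 16) 1)). pose proof (Rmin_r d3 (Rmin (eps / 16) 1)).
      pose proof (Rmin_l (eps / 16) 1). pose proof (Rmin_r (eps / 16) 1). lra. }
    exists d. split; [unfold d; repeat apply Rmin_glb_lt; lra|].
    intros h Hh. rewrite Cexp_0, Cplus_0_l.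
    pose proof (re_le_Cmod h) as Rh. pose proof (im_le_Cmod h) as Ih.
    destruct h as [x y]. simpl in Rh, Ih. set (m := Cmod (x, y)) in *.
    pose proof (Rabs_pos x). pose proof (Rabs_pos y).
    specialize (Q1 x ltac:(lra)). specialize (Q2 y ltac:(lra)). specialize (Q3 y ltac:(lra)).
    rewrite exp_0 in Q1. rewrite cos_0 in Q2. rewrite sin_0 in Q3.
    pose proof (Rmin_l (eps / 16) 1) as M1. pose proof (Rmin_r (eps / 16) 1) as M2.
    set (a := exp x - 1 - 1 * x) in *. set (b := cos y - 1 - 0 * y) in *. set (c := sin y - 0 - 1 * y) in *.
    assert (Ha : Rabs a <= eps / 16 * m) by nra.
    assert (Hb : Rabs b <= eps / 16 * m) by nra.
    assert (Hc : Rabs c <= eps / 16 * m) by nra.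
    assert (He3 : Rabs (exp x - 1) <= 2 * m).
    { replace (exp x - 1) with (a + x) by (unfold a; ring).
      eapply Rle_trans; [apply Rabs_triang|]. nra. }
    assert (Hsin : Rabs (sin y) <= 2 * m).
    { replace (sin y) with (c + y) by (unfold c; ring).
      eapply Rle_trans; [apply Rabs_triang|]. nra. }
    replace (Cexp (x, y) - 1 - 1 * (x, y))%C
       with ((a + b + (exp x - 1) * b, c + (exp x - 1) * sin y) : C)
      by (unfold Cexp, a, b, c; apply injective_projections; simpl; ring).
    eapply Rle_trans; [apply Cmod_le_sum|].
    pose proof (Rabs_triang (a + b) ((exp x - 1) * b)) as T1. pose proof (Rabs_triang a b) as T2.
    pose proof (Rabs_triang c ((exp x - 1) * sin y)) as T3.
    rewrite Rabs_mult in T1, T3.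
    pose proof (Rabs_pos (exp x - 1)). pose proof (Rabs_pos b). pose proof (Rabs_pos (sin y)).
    assert (m0 : 0 <= m) by lra.
    assert (Rabs (exp x - 1) * Rabs b <= 2 * (eps / 16 * m)) by (apply Rmult_le_compat; lra).
    assert (Rabs (exp x - 1) * Rabs (sin y) <= (2 * m) * (2 * m)) by (apply Rmult_le_compat; lra).
    nra. }
  apply holomorphic_at_intro. intros eps He.
  pose proof (exp_pos (Re z)) as Pz.
  destruct (holomorphic_at_elim _ _ _ H0 (eps / exp (Re z)) ltac:(apply Rdiv_lt_0_compat; lra)) as [d [Hd Hh]].
  exists d. split; [exact Hd|]. intros h Hlt. specialize (Hh h Hlt).
  rewrite Cplus_0_l, Cexp_0 in Hh. rewrite Cexp_plus.
  replace (Cexp z * Cexp h - Cexp z - Cexp z * h)%C with (Cexp z * (Cexp h - 1 - 1 * h))%C by ring.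
  rewrite Cmod_mult, Cmod_Cexp.
  replace (eps * Cmod h) with (exp (Re z) * (eps / exp (Re z) * Cmod h)) by (field; lra).
  apply Rmult_le_compat_l; lra.
Qed.

(** * Complex power series with real coefficients *)

Definition Cseries (t : nat -> C) : C :=
  (Series (fun n => Re (t n)), Series (fun n => Im (t n))).

Definition abs_summable (t : nat -> C) : Prop := ex_series (fun n => Cmod (t n)).

Lemma abs_summable_le t (g : nat -> R) :
  (forall n, Cmod (t n) <= g n) -> ex_series g -> abs_summable t.
Proof.
  intros H E. apply (@ex_series_le R_AbsRing R_CompleteNormedModule) with g; [|exact E].
  intros n. unfold norm; simpl; unfold abs; simpl. rewrite Rabs_pos_eq; [apply H|apply Cmod_ge_0].
Qed.

Lemma abs_summable_Re t : abs_summable t -> ex_series (fun n => Rabs (Re (t n))).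
Proof.
  intros E. apply (@ex_series_le R_AbsRing R_CompleteNormedModule) with (fun n => Cmod (t n)); [|exact E].
  intros n. unfold norm; simpl; unfold abs; simpl. rewrite Rabs_Rabsolu. apply re_le_Cmod.
Qed.

Lemma abs_summable_Im t : abs_summable t -> ex_series (fun n => Rabs (Im (t n))).
Proof.
  intros E. apply (@ex_series_le R_AbsRing R_CompleteNormedModule) with (fun n => Cmod (t n)); [|exact E].
  intros n. unfold norm; simpl; unfold abs; simpl. rewrite Rabs_Rabsolu. apply im_le_Cmod.
Qed.

Lemma Cseries_ext s t : (forall n, s n = t n) -> Cseries s = Cseries t.
Proof.
  intros H. unfold Cseries. f_equal; apply Series_ext; intros n; rewrite H; reflexivity.
Qed.

(** Projecting on the direction (A, B) of the sum reduces the triangle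
    inequality to real series: A Re t + B Im t <= |A + iB| |t| termwise, and
    the left sides add up to |A + iB|^2. *)
Lemma Cseries_norm t : abs_summable t -> Cmod (Cseries t) <= Series (fun n => Cmod (t n)).
Proof.
  intros H. pose proof (ex_series_Rabs _ (abs_summable_Re _ H)) as Er.
  pose proof (ex_series_Rabs _ (abs_summable_Im _ H)) as Ei.
  set (m := Cmod (Cseries t)). set (A := Series (fun n => Re (t n))). set (B := Series (fun n => Im (t n))).
  assert (m2 : m * m = A * A + B * B).
  { unfold m. replace (Cmod (Cseries t) * Cmod (Cseries t)) with (Cmod (Cseries t) ^ 2) by ring.
    rewrite Cmod2_alt. unfold Cseries. simpl. fold A B. ring. }
  pose proof (Cmod_ge_0 (Cseries t)) as m0. fold m in m0.
  assert (S0 : 0 <= Series (fun n => Cmod (t n))).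
  { replace 0 with (Series (fun n => 0 * 0)).
    - apply Series_le; [|exact H]. intros n. rewrite Rmult_0_l. split; [lra|apply Cmod_ge_0].
    - rewrite Series_scal_l. ring. }
  destruct (Req_dec m 0) as [->|Hne]; [exact S0|].
  apply Rmult_le_reg_l with m; [lra|]. rewrite m2. unfold A, B.
  rewrite <- !Series_scal_l. rewrite <- Series_plus.
  2:{ apply (@ex_series_scal_l R_AbsRing). exact Er. }
  2:{ apply (@ex_series_scal_l R_AbsRing). exact Ei. }
  fold A B.
  assert (E2 : ex_series (fun n => m * Cmod (t n))) by (apply (@ex_series_scal_l R_AbsRing); exact H).
  assert (cmp : forall n, Rabs (A * Re (t n) + B * Im (t n)) <= m * Cmod (t n)).
  { intros n. apply Rsqr_incr_0_var; [|apply Rmult_le_pos; [lra|apply Cmod_ge_0]].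
    rewrite <- Rsqr_abs, Rsqr_mult. unfold Rsqr at 2. rewrite m2.
    replace ((Cmod (t n))²) with (Cmod (t n) ^ 2) by (unfold Rsqr; ring).
    rewrite Cmod2_alt. unfold Rsqr.
    pose proof (pow2_ge_0 (A * Im (t n) - B * Re (t n))). nra. }
  eapply Rle_trans; [apply Rle_abs|]. eapply Rle_trans; [apply Series_Rabs|].
  - apply (@ex_series_le R_AbsRing R_CompleteNormedModule) with (fun n => m * Cmod (t n)); [|exact E2].
    intros n. unfold norm; simpl; unfold abs; simpl. rewrite Rabs_Rabsolu. apply cmp.
  - apply Series_le; [|exact E2]. intros n. split; [apply Rabs_pos|apply cmp].
Qed.

Lemma Cseries_plus s t : abs_summable s -> abs_summable t ->
  Cseries (fun n => s n + t n)%C = (Cseries s + Cseries t)%C.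
Proof.
  intros Hs Ht. unfold Cseries. apply injective_projections; simpl; rewrite <- Series_plus;
    try reflexivity; apply ex_series_Rabs; try apply abs_summable_Re; try apply abs_summable_Im; assumption.
Qed.

Lemma Cseries_scal c t : abs_summable t ->
  Cseries (fun n => c * t n)%C = (c * Cseries t)%C.
Proof.
  intros Ht. pose proof (ex_series_Rabs _ (abs_summable_Re _ Ht)) as Er.
  pose proof (ex_series_Rabs _ (abs_summable_Im _ Ht)) as Ei.
  unfold Cseries. apply injective_projections; simpl.
  - rewrite <- !Series_scal_l, <- Series_minus.
    + reflexivity.
    + apply (@ex_series_scal_l R_AbsRing). exact Er.
    + apply (@ex_series_scal_l R_AbsRing). exact Ei.
  - rewrite <- !Series_scal_l, <- Series_plus.
    + reflexivity.
    + apply (@ex_series_scal_l R_AbsRing). exact Ei.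
    + apply (@ex_series_scal_l R_AbsRing). exact Er.
Qed.

Lemma abs_summable_scal c t : abs_summable t -> abs_summable (fun n => c * t n)%C.
Proof.
  intros H. apply ex_series_ext with (fun n => Cmod c * Cmod (t n)).
  - intros n. symmetry. apply Cmod_mult.
  - apply (@ex_series_scal_l R_AbsRing). exact H.
Qed.

Lemma abs_summable_plus s t : abs_summable s -> abs_summable t ->
  abs_summable (fun n => s n + t n)%C.
Proof.
  intros Hs Ht. apply abs_summable_le with (fun n => Cmod (s n) + Cmod (t n)).
  - intros n. apply Cmod_triangle.
  - apply (@ex_series_plus R_AbsRing); assumption.
Qed.

Lemma abs_summable_shift t : abs_summable t -> abs_summable (fun n => t (S n)).
Proof. intros H. apply (ex_series_incr_1 (fun n => Cmod (t n))). exact H. Qed.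

Lemma Cseries_incr t : abs_summable t -> Cseries t = (t O + Cseries (fun n => t (S n)))%C.
Proof.
  intros H. unfold Cseries. apply injective_projections; simpl; apply Series_incr_1;
   apply ex_series_Rabs; [apply abs_summable_Re|apply abs_summable_Im]; assumption.
Qed.

Fixpoint Csum (t : nat -> C) (n : nat) : C :=
  match n with
  | O => t O
  | S k => (Csum t k + t (S k))%C
  end.

Lemma Re_Csum t n : Re (Csum t n) = sum_f_R0 (fun k => Re (t k)) n.
Proof. induction n as [|n IH]; [reflexivity|]. simpl. rewrite <- IH. reflexivity. Qed.

Lemma Im_Csum t n : Im (Csum t n) = sum_f_R0 (fun k => Im (t k)) n.
Proof. induction n as [|n IH]; [reflexivity|]. simpl. rewrite <- IH. reflexivity. Qed.

(** Real and imaginary parts are combinations of four real Cauchy products. *)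
Lemma Cseries_mult s t : abs_summable s -> abs_summable t ->
  Cseries (fun n => Csum (fun k => s k * t (n - k)%nat) n)%C = (Cseries s * Cseries t)%C.
Proof.
  intros Hs Ht.
  pose proof (abs_summable_Re _ Hs) as R1. pose proof (abs_summable_Im _ Hs) as I1.
  pose proof (abs_summable_Re _ Ht) as R2. pose proof (abs_summable_Im _ Ht) as I2.
  assert (M : forall a b, ex_series (fun n => Rabs (a n)) -> ex_series (fun n => Rabs (b n)) ->
     is_series (fun n => sum_f_R0 (fun k => a k * b (n - k)%nat) n) (Series a * Series b)).
  { intros a b Ha Hb. apply is_series_mult; try assumption; apply Series_correct, ex_series_Rabs; assumption. }
  pose proof (M _ _ R1 R2) as RR. pose proof (M _ _ I1 I2) as II.
  pose proof (M _ _ R1 I2) as RI. pose proof (M _ _ I1 R2) as IR.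
  apply injective_projections.
  - change (Series (fun n => Re (Csum (fun k => s k * t (n - k)%nat) n)%C)
      = Series (fun n => Re (s n)) * Series (fun n => Re (t n)) - Series (fun n => Im (s n)) * Series (fun n => Im (t n))).
    apply is_series_unique.
    apply is_series_ext with (2 := is_series_minus _ _ _ _ RR II).
    intros n. rewrite Re_Csum. unfold plus, opp; simpl.
    rewrite (sum_eq (fun k => Re (s k * t (n - k)%nat)%C) (fun k => Re (s k) * Re (t (n - k)%nat) - Im (s k) * Im (t (n - k)%nat))).
    + rewrite minus_sum. reflexivity.
    + intros i _. apply re_mult.
  - change (Series (fun n => Im (Csum (fun k => s k * t (n - k)%nat) n)%C)
      = Series (fun n => Re (s n)) * Series (fun n => Im (t n)) + Series (fun n => Im (s n)) * Series (fun n => Re (t n))).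
    apply is_series_unique.
    apply is_series_ext with (2 := is_series_plus _ _ _ _ RI IR).
    intros n. rewrite Im_Csum. unfold plus; simpl.
    rewrite (sum_eq (fun k => Im (s k * t (n - k)%nat)%C) (fun k => Re (s k) * Im (t (n - k)%nat) + Im (s k) * Re (t (n - k)%nat))).
    + rewrite sum_plus. reflexivity.
    + intros i _. apply im_mult.
Qed.

Definition real_cps (a : nat -> R) : C -> C := CPSeries (fun n => RtoC (a n)).

Lemma real_cps_Cseries a z : real_cps a z = Cseries (fun n => RtoC (a n) * z ^ n)%C.
Proof. reflexivity. Qed.

Lemma Cmod_term a z n : Cmod (RtoC (a n) * z ^ n)%C = Rabs (a n * Cmod z ^ n).
Proof.
  rewrite Cmod_mult, Cmod_pow, Cmod_R, Rabs_mult. f_equal. symmetry. apply Rabs_pos_eq, pow_le, Cmod_ge_0.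
Qed.

Lemma real_cps_summable a z : Rbar_lt (Cmod z) (CV_radius a) ->
  abs_summable (fun n => RtoC (a n) * z ^ n)%C.
Proof.
  intros H. unfold abs_summable. apply ex_series_ext with (fun n => Rabs (a n * Cmod z ^ n)).
  - intros n. symmetry. apply Cmod_term.
  - apply CV_disk_inside. rewrite Rabs_pos_eq by apply Cmod_ge_0. exact H.
Qed.

Lemma real_cps_ext a b z : (forall n, a n = b n) -> real_cps a z = real_cps b z.
Proof. intros H. apply Cseries_ext. intros n. rewrite H. reflexivity. Qed.

Lemma real_cps_bound a b z : Rbar_lt (Cmod z) (CV_radius b) -> (forall n, Rabs (a n) <= b n) ->
  Cmod (real_cps a z) <= PSeries b (Cmod z).
Proof.
  intros H Hab. rewrite real_cps_Cseries.
  assert (E : ex_series (fun n => b n * Cmod z ^ n)).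
  { apply ex_series_ext with (fun n => Rabs (b n * Cmod z ^ n)).
    - intros n. apply Rabs_pos_eq. apply Rmult_le_pos; [|apply pow_le, Cmod_ge_0].
      eapply Rle_trans; [apply Rabs_pos|apply Hab].
    - apply CV_disk_inside. rewrite Rabs_pos_eq by apply Cmod_ge_0. exact H. }
  assert (cmp : forall n, Cmod (RtoC (a n) * z ^ n)%C <= b n * Cmod z ^ n).
  { intros n. rewrite Cmod_mult, Cmod_pow, Cmod_R.
    apply Rmult_le_compat_r; [apply pow_le, Cmod_ge_0|apply Hab]. }
  eapply Rle_trans; [apply Cseries_norm|].
  - apply abs_summable_le with (1 := cmp). exact E.
  - apply Series_le; [|exact E]. intros n. split; [apply Cmod_ge_0|apply cmp].
Qed.

Lemma real_cps_R a x : real_cps a (RtoC x) = RtoC (PSeries a x).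
Proof.
  assert (E : forall n, (RtoC (a n) * RtoC x ^ n)%C = RtoC (a n * x ^ n)).
  { intros n. rewrite RtoC_mult, RtoC_pow. reflexivity. }
  rewrite real_cps_Cseries, (Cseries_ext _ _ E). apply injective_projections; [reflexivity|].
  change (Series (fun _ => 0) = 0).
  rewrite (Series_ext _ (fun _ => 0 * 0)) by (intros; ring). rewrite Series_scal_l. ring.
Qed.

Lemma real_cps_0 a : real_cps a 0%C = RtoC (a O).
Proof. rewrite real_cps_R, PSeries_0. reflexivity. Qed.

Lemma real_cps_scal c a z : Rbar_lt (Cmod z) (CV_radius a) ->
  real_cps (fun n => c * a n) z = (RtoC c * real_cps a z)%C.
Proof.
  intros H. rewrite !real_cps_Cseries, <- Cseries_scal by (apply real_cps_summable, H).
  apply Cseries_ext. intros n. rewrite RtoC_mult. ring.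
Qed.

Lemma real_cps_mult a b z : Rbar_lt (Cmod z) (CV_radius a) -> Rbar_lt (Cmod z) (CV_radius b) ->
  real_cps (PS_mult a b) z = (real_cps a z * real_cps b z)%C.
Proof.
  intros Ha Hb. rewrite !real_cps_Cseries, <- Cseries_mult by (apply real_cps_summable; assumption).
  apply Cseries_ext. intros n. unfold PS_mult.
  assert (E : forall m, (m <= n)%nat -> (RtoC (sum_f_R0 (fun k => a k * b (n - k)%nat)%R m) * z ^ n)%C
     = Csum (fun k => RtoC (a k) * z ^ k * (RtoC (b (n - k)%nat) * z ^ (n - k)))%C m).
  { intros m. induction m as [|m IH]; intros Hm; cbn [sum_f_R0 Csum].
    - rewrite RtoC_mult, Nat.sub_0_r. simpl. ring.
    - rewrite <- IH by lia. rewrite RtoC_plus, RtoC_mult.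
      replace (z ^ n)%C with (z ^ S m * z ^ (n - S m))%C.
      + ring.
      + rewrite <- Cpow_add_r. f_equal. lia. }
  apply E. apply le_n.
Qed.

Lemma real_cps_shift a z : Rbar_lt (Cmod z) (CV_radius a) ->
  real_cps (PS_incr_1 a) z = (z * real_cps a z)%C.
Proof.
  intros H. rewrite (real_cps_Cseries (PS_incr_1 a)), Cseries_incr.
  - unfold PS_incr_1 at 1. rewrite Cmult_0_l, Cplus_0_l.
    rewrite real_cps_Cseries, <- Cseries_scal by (apply real_cps_summable, H).
    apply Cseries_ext. intros n. simpl. ring.
  - apply real_cps_summable. rewrite CV_radius_incr_1. exact H.
Qed.

(** The remainder D_n of (z+h)^n satisfies
    D_(n+1) = (z+h) D_n + n z^(n-1) h^2; the index starts at 2, where the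
    remainder first differs from 0. *)
Lemma power_remainder z h s k : Cmod z <= s -> Cmod (z + h)%C <= s ->
  Cmod ((z + h) ^ S (S k) - z ^ S (S k) - RtoC (INR (S (S k))) * z ^ S k * h)%C
  <= Cmod h ^ 2 * (INR (S (S k)) * INR (S k) * s ^ k).
Proof.
  intros Hz Hzh. pose proof (Cmod_ge_0 z) as z0. pose proof (Cmod_ge_0 h) as h0.
  induction k as [|k IH].
  - replace ((z + h) ^ 2 - z ^ 2 - RtoC (INR 2) * z ^ 1 * h)%C with (h ^ 2)%C.
    + rewrite Cmod_pow. simpl INR. simpl. nra.
    + simpl INR. rewrite RtoC_plus. simpl. ring.
  - set (D := ((z + h) ^ S (S k) - z ^ S (S k) - RtoC (INR (S (S k))) * z ^ S k * h)%C) in *.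
    replace ((z + h) ^ S (S (S k)) - z ^ S (S (S k)) - RtoC (INR (S (S (S k)))) * z ^ S (S k) * h)%C
      with ((z + h) * D + RtoC (INR (S (S k))) * z ^ S k * h ^ 2)%C.
    2:{ unfold D. rewrite (S_INR (S (S k))), RtoC_plus. 
        change (z ^ S (S (S k)))%C with (z * (z * z ^ S k))%C. change (z ^ S (S k))%C with (z * z ^ S k)%C.
        change ((z + h) ^ S (S (S k)))%C with ((z + h) * (z + h) ^ S (S k))%C. 
        simpl (h ^ 2)%C. ring. }
    eapply Rle_trans; [apply Cmod_triangle|].
    rewrite !Cmod_mult, !Cmod_pow, Cmod_R, Rabs_pos_eq by apply pos_INR.
    assert (s0 : 0 <= s) by lra.
    assert (A : Cmod (z + h)%C * Cmod D <= s * (Cmod h ^ 2 * (INR (S (S k)) * INR (S k) * s ^ k))).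
    { apply Rmult_le_compat; [apply Cmod_ge_0|apply Cmod_ge_0|exact Hzh|exact IH]. }
    assert (B : Cmod z ^ S k <= s ^ S k) by (apply pow_incr; lra).
    pose proof (pow_le s k s0). pose proof (pow_le s (S k) s0).
    pose proof (pos_INR k). pose proof (pow2_ge_0 (Cmod h)).
    assert (Bm : INR (S (S k)) * Cmod z ^ S k * Cmod h ^ 2 <= INR (S (S k)) * s ^ S k * Cmod h ^ 2).
    { apply Rmult_le_compat_r; [assumption|]. apply Rmult_le_compat_l; [apply pos_INR|exact B]. }
    eapply Rle_trans; [apply Rplus_le_compat; [exact A|exact Bm]|].
    simpl (s ^ S k). rewrite !S_INR.
    replace (s * (Cmod h ^ 2 * ((INR k + 1 + 1) * (INR k + 1) * s ^ k)) + (INR k + 1 + 1) * (s * s ^ k) * Cmod h ^ 2)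
      with (Cmod h ^ 2 * (s * s ^ k) * ((INR k + 1 + 1) * (INR k + 1 + 1))) by ring.
    replace (Cmod h ^ 2 * ((INR k + 1 + 1 + 1) * (INR k + 1 + 1) * (s * s ^ k)))
      with (Cmod h ^ 2 * (s * s ^ k) * ((INR k + 1 + 1 + 1) * (INR k + 1 + 1))) by ring.
    apply Rmult_le_compat_l; [|nra]. apply Rmult_le_pos; [assumption|]. simpl in *; assumption.
Qed.

Lemma Rbar_lt_between (x : R) (R0 : Rbar) : Rbar_lt x R0 -> exists s : R, x < s /\ Rbar_lt s R0.
Proof.
  destruct R0 as [l| |]; simpl; intros H.
  - exists ((x + l) / 2). lra.
  - exists (x + 1). split; [lra|exact I].
  - contradiction.
Qed.

(** Termwise differentiation: the remainders add up to at most |h|^2 times the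
    series of the second derivative at a radius s between |z| and the radius
    of convergence. *)
Lemma real_cps_holomorphic a z : Rbar_lt (Cmod z) (CV_radius a) ->
  holomorphic_at (real_cps a) z (real_cps (PS_derive a) z).
Proof.
  intros H. destruct (Rbar_lt_between _ _ H) as [s [Hs Hr]].
  pose proof (Cmod_ge_0 z) as z0.
  set (dd := fun n => Rabs (PS_derive (PS_derive a) n) * s ^ n).
  assert (Edd : ex_series dd).
  { apply ex_series_ext with (fun n => Rabs (PS_derive (PS_derive a) n * s ^ n)).
    - intros n. unfold dd. rewrite Rabs_mult. f_equal. apply Rabs_pos_eq, pow_le. lra.
    - apply CV_disk_inside. rewrite !CV_radius_derive, Rabs_pos_eq by lra. exact Hr. }
  set (K := Series dd).
  assert (K0 : 0 <= K).
  { replace 0 with (Series (fun n => 0 * 0)) by (rewrite Series_scal_l; ring).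
    apply Series_le; [|exact Edd]. intros n. rewrite Rmult_0_l. split; [lra|].
    apply Rmult_le_pos; [apply Rabs_pos|apply pow_le; lra]. }
  assert (main : forall h, Cmod h < s - Cmod z ->
     Cmod (real_cps a (z + h) - real_cps a z - real_cps (PS_derive a) z * h)%C <= Cmod h ^ 2 * K).
  { intros h Hh.
    assert (Hzh : Cmod (z + h)%C <= s) by (eapply Rle_trans; [apply Cmod_triangle|lra]).
    assert (Hzh' : Rbar_lt (Cmod (z + h)%C) (CV_radius a)) by (eapply Rbar_le_lt_trans; [|exact Hr]; exact Hzh).
    pose proof (real_cps_summable _ _ H) as S1. pose proof (real_cps_summable _ _ Hzh') as S2.
    assert (S3 : abs_summable (fun n => RtoC (PS_derive a n) * z ^ n)%C).
    { apply real_cps_summable. rewrite CV_radius_derive. exact H. }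
    rewrite !real_cps_Cseries.
    rewrite (Cseries_incr _ S2), (Cseries_incr _ S1).
    apply abs_summable_shift in S1. apply abs_summable_shift in S2.
    pose proof S3 as S3'.
    set (d := fun n => (RtoC (a (S (S n))) * ((z + h) ^ S (S n) - z ^ S (S n) - RtoC (INR (S (S n))) * z ^ S n * h))%C).
    set (e := fun n => (RtoC (a (S n)) * (z + h) ^ S n + (RtoC (-1) * (RtoC (a (S n)) * z ^ S n)
                + (- h) * (RtoC (PS_derive a n) * z ^ n)))%C).
    assert (Se : abs_summable e).
    { unfold e. apply abs_summable_plus; [exact S2|]. apply abs_summable_plus; apply abs_summable_scal; assumption. }
    replace (RtoC (a O) * (z + h) ^ 0 + Cseries (fun n => RtoC (a (S n)) * (z + h) ^ S n) -
       (RtoC (a O) * z ^ 0 + Cseries (fun n => RtoC (a (S n)) * z ^ S n)) -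
       Cseries (fun n => RtoC (PS_derive a n) * z ^ n) * h)%C
      with (Cseries e).
    2:{ unfold e. rewrite Cseries_plus; [|exact S2|apply abs_summable_plus; apply abs_summable_scal; assumption].
        rewrite Cseries_plus; [|apply abs_summable_scal; assumption|apply abs_summable_scal; assumption].
        rewrite !Cseries_scal by assumption. simpl (_ ^ 0)%C. ring. }
    rewrite (Cseries_incr _ Se).
    assert (e0 : e O = 0%C).
    { unfold e, PS_derive. rewrite RtoC_mult. simpl INR. simpl. ring. }
    rewrite e0, Cplus_0_l.
    assert (ed : forall n, e (S n) = d n).
    { intros n. unfold e, d, PS_derive. rewrite RtoC_mult. ring. }
    rewrite (Cseries_ext _ d ed).
    assert (cmp : forall n, Cmod (d n) <= Cmod h ^ 2 * dd n).
    { intros n. unfold d. rewrite Cmod_mult, Cmod_R.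
      replace (Cmod h ^ 2 * dd n) with (Rabs (a (S (S n))) * (Cmod h ^ 2 * (INR (S (S n)) * INR (S n) * s ^ n))).
      - apply Rmult_le_compat_l; [apply Rabs_pos|]. apply power_remainder; [lra|exact Hzh].
      - unfold dd, PS_derive. rewrite !Rabs_mult, !(Rabs_pos_eq (INR _)) by apply pos_INR. ring. }
    assert (E : ex_series (fun n => Cmod h ^ 2 * dd n)) by (apply (@ex_series_scal_l R_AbsRing); exact Edd).
    eapply Rle_trans; [apply Cseries_norm; apply abs_summable_le with (1 := cmp); exact E|].
    unfold K. rewrite <- Series_scal_l. apply Series_le; [|exact E].
    intros n. split; [apply Cmod_ge_0|apply cmp]. }
  apply holomorphic_at_intro. intros eps He.
  assert (P1 : 0 < / (K + 1)) by (apply Rinv_0_lt_compat; lra).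
  exists (Rmin (s - Cmod z) (eps * / (K + 1))). split.
  - apply Rmin_glb_lt; [lra|apply Rmult_lt_0_compat; lra].
  - intros h Hh.
    pose proof (Rmin_l (s - Cmod z) (eps * / (K + 1))). pose proof (Rmin_r (s - Cmod z) (eps * / (K + 1))).
    eapply Rle_trans; [apply main; lra|]. pose proof (Cmod_ge_0 h).
    replace (Cmod h ^ 2 * K) with (Cmod h * K * Cmod h) by ring.
    apply Rmult_le_compat_r; [assumption|].
    assert (Cmod h * (K + 1) <= eps * / (K + 1) * (K + 1)) by (apply Rmult_le_compat_r; lra).
    rewrite Rmult_assoc, Rinv_l, Rmult_1_r in H3 by lra. nra.
Qed.

Definition PS_derive_iter (n : nat) (a : nat -> R) : nat -> R := Nat.iter n PS_derive a.

Lemma PS_derive_iter_0 n : forall a, PS_derive_iter n a O = INR (fact n) * a n.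
Proof.
  assert (G : forall m a, PS_derive_iter n a m * INR (fact m) = INR (fact (m + n)) * a (m + n)%nat).
  { induction n as [|n IH]; intros m a.
    - simpl. rewrite Nat.add_0_r. ring.
    - change (PS_derive_iter (S n) a m) with (INR (S m) * PS_derive_iter n a (S m)).
      replace (m + S n)%nat with (S m + n)%nat by lia. rewrite <- IH.
      rewrite fact_simpl, mult_INR. ring. }
  intros a. specialize (G O a). simpl in G. rewrite <- G. ring.
Qed.

Lemma C_derive_n_local f a r : 0 < r -> Rbar_le r (CV_radius a) ->
  (forall z, Cmod z < r -> f z = real_cps a z) ->
  forall n z, Cmod z < r -> C_derive_n f n z = real_cps (PS_derive_iter n a) z.
Proof.
  intros Hr Ha Hf n. 
  assert (rad : forall n, Rbar_le r (CV_radius (PS_derive_iter n a))).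
  { induction n0 as [|k IH]; [exact Ha|]. simpl. rewrite CV_radius_derive. exact IH. }
  induction n as [|n IH]; intros z Hz; [apply Hf, Hz|].
  simpl. apply holomorphic_C_derive.
  apply holomorphic_at_ext with (real_cps (PS_derive_iter n a)) r; [exact Hz| |].
  - intros y Hy. symmetry. apply IH, Hy.
  - apply real_cps_holomorphic. eapply Rbar_lt_le_trans; [|apply rad]. exact Hz.
Qed.

(** Iterated derivatives at 0 depend only on the germ, so a function that
    agrees near 0 with a power series has its coefficients. *)
Lemma taylor_local f a r : 0 < r -> Rbar_le r (CV_radius a) ->
  (forall z, Cmod z < r -> f z = real_cps a z) -> forall n, taylor f n = RtoC (a n).
Proof.
  intros Hr Ha Hf n. unfold taylor.
  rewrite (C_derive_n_local f a r Hr Ha Hf n 0%C) by (rewrite Cmod_0; exact Hr).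
  rewrite real_cps_0, PS_derive_iter_0, RtoC_mult.
  field. intros E. apply RtoC_inj in E. exact (INR_fact_neq_0 n E).
Qed.

(** * Exponentials of power series *)

Lemma CV_radius_ge_bounded a r : (exists M, forall n, Rabs (a n * r ^ n) <= M) ->
  Rbar_le r (CV_radius a).
Proof. intros H. destruct (CV_radius_bounded a) as [U _]. apply U. exact H. Qed.

Lemma CV_radius_inside_bounded a r : 0 <= r -> Rbar_lt r (CV_radius a) ->
  exists M, 0 < M /\ forall n, Rabs (a n * r ^ n) <= M.
Proof.
  intros Hr H. assert (E : ex_series (fun n => Rabs (a n * r ^ n))).
  { apply CV_disk_inside. rewrite Rabs_pos_eq by exact Hr. exact H. }
  apply ex_series_lim_0 in E.
  destruct (filterlim_bounded (fun n => Rabs (a n * r ^ n))) as [M HM].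
  { exists 0. exact E. }
  exists (Rmax M 1). split; [eapply Rlt_le_trans; [apply Rlt_0_1|apply Rmax_r]|].
  intros n. specialize (HM n). unfold norm in HM; simpl in HM; unfold abs in HM; simpl in HM.
  rewrite Rabs_Rabsolu in HM. eapply Rle_trans; [exact HM|apply Rmax_l].
Qed.

Lemma Rbar_le_approx (H : R) (l : Rbar) :
  0 < H -> (forall x, 0 < x < H -> Rbar_le x l) -> Rbar_le H l.
Proof.
  intros HH Hx. destruct l as [l| |]; simpl.
  - destruct (Rle_lt_dec H l) as [h|h]; [exact h|exfalso].
    specialize (Hx ((Rmax 0 l + H) / 2)). simpl in Hx.
    assert (Rmax 0 l < H) by (apply Rmax_lub_lt; lra).
    pose proof (Rmax_l 0 l). pose proof (Rmax_r 0 l). specialize (Hx ltac:(lra)). lra.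
  - exact I.
  - exact (Hx (H / 2) ltac:(lra)).
Qed.

(** A sequence with G_(n+1) <= G_n (1 + C/(n+1)) grows like n^C, in
    particular more slowly than any geometric sequence. *)
Lemma growth_subgeometric (G : nat -> R) C t : 0 <= C -> 1 < t ->
  (forall n, 0 <= G n <= G (S n)) -> (forall n, G (S n) <= G n * (1 + C / INR (S n))) ->
  exists K, forall n, G n <= K * t ^ n.
Proof.
  intros HC Ht Hmono Hstep.
  assert (N1 : exists n1, forall n, (n1 <= n)%nat -> C / INR (S n) <= t - 1).
  { destruct (INR_unbounded (C / (t - 1))) as [n1 Hn1]. exists n1. intros n Hn.
    assert (INR n1 <= INR n) by (apply le_INR; exact Hn).
    rewrite S_INR. pose proof (pos_INR n).
    apply Rmult_le_reg_r with (INR n + 1); [lra|].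
    unfold Rdiv. rewrite Rmult_assoc, Rinv_l, Rmult_1_r by lra.
    apply Rmult_lt_compat_r with (r := t - 1) in Hn1; [|lra].
    unfold Rdiv in Hn1. rewrite Rmult_assoc, Rinv_l, Rmult_1_r in Hn1 by lra. nra. }
  destruct N1 as [n1 Hn1]. exists (G n1).
  assert (mono : forall k n, G n <= G (n + k)%nat).
  { induction k as [|k IH]; intros n; [rewrite Nat.add_0_r; lra|].
    rewrite Nat.add_succ_r. eapply Rle_trans; [apply IH|apply Hmono]. }
  assert (T1 : forall k, 1 <= t ^ k) by (intros; apply pow_R1_Rle; lra).
  assert (up : forall k, G (n1 + k)%nat <= G n1 * t ^ k).
  { induction k as [|k IH]; [rewrite Nat.add_0_r; simpl; lra|].
    rewrite Nat.add_succ_r. eapply Rle_trans; [apply Hstep|].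
    specialize (Hn1 (n1 + k)%nat ltac:(lia)). pose proof (proj1 (Hmono (n1 + k)%nat)).
    apply Rle_trans with (G (n1 + k)%nat * t); [apply Rmult_le_compat_l; lra|].
    simpl. rewrite <- Rmult_assoc, (Rmult_comm (G n1 * t)), <- Rmult_assoc, (Rmult_comm (t ^ k)).
    apply Rmult_le_compat_r; lra. }
  intros n. destruct (Nat.le_gt_cases n1 n) as [Hn|Hn].
  - replace n with (n1 + (n - n1))%nat at 1 by lia. eapply Rle_trans; [apply up|].
    apply Rmult_le_compat_l; [apply Hmono|]. apply Rle_pow; [lra|lia].
  - apply Rle_trans with (G n1).
    + replace n1 with (n + (n1 - n))%nat by lia. apply mono.
    + pose proof (proj1 (Hmono n1)). specialize (T1 n). nra.
Qed.

(** A solution e of e' = e s converges wherever s does. For x < y < H the sums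
    G_n of |e_j| y^j over j <= n satisfy G_(n+1) <= G_n (1 + C/(n+1)), so
    |e_n| x^n is bounded. *)
Lemma exp_series_radius (e s : nat -> R) (H : R) : 0 < H -> Rbar_le H (CV_radius s) ->
  (forall n, PS_derive e n = PS_mult e s n) -> Rbar_le H (CV_radius e).
Proof.
  intros HH Hs He. apply Rbar_le_approx; [exact HH|]. intros x Hx.
  set (y := (x + H) / 2). assert (Hy : x < y < H) by (unfold y; lra).
  destruct (CV_radius_inside_bounded s y ltac:(lra)) as [M [M0 HM]].
  { eapply Rbar_lt_le_trans; [|exact Hs]. simpl; lra. }
  set (g := fun n => Rabs (e n) * y ^ n). set (G := sum_f_R0 g).
  assert (g0 : forall n, 0 <= g n).
  { intros n. apply Rmult_le_pos; [apply Rabs_pos|apply pow_le; lra]. }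
  assert (G0 : forall n, 0 <= G n) by (intros n; apply cond_pos_sum, g0).
  (* M bounds |s_k| y^k, whence C = y M. *)
  destruct (growth_subgeometric G (y * M) (y / x)) as [K HK].
  - apply Rmult_le_pos; lra.
  - apply Rmult_lt_reg_r with x; [lra|]. unfold Rdiv. rewrite Rmult_assoc, Rinv_l by lra. lra.
  - intros n. split; [apply G0|]. unfold G. rewrite tech5. specialize (g0 (S n)). lra.
  - intros n. unfold G at 1. rewrite tech5. fold (G n).
    assert (pS : 0 < INR (S n)) by (apply lt_0_INR; lia).
    assert (B : g (S n) <= G n * (y * M) / INR (S n)); [|unfold Rdiv in *; lra].
    apply Rmult_le_reg_l with (INR (S n)); [exact pS|].
    replace (INR (S n) * (G n * (y * M) / INR (S n))) with (y * (M * G n)) by (field; lra).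
    unfold g. replace (INR (S n) * (Rabs (e (S n)) * y ^ S n)) with (y * (Rabs (PS_derive e n) * y ^ n)).
    2:{ unfold PS_derive. rewrite Rabs_mult, (Rabs_pos_eq (INR (S n))) by lra. simpl. ring. }
    apply Rmult_le_compat_l; [lra|]. rewrite He. unfold PS_mult.
    eapply Rle_trans; [apply Rmult_le_compat_r; [apply pow_le; lra|apply Rsum_abs]|].
    unfold G. rewrite Rmult_comm, scal_sum, scal_sum. apply sum_Rle. intros k Hk.
    rewrite Rabs_mult. unfold g. specialize (HM (n - k)%nat).
    rewrite Rabs_mult, (Rabs_pos_eq (y ^ (n - k))) in HM by (apply pow_le; lra).
    replace (y ^ n) with (y ^ k * y ^ (n - k)) by (rewrite <- pow_add; f_equal; lia).
    replace (Rabs (e k) * Rabs (s (n - k)%nat) * (y ^ k * y ^ (n - k)))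
      with (Rabs (e k) * y ^ k * (Rabs (s (n - k)%nat) * y ^ (n - k))) by ring.
    apply Rmult_le_compat_l; [apply g0|exact HM].
  - apply CV_radius_ge_bounded. exists K. intros n.
    assert (gn : g n <= G n).
    { unfold G. destruct n as [|n]; [simpl; lra|]. rewrite tech5. specialize (G0 n). unfold G in G0. lra. }
    specialize (HK n). rewrite Rabs_mult, (Rabs_pos_eq (x ^ n)) by (apply pow_le; lra).
    unfold g in gn. assert (yn : 0 < y ^ n) by (apply pow_lt; lra). assert (xn : 0 < x ^ n) by (apply pow_lt; lra).
    apply Rmult_le_reg_r with (y ^ n / x ^ n); [apply Rdiv_lt_0_compat; assumption|].
    replace (Rabs (e n) * x ^ n * (y ^ n / x ^ n)) with (Rabs (e n) * y ^ n) by (field; lra).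
    replace (y ^ n / x ^ n) with ((y / x) ^ n); [lra|].
    unfold Rdiv. rewrite Rpow_mult_distr, pow_inv. reflexivity.
Qed.

Lemma exp_series_exists (s : nat -> R) :
  exists e, e O = 1 /\ forall n, PS_derive e n = PS_mult e s n.
Proof.
  destruct (course_of_values (fun n e => match n with O => 1 | S k => PS_mult e s k / INR (S k) end)) as [e He].
  - intros [|n] g h Hgh; [reflexivity|]. f_equal. unfold PS_mult. apply sum_eq.
    intros i Hi. rewrite Hgh by lia. reflexivity.
  - exists e. split; [apply He|]. intros n. unfold PS_derive. rewrite (He (S n)). field.
    apply not_0_INR. lia.
Qed.

(** Both sides solve e' = e s with value 1 at 0: the product of e and
    exp(-int s) has derivative 0. *)
Lemma exp_series_value (e s : nat -> R) (H : R) : Rbar_le H (CV_radius s) -> Rbar_le H (CV_radius e) ->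
  e O = 1 -> (forall n, PS_derive e n = PS_mult e s n) ->
  forall w, Cmod w < H -> real_cps e w = Cexp (real_cps (PS_Int s) w).
Proof.
  intros Hs He e0 Hode.
  set (F := fun w => (real_cps e w * Cexp (RtoC (-1) * real_cps (PS_Int s) w))%C).
  assert (ltS : forall w, Cmod w < H -> Rbar_lt (Cmod w) (CV_radius s)).
  { intros w Hw. eapply Rbar_lt_le_trans; [|exact Hs]. exact Hw. }
  assert (ltE : forall w, Cmod w < H -> Rbar_lt (Cmod w) (CV_radius e)).
  { intros w Hw. eapply Rbar_lt_le_trans; [|exact He]. exact Hw. }
  assert (D : forall w, Cmod w < H -> holomorphic_at F w 0%C).
  { intros w Hw.
    assert (dL : holomorphic_at (real_cps (PS_Int s)) w (real_cps s w)).
    { replace (real_cps s w) with (real_cps (PS_derive (PS_Int s)) w).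
      - apply real_cps_holomorphic. rewrite CV_radius_Int. apply ltS, Hw.
      - apply real_cps_ext. intros n. unfold PS_derive, PS_Int. field. apply not_0_INR. lia. }
    assert (dE : holomorphic_at (real_cps e) w (real_cps e w * real_cps s w)%C).
    { rewrite <- real_cps_mult by auto.
      replace (real_cps (PS_mult e s) w) with (real_cps (PS_derive e) w) by (apply real_cps_ext, Hode).
      apply real_cps_holomorphic, ltE, Hw. }
    assert (dm : holomorphic_at (fun x => RtoC (-1) * real_cps (PS_Int s) x)%C w (RtoC (-1) * real_cps s w)%C).
    { replace (RtoC (-1) * real_cps s w)%C with (0 * real_cps (PS_Int s) w + RtoC (-1) * real_cps s w)%C by ring.
      apply (holomorphic_at_mult (fun _ => RtoC (-1))); [apply holomorphic_at_const|exact dL]. }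
    pose proof (holomorphic_at_comp Cexp _ w _ _ (holomorphic_Cexp _) dm) as dX.
    pose proof (holomorphic_at_mult _ _ w _ _ dE dX) as dF.
    match type of dF with holomorphic_at _ _ ?l => replace (RtoC 0) with l by ring end.
    exact dF. }
  intros w Hw. pose proof (holomorphic_constant F H D w Hw) as E.
  unfold F in E. rewrite (real_cps_0 e), (real_cps_0 (PS_Int s)), e0 in E.
  simpl (PS_Int s 0) in E. rewrite Cmult_0_r, Cexp_0, Cmult_1_l in E.
  set (X := real_cps (PS_Int s) w) in *.
  assert (I : (Cexp X * Cexp (RtoC (-1) * X))%C = 1%C).
  { replace (RtoC (-1) * X)%C with (- X)%C by ring. apply Cexp_neg. }
  transitivity (real_cps e w * (Cexp X * Cexp (RtoC (-1) * X)))%C; [rewrite I; ring|].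
  transitivity (Cexp X * (real_cps e w * Cexp (RtoC (-1) * X)))%C; [ring|]. rewrite E. ring.
Qed.

(** * Series with nonnegative logarithmic derivative *)

(** An entire function b with b(0) = 1 and a zero at H > 0, whose logarithmic
    derivative -p has coefficients of constant sign and converges up to H. It
    follows that b has no zero in the open disc |w| < H. *)
Record log_derivative_data (b p : nat -> R) (H : R) : Prop := {
  ld_pos : 0 < H;
  ld_start : b O = 1;
  ld_entire : CV_radius b = p_infty;
  ld_nonneg : forall k, 0 <= p k;
  ld_first : 0 < p O;
  ld_radius : Rbar_le H (CV_radius p);
  ld_ode : forall n, PS_derive b n = PS_mult b (fun k => - p k) n;
  ld_zero : PSeries b H = 0
}.

Lemma Cexp_R t : Cexp (RtoC t) = RtoC (exp t).
Proof. unfold Cexp. simpl. rewrite cos_0, sin_0. apply injective_projections; simpl; ring. Qed.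

Lemma PSeries_nonneg_ex a x : (forall n, 0 <= a n) -> 0 <= x -> Rbar_lt x (CV_radius a) ->
  ex_series (fun n => a n * x ^ n).
Proof.
  intros Ha Hx Hr. apply ex_series_Rabs. apply CV_disk_inside. rewrite Rabs_pos_eq by exact Hx. exact Hr.
Qed.

Lemma PSeries_le_nonneg a b x y : (forall n, 0 <= a n <= b n) -> 0 <= x <= y ->
  Rbar_lt y (CV_radius b) -> PSeries a x <= PSeries b y.
Proof.
  intros Hab Hx Hr. unfold PSeries. apply Series_le.
  - intros n. split.
    + apply Rmult_le_pos; [apply Hab|apply pow_le; lra].
    + apply Rmult_le_compat; [apply Hab|apply pow_le; lra|apply Hab|apply pow_incr; lra].
  - apply PSeries_nonneg_ex; [intros n; eapply Rle_trans; apply Hab|lra|exact Hr].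
Qed.

Lemma PSeries_ge_start a x : (forall n, 0 <= a n) -> 0 <= x -> Rbar_lt x (CV_radius a) ->
  a O <= PSeries a x.
Proof.
  intros Ha Hx Hr. rewrite <- (PSeries_0 a) at 1. apply PSeries_le_nonneg; [|lra|exact Hr].
  intros n. split; [apply Ha|apply Rle_refl].
Qed.

Section LogDerivative.

Context (b p : nat -> R) (H kappa : R) (D : log_derivative_data b p H) (kappa_pos : 0 < kappa).

Let HH := ld_pos _ _ _ D.
Let p_nonneg := ld_nonneg _ _ _ D.

Lemma inside_p x : x < H -> Rbar_lt x (CV_radius p).
Proof. intros Hx. eapply Rbar_lt_le_trans; [|apply (ld_radius _ _ _ D)]. exact Hx. Qed.

Lemma log_series_radius c : Rbar_le H (CV_radius (fun k => c * p k)).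
Proof.
  destruct (Req_dec c 0) as [->|Hc].
  - rewrite (CV_radius_ext _ (fun _ => 0)) by (intros; ring). rewrite CV_radius_const_0. exact I.
  - change (fun k => c * p k) with (PS_scal c p). rewrite CV_radius_scal by exact Hc. apply (ld_radius _ _ _ D).
Qed.

Lemma log_value w : Cmod w < H ->
  real_cps b w = Cexp (real_cps (PS_Int (fun k => - 1 * p k)) w).
Proof.
  intros Hw. apply exp_series_value with H; [apply log_series_radius| |apply (ld_start _ _ _ D)| |exact Hw].
  - rewrite (ld_entire _ _ _ D). exact I.
  - intros n. rewrite (ld_ode _ _ _ D). unfold PS_mult. apply sum_eq. intros; ring.
Qed.

Lemma log_value_R x : 0 <= x < H ->
  PSeries b x = exp (PSeries (PS_Int (fun k => - 1 * p k)) x).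
Proof.
  intros Hx. apply RtoC_inj. rewrite <- Cexp_R, <- !real_cps_R. apply log_value.
  rewrite Cmod_R, Rabs_pos_eq by lra. lra.
Qed.

(** The series q such that f(z) = z b(z^2)^kappa has z f'/f = 1 - q(z^2), so
    that q = 1 marks the first critical point of f on the positive axis. *)
Definition starlike_defect : nat -> R := PS_incr_1 (fun k => 2 * kappa * p k).

Lemma starlike_defect_nonneg n : 0 <= starlike_defect n.
Proof.
  destruct n as [|n]; simpl; [apply Rle_refl|]. apply Rmult_le_pos; [lra|apply p_nonneg].
Qed.

Lemma starlike_defect_radius : Rbar_le H (CV_radius starlike_defect).
Proof. unfold starlike_defect. rewrite CV_radius_incr_1. apply log_series_radius. Qed.

Lemma inside_defect x : x < H -> Rbar_lt x (CV_radius starlike_defect).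
Proof. intros Hx. eapply Rbar_lt_le_trans; [|apply starlike_defect_radius]. exact Hx. Qed.

Lemma inside_defect_derive x : x < H -> Rbar_lt x (CV_radius (PS_derive starlike_defect)).
Proof. rewrite CV_radius_derive. apply inside_defect. Qed.

Lemma starlike_defect_derive_nonneg n : 0 <= PS_derive starlike_defect n.
Proof. apply Rmult_le_pos; [apply pos_INR|apply starlike_defect_nonneg]. Qed.

Lemma starlike_defect_value w : Cmod w < H ->
  real_cps starlike_defect w = (RtoC (2 * kappa) * (w * real_cps p w))%C.
Proof.
  intros Hw. unfold starlike_defect. rewrite real_cps_shift.
  - rewrite real_cps_scal by (apply inside_p, Hw). ring.
  - eapply Rbar_lt_le_trans; [|apply log_series_radius]. exact Hw.
Qed.

Lemma starlike_defect_value_R x : 0 <= x < H -> PSeries starlike_defect x = 2 * kappa * (x * PSeries p x).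
Proof.
  intros Hx. apply RtoC_inj. rewrite !RtoC_mult, <- !real_cps_R, starlike_defect_value, RtoC_mult; [reflexivity|].
  rewrite Cmod_R, Rabs_pos_eq by lra. lra.
Qed.

Lemma starlike_defect_incr x y : 0 <= x < y -> y < H -> PSeries starlike_defect x < PSeries starlike_defect y.
Proof.
  intros Hx Hy. rewrite !starlike_defect_value_R by lra.
  apply Rmult_lt_compat_l; [lra|].
  assert (PSeries p x <= PSeries p y).
  { apply PSeries_le_nonneg; [|lra|apply inside_p; lra]. intros n. split; [apply p_nonneg|lra]. }
  assert (p O <= PSeries p x) by (apply PSeries_ge_start; [apply p_nonneg|lra|apply inside_p; lra]).
  pose proof (ld_first _ _ _ D). nra.
Qed.

Lemma starlike_defect_0 : PSeries starlike_defect 0 = 0.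
Proof. rewrite PSeries_0. reflexivity. Qed.

Lemma starlike_defect_derive_pos x : 0 <= x < H -> 0 < PSeries (PS_derive starlike_defect) x.
Proof.
  intros Hx. apply Rlt_le_trans with (PS_derive starlike_defect 0).
  - unfold PS_derive, starlike_defect. simpl. pose proof (ld_first _ _ _ D). nra.
  - apply PSeries_ge_start; [apply starlike_defect_derive_nonneg|lra|apply inside_defect_derive; lra].
Qed.

Lemma starlike_defect_derive_mono x y : 0 <= x <= y -> y < H ->
  PSeries (PS_derive starlike_defect) x <= PSeries (PS_derive starlike_defect) y.
Proof.
  intros Hx Hy. apply PSeries_le_nonneg; [|lra|apply inside_defect_derive; lra].
  intros n. split; [apply starlike_defect_derive_nonneg|lra].
Qed.

Lemma starlike_defect_continuous x : 0 <= x < H -> continuity_pt (PSeries starlike_defect) x.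
Proof.
  intros Hx. apply PSeries_continuity. rewrite Rabs_pos_eq by lra. apply inside_defect. lra.
Qed.

Lemma starlike_defect_derive_continuous x : 0 <= x < H -> continuity_pt (PSeries (PS_derive starlike_defect)) x.
Proof.
  intros Hx. apply PSeries_continuity. rewrite Rabs_pos_eq by lra. apply inside_defect_derive. lra.
Qed.

(** If q stayed below 1, then int p <= w p(w) < 1/(2 kappa), and
    b = exp(-int p) would be bounded below by a positive constant up to H,
    where it vanishes. *)
Lemma starlike_defect_reaches_one : exists w, 0 < w < H /\ PSeries starlike_defect w = 1.
Proof.
  assert (big : exists x, 0 <= x < H /\ 1 <= PSeries starlike_defect x).
  { destruct (Classical_Prop.classic (exists x, 0 <= x < H /\ 1 <= PSeries starlike_defect x)) as [E|E]; [exact E|exfalso].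
    set (m := exp (- / (2 * kappa))).
    assert (lower : forall x, 0 <= x < H -> m <= PSeries b x).
    { intros x Hx. destruct (Rle_lt_dec 1 (PSeries starlike_defect x)) as [h|h]; [exfalso; apply E; exists x; tauto|].
      rewrite log_value_R by exact Hx. rewrite starlike_defect_value_R in h by exact Hx.
      apply Rlt_le, exp_increasing.
      assert (I1 : PSeries (PS_Int p) x <= x * PSeries p x).
      { rewrite <- PSeries_incr_1. apply PSeries_le_nonneg; [|lra|rewrite CV_radius_incr_1; apply inside_p; lra].
        intros [|n]; simpl; [split; apply Rle_refl|].
        assert (1 <= INR (S n)) by (change 1 with (INR 1); apply le_INR; lia).
        change (match n with O => 1 | S _ => INR n + 1 end) with (INR (S n)).
        pose proof (p_nonneg n). split.
        - apply Rdiv_le_0_compat; lra.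
        - apply Rmult_le_reg_r with (INR (S n)); [lra|]. unfold Rdiv. rewrite Rmult_assoc, Rinv_l by lra. nra. }
      assert (E1 : PSeries (PS_Int (fun k => - 1 * p k)) x = - PSeries (PS_Int p) x).
      { rewrite <- PSeries_opp. apply PSeries_ext. intros [|n]; unfold PS_opp, PS_Int, opp; simpl; [ring|].
        unfold Rdiv. ring. }
      rewrite E1. 
      assert (x * PSeries p x < / (2 * kappa)).
      { apply Rmult_lt_reg_l with (2 * kappa); [lra|]. rewrite Rinv_r by lra. exact h. }
      lra. }
    assert (cont : continuity_pt (PSeries b) H).
    { apply PSeries_continuity. rewrite (ld_entire _ _ _ D). exact I. }
    assert (mpos : 0 < m) by apply exp_pos.
    destruct (cont m mpos) as [d [Hd Hc]].
    set (x := Rmax 0 (H - d / 2)).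
    assert (Hx : 0 <= x < H).
    { unfold x. split; [apply Rmax_l|]. apply Rmax_lub_lt; lra. }
    specialize (Hc x). unfold D_x, no_cond in Hc. simpl in Hc. unfold Rdist in Hc.
    rewrite (ld_zero _ _ _ D), Rminus_0_r in Hc.
    assert (Rabs (x - H) < d).
    { rewrite Rabs_left by lra. unfold x. pose proof (Rmax_r 0 (H - d / 2)). lra. }
    specialize (Hc ltac:(split; [split; [exact I|lra]|assumption])).
    specialize (lower x Hx). rewrite Rabs_pos_eq in Hc by lra. lra. }
  destruct big as [x [Hx Hq]].
  destruct (Req_dec (PSeries starlike_defect x) 1) as [E|E].
  - exists x. split; [|exact E]. destruct (Req_dec x 0) as [->|]; [rewrite starlike_defect_0 in E; lra|lra].
  - assert (x0 : x <> 0) by (intros ->; rewrite starlike_defect_0 in Hq; lra).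
    destruct (IVT_interv (fun t => PSeries starlike_defect t - 1) 0 x) as [w [Hw1 Hw2]].
    + intros a Ha1. apply continuity_pt_minus; [apply starlike_defect_continuous; lra|].
      apply continuity_pt_const. intros u v. reflexivity.
    + lra.
    + rewrite starlike_defect_0. lra.
    + lra.
    + exists w. split; [|lra]. destruct (Req_dec w 0) as [->|]; [rewrite starlike_defect_0 in Hw2; lra|lra].
Qed.

(** The value of -z f''/f' at w = z^2 on the positive axis, for
    f(z) = z b(z^2)^kappa. *)
Definition convexity_defect (x : R) : R :=
  PSeries starlike_defect x + 2 * x * PSeries (PS_derive starlike_defect) x / (1 - PSeries starlike_defect x).

Context (w1 : R) (Hw1 : 0 < w1 < H) (q1 : PSeries starlike_defect w1 = 1).

Lemma starlike_defect_range x : 0 <= x < w1 -> 0 <= PSeries starlike_defect x < 1.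
Proof.
  intros Hx. split.
  - rewrite <- (PSeries_0 starlike_defect : PSeries starlike_defect 0 = 0).
    destruct (Req_dec x 0) as [->|]; [lra|]. left. apply starlike_defect_incr; lra.
  - rewrite <- q1. apply starlike_defect_incr; lra.
Qed.

Lemma convexity_defect_incr x y : 0 <= x < y -> y < w1 -> convexity_defect x < convexity_defect y.
Proof.
  intros Hx Hy. unfold convexity_defect.
  pose proof (starlike_defect_range x ltac:(lra)). pose proof (starlike_defect_range y ltac:(lra)).
  pose proof (starlike_defect_incr x y Hx ltac:(lra)).
  pose proof (starlike_defect_derive_pos x ltac:(lra)).
  pose proof (starlike_defect_derive_mono x y ltac:(lra) ltac:(lra)).
  apply Rplus_lt_le_compat; [assumption|]. unfold Rdiv.
  apply Rmult_le_compat.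
  - apply Rmult_le_pos; lra.
  - left. apply Rinv_0_lt_compat. lra.
  - apply Rmult_le_compat; lra.
  - apply Rinv_le_contravar; lra.
Qed.

(** Clearing the denominator 1 - q gives a continuous function on the closed
    interval, negative at 0 and positive at w1, where the denominator
    vanishes. *)
Lemma convexity_defect_surjective T : 0 < T -> exists x, 0 < x < w1 /\ convexity_defect x = T.
Proof.
  intros HT.
  set (J := fun x => PSeries starlike_defect x * (1 - PSeries starlike_defect x)
     + 2 * x * PSeries (PS_derive starlike_defect) x - T * (1 - PSeries starlike_defect x)).
  assert (J1 : 0 < J w1).
  { unfold J. rewrite q1. pose proof (starlike_defect_derive_pos w1 ltac:(lra)).
    assert (0 < 2 * w1 * PSeries (PS_derive starlike_defect) w1) by (apply Rmult_lt_0_compat; lra). lra. }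
  assert (J0 : J 0 < 0) by (unfold J; rewrite starlike_defect_0; lra).
  destruct (IVT_interv J 0 w1) as [x [Hx1 Hx2]]; [|lra|exact J0|exact J1|].
  - intros a Ha. unfold J.
    assert (C1 := starlike_defect_continuous a ltac:(lra)).
    assert (C2 := starlike_defect_derive_continuous a ltac:(lra)).
    assert (C3 : forall c, continuity_pt (fun _ => c) a) by (intros c; apply continuity_pt_const; intros u v; reflexivity).
    assert (C4 : continuity_pt (fun x => 1 - PSeries starlike_defect x) a).
    { apply (continuity_pt_minus (fun _ => 1)); [apply C3|exact C1]. }
    apply (continuity_pt_minus (fun x => PSeries starlike_defect x * (1 - PSeries starlike_defect x) + 2 * x * PSeries (PS_derive starlike_defect) x)).
    + apply (continuity_pt_plus (fun x => PSeries starlike_defect x * (1 - PSeries starlike_defect x))).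
      * apply (continuity_pt_mult (PSeries starlike_defect)); assumption.
      * apply (continuity_pt_mult (fun x => 2 * x)); [|exact C2].
        apply (continuity_pt_mult (fun _ => 2) (fun x => x)); [apply C3|apply derivable_continuous_pt, derivable_pt_id].
    + apply (continuity_pt_mult (fun _ => T)); [apply C3|exact C4].
  - assert (x0 : x <> 0) by (intros ->; lra). assert (x1 : x <> w1) by (intros ->; lra).
    exists x. split; [lra|]. pose proof (starlike_defect_range x ltac:(lra)).
    unfold J in Hx2. unfold convexity_defect.
    apply Rmult_eq_reg_r with (1 - PSeries starlike_defect x); [|lra].
    rewrite Rmult_plus_distr_r. unfold Rdiv. rewrite Rmult_assoc, Rinv_l by lra. lra.
Qed.

Definition complex_defect (w : C) : C :=
  (real_cps starlike_defect w + RtoC 2 * w * real_cps (PS_derive starlike_defect) w / (1 - real_cps starlike_defect w))%C.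

Lemma one_minus_defect_mod w : Cmod w < w1 ->
  1 - PSeries starlike_defect (Cmod w) <= Cmod (1 - real_cps starlike_defect w)%C.
Proof.
  intros Hw.
  assert (B : Cmod (real_cps starlike_defect w) <= PSeries starlike_defect (Cmod w)).
  { apply real_cps_bound; [apply inside_defect; lra|].
    intros n. rewrite Rabs_pos_eq by apply starlike_defect_nonneg. lra. }
  assert (T : Cmod 1%C <= Cmod (1 - real_cps starlike_defect w)%C + Cmod (real_cps starlike_defect w)).
  { replace (RtoC 1) with ((1 - real_cps starlike_defect w) + real_cps starlike_defect w)%C at 1 by ring. apply Cmod_triangle. }
  rewrite Cmod_1 in T. lra.
Qed.

Lemma one_minus_defect_neq_0 w : Cmod w < w1 -> (1 - real_cps starlike_defect w)%C <> 0%C.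
Proof.
  intros Hw. apply Cmod_gt_0. pose proof (one_minus_defect_mod w Hw).
  pose proof (starlike_defect_range (Cmod w) ltac:(split; [apply Cmod_ge_0|exact Hw])). lra.
Qed.

(** Nonnegative coefficients bound q(w) and q'(w) by q(|w|) and q'(|w|), and
    |1 - q(w)| from below by 1 - q(|w|). *)
Lemma complex_defect_bound w : Cmod w < w1 -> Cmod (complex_defect w) <= convexity_defect (Cmod w).
Proof.
  intros Hw. pose proof (Cmod_ge_0 w) as w0. unfold complex_defect, convexity_defect.
  pose proof (one_minus_defect_mod w Hw) as M. pose proof (one_minus_defect_neq_0 w Hw) as N.
  pose proof (starlike_defect_range (Cmod w) ltac:(lra)).
  eapply Rle_trans; [apply Cmod_triangle|]. apply Rplus_le_compat.
  - apply real_cps_bound; [apply inside_defect; lra|].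
    intros n. rewrite Rabs_pos_eq by apply starlike_defect_nonneg. lra.
  - rewrite Cmod_div by exact N. rewrite !Cmod_mult, Cmod_R, (Rabs_pos_eq 2) by lra.
    unfold Rdiv. apply Rmult_le_compat.
    + apply Rmult_le_pos; [lra|apply Cmod_ge_0].
    + left. apply Rinv_0_lt_compat. lra.
    + apply Rmult_le_compat_l; [lra|]. apply real_cps_bound; [apply inside_defect_derive; lra|].
      intros n. rewrite Rabs_pos_eq by apply starlike_defect_derive_nonneg. lra.
    + apply Rinv_le_contravar; lra.
Qed.

Lemma complex_defect_R x : 0 <= x < w1 -> complex_defect (RtoC x) = RtoC (convexity_defect x).
Proof.
  intros Hx. unfold complex_defect, convexity_defect. rewrite !real_cps_R.
  pose proof (starlike_defect_range x Hx).
  rewrite RtoC_plus, RtoC_div, !RtoC_mult, RtoC_minus by lra. reflexivity.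
Qed.

End LogDerivative.

(** * The function z e(z^2) *)

Section OddSeries.

Context (b p : nat -> R) (H kappa : R) (D : log_derivative_data b p H) (kappa_pos : 0 < kappa).
Context (e : nat -> R) (e0 : e O = 1) (e_ode : forall n, PS_derive e n = PS_mult e (fun k => - kappa * p k) n).

Lemma power_radius : Rbar_le H (CV_radius e).
Proof.
  apply exp_series_radius with (fun k => - kappa * p k); [apply (ld_pos _ _ _ D)| |exact e_ode].
  apply (log_series_radius _ _ _ D).
Qed.

Lemma power_value w : Cmod w < H -> real_cps e w = Cexp (real_cps (PS_Int (fun k => - kappa * p k)) w).
Proof.
  intros Hw. apply exp_series_value with H; [apply (log_series_radius _ _ _ D)|apply power_radius|exact e0|exact e_ode|exact Hw].
Qed.

Lemma power_neq_0 w : Cmod w < H -> real_cps e w <> 0%C.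
Proof. intros Hw. rewrite power_value by exact Hw. apply Cexp_neq_0. Qed.

(** Near 0 the logarithm of b is small, so that the principal logarithm of b
    is the one given by the power series. *)
Lemma power_principal : exists d, 0 < d <= H /\ forall w, Cmod w < d ->
  Cpower (real_cps b w) kappa = real_cps e w.
Proof.
  set (L := real_cps (PS_Int (fun k => - 1 * p k))).
  pose proof (ld_pos _ _ _ D) as HH.
  assert (rad : Rbar_le H (CV_radius (PS_Int (fun k => - 1 * p k)))).
  { rewrite CV_radius_Int. apply (log_series_radius _ _ _ D). }
  assert (hol : exists l, holomorphic_at L 0%C l).
  { eexists. apply real_cps_holomorphic. rewrite Cmod_0. eapply Rbar_lt_le_trans; [|exact rad]. exact HH. }
  destruct hol as [l hol].
  destruct (holomorphic_at_elim _ _ _ hol 1 Rlt_0_1) as [d [Hd Hh]].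
  assert (L0 : L 0%C = 0%C) by (unfold L; rewrite real_cps_0; reflexivity).
  pose proof (Cmod_ge_0 l).
  set (c := / (Cmod l + 1)). assert (c0 : 0 < c) by (apply Rinv_0_lt_compat; lra).
  exists (Rmin H (Rmin d c)).
  pose proof (Rmin_l H (Rmin d c)). pose proof (Rmin_r H (Rmin d c)).
  pose proof (Rmin_l d c). pose proof (Rmin_r d c).
  split; [split; [repeat apply Rmin_glb_lt; lra|lra]|].
  intros w Hw. rewrite (log_value _ _ _ D) by lra. fold L.
  (* A bound 1 < pi/2 on the logarithm keeps exp L in the right half plane. *)
  assert (small : Cmod (L w) <= 1).
  { specialize (Hh w ltac:(lra)). rewrite Cplus_0_l, L0 in Hh.
    replace (L w) with ((L w - 0 - l * w) + l * w)%C by ring.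
    eapply Rle_trans; [apply Cmod_triangle|]. rewrite (Cmod_mult l w).
    assert ((Cmod l + 1) * Cmod w <= (Cmod l + 1) * c) by (apply Rmult_le_compat_l; lra).
    unfold c in H5. rewrite Rinv_r in H5 by lra. lra. }
  unfold Cpower. rewrite Clog_Cexp.
  2:{ pose proof (im_le_Cmod (L w)). pose proof PI2_1. lra. }
  rewrite power_value by lra. f_equal. unfold L. rewrite <- real_cps_scal.
  - apply real_cps_ext. intros [|n]; unfold PS_Int; [ring|]. unfold Rdiv. ring.
  - eapply Rbar_lt_le_trans; [|exact rad]. simpl. lra.
Qed.

(** The coefficients of z e(z^2). *)
Definition odd_spread (n : nat) : R := if Nat.odd n then e (Nat.div2 n) else 0.

Lemma odd_spread_even n : odd_spread (2 * n) = 0.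
Proof.
  unfold odd_spread. rewrite Nat.odd_mul. reflexivity.
Qed.

Lemma odd_spread_odd n : odd_spread (2 * n + 1) = e n.
Proof.
  unfold odd_spread. replace (2 * n + 1)%nat with (S (2 * n)) by lia.
  rewrite Nat.div2_succ_double, Nat.odd_succ, Nat.even_mul. reflexivity.
Qed.

Lemma Cmod_square_lt z r : Cmod z < sqrt r -> Cmod (z ^ 2)%C < r.
Proof.
  intros Hz. pose proof (Cmod_ge_0 z).
  assert (0 < r).
  { destruct (Rlt_le_dec 0 r) as [h|h]; [exact h|]. rewrite sqrt_neg_0 in Hz by exact h. lra. }
  rewrite Cmod_pow, <- (sqrt_sqrt r) by lra. nra.
Qed.

Lemma odd_spread_radius : Rbar_le (sqrt H) (CV_radius odd_spread).
Proof.
  pose proof (ld_pos _ _ _ D) as HH.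
  apply Rbar_le_approx; [apply sqrt_lt_R0; exact HH|]. intros x Hx.
  assert (x2 : 0 < x ^ 2 < H).
  { split; [nra|]. rewrite <- (sqrt_sqrt H) by lra. nra. }
  destruct (CV_radius_inside_bounded e (x ^ 2)) as [M [M0 HM]]; [lra| |].
  { eapply Rbar_lt_le_trans; [|apply power_radius]. simpl. lra. }
  apply CV_radius_ge_bounded. exists (M * x). intros n.
  destruct (Nat.Even_or_Odd n) as [[k ->]|[k ->]].
  - rewrite odd_spread_even, Rmult_0_l, Rabs_R0. apply Rmult_le_pos; lra.
  - rewrite odd_spread_odd, pow_add, pow_mult, <- Rmult_assoc, Rabs_mult, pow_1.
    rewrite (Rabs_pos_eq x) by lra. apply Rmult_le_compat_r; [lra|apply HM].
Qed.

Lemma odd_spread_value z : Cmod z < sqrt H -> real_cps odd_spread z = (z * real_cps e (z ^ 2))%C.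
Proof.
  intros Hz. pose proof (Cmod_square_lt _ _ Hz) as Hz2.
  assert (S2 : abs_summable (fun n => RtoC (e n) * (z ^ 2) ^ n)%C).
  { apply real_cps_summable. eapply Rbar_lt_le_trans; [|apply power_radius]. exact Hz2. }
  rewrite !real_cps_Cseries, <- Cseries_scal by exact S2.
  apply abs_summable_scal with (c := z) in S2.
  set (t := fun n => (RtoC (odd_spread n) * z ^ n)%C).
  set (s := fun n => (z * (RtoC (e n) * (z ^ 2) ^ n))%C) in *.
  assert (te : forall n, t (2 * n)%nat = 0%C).
  { intros n. unfold t. rewrite odd_spread_even. apply Cmult_0_l. }
  assert (to : forall n, t (2 * n + 1)%nat = s n).
  { intros n. unfold t, s. rewrite odd_spread_odd, Cpow_add_r, Cpow_mult_r, Cpow_1_r. ring. }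
  assert (part : forall g : C -> R, g 0%C = 0 -> ex_series (fun n => g (s n)) ->
    Series (fun n => g (t n)) = Series (fun n => g (s n))).
  { intros g g0 Hg.
    assert (toS : forall a, Series a = PSeries a 1).
    { intros a. apply Series_ext. intros n. rewrite pow1. ring. }
    rewrite !toS, PSeries_odd_even.
    - rewrite Rmult_1_l, !pow1.
      rewrite (PSeries_ext (fun n => g (t (2 * n)%nat)) (fun _ => 0)) by (intros n; rewrite te; exact g0).
      rewrite PSeries_const_0, Rplus_0_l. apply PSeries_ext. intros n. rewrite to. reflexivity.
    - apply ex_series_ext with (fun _ => 0).
      + intros n. rewrite te, g0. symmetry. apply Rmult_0_r.
      + exists 0. apply is_series_Reals. 
        assert (Z : forall n, sum_f_R0 (fun _ => 0) n = 0) by (intros n; rewrite sum_cte; ring).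
        intros eps Heps. exists O. intros n _. rewrite Z. unfold Rdist. rewrite Rminus_diag, Rabs_R0. exact Heps.
    - apply ex_series_ext with (fun n => g (s n)); [|exact Hg].
      intros n. rewrite to, pow_n_pow, !pow1. symmetry. apply Rmult_1_l. }
  unfold Cseries. f_equal; apply part; try reflexivity; apply ex_series_Rabs.
  - apply (abs_summable_Re _ S2).
  - apply (abs_summable_Im _ S2).
Qed.

Lemma power_derivative w : Cmod w < H ->
  real_cps (PS_derive e) w = (real_cps e w * (RtoC (- kappa) * real_cps p w))%C.
Proof.
  intros Hw. rewrite (real_cps_ext _ _ w e_ode), real_cps_mult, real_cps_scal; [reflexivity| | |].
  - apply (inside_p _ _ _ D). exact Hw.
  - eapply Rbar_lt_le_trans; [|apply power_radius]. exact Hw.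
  - eapply Rbar_lt_le_trans; [|apply (log_series_radius _ _ _ D)]. exact Hw.
Qed.

Lemma holomorphic_square z : holomorphic_at (fun x => x ^ 2)%C z (RtoC 2 * z)%C.
Proof.
  apply holomorphic_at_ext with (fun x => x * x)%C (Cmod z + 1); [lra|intros y _; simpl; ring|].
  replace (RtoC 2 * z)%C with (1 * z + z * 1)%C.
  - apply (holomorphic_at_mult (fun x => x) (fun x => x)); apply holomorphic_at_id.
  - replace (RtoC 2) with (1 + 1)%C by (rewrite <- RtoC_plus; reflexivity). ring.
Qed.

Lemma real_cps_square_holomorphic a z : Rbar_le H (CV_radius a) -> Cmod z < sqrt H ->
  holomorphic_at (fun x => real_cps a (x ^ 2)%C) z (RtoC 2 * z * real_cps (PS_derive a) (z ^ 2))%C.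
Proof.
  intros Ha Hz. apply (holomorphic_at_comp (real_cps a) (fun x => x ^ 2)%C); [|apply holomorphic_square].
  apply real_cps_holomorphic. eapply Rbar_lt_le_trans; [|exact Ha]. apply Cmod_square_lt, Hz.
Qed.

Let q := real_cps (starlike_defect p kappa).
Let q' := real_cps (PS_derive (starlike_defect p kappa)).

Lemma odd_series_derivative f z : (forall y, Cmod y < sqrt H -> f y = (y * real_cps e (y ^ 2))%C) ->
  Cmod z < sqrt H -> holomorphic_at f z (real_cps e (z ^ 2) * (1 - q (z ^ 2)))%C.
Proof.
  intros Hf Hz. apply holomorphic_at_ext with (fun y => y * real_cps e (y ^ 2))%C (sqrt H); [exact Hz| |].
  - intros y Hy. symmetry. apply Hf, Hy.
  - pose proof (holomorphic_at_mult (fun y => y) _ z _ _ (holomorphic_at_id z)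
      (real_cps_square_holomorphic e z power_radius Hz)) as G.
    match type of G with holomorphic_at _ _ ?l => replace (real_cps e (z ^ 2) * (1 - q (z ^ 2)))%C with l end; [exact G|].
    pose proof (Cmod_square_lt _ _ Hz) as Hz2.
    rewrite power_derivative by exact Hz2.
    unfold q. rewrite (starlike_defect_value _ _ _ _ D) by exact Hz2. rewrite RtoC_mult, RtoC_opp. simpl (z ^ 2)%C. ring.
Qed.

Context (w1 : R) (Hw1 : 0 < w1 < H) (q1 : PSeries (starlike_defect p kappa) w1 = 1).

(** The derivative is f' = e(z^2) (1 - q(z^2)); neither factor vanishes for
    |z| < sqrt w1, and z f''/f' is z times the logarithmic derivative of the
    product. *)
Lemma odd_series_second_quotient f z :
  (forall y, Cmod y < sqrt H -> f y = (y * real_cps e (y ^ 2))%C) -> Cmod z < sqrt w1 ->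
  C_derive f z <> 0%C /\ zf''_f' f z = (- complex_defect p kappa (z ^ 2))%C.
Proof.
  intros Hf Hz1.
  assert (Hz : Cmod z < sqrt H) by (eapply Rlt_trans; [exact Hz1|apply sqrt_lt_1; lra]).
  pose proof (Cmod_square_lt _ _ Hz) as Hz2. pose proof (Cmod_square_lt _ _ Hz1) as Hz3.
  pose proof (power_neq_0 _ Hz2) as N1.
  pose proof (one_minus_defect_neq_0 _ _ _ _ D kappa_pos w1 Hw1 q1 _ Hz3) as N2.
  assert (D1 : forall y, Cmod y < sqrt H -> C_derive f y = (real_cps e (y ^ 2) * (1 - q (y ^ 2)))%C).
  { intros y Hy. apply holomorphic_C_derive, odd_series_derivative; assumption. }
  assert (D2 : C_derive_n f 2 z = (RtoC 2 * z * real_cps (PS_derive e) (z ^ 2) * (1 - q (z ^ 2))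
     + real_cps e (z ^ 2) * (RtoC (-1) * (RtoC 2 * z * q' (z ^ 2))))%C).
  { change (C_derive_n f 2) with (C_derive (C_derive f)). apply holomorphic_C_derive.
    apply holomorphic_at_ext with (fun y => real_cps e (y ^ 2) * (1 + RtoC (-1) * q (y ^ 2)))%C (sqrt H); [exact Hz| |].
    - intros y Hy. rewrite D1 by exact Hy. ring.
    - pose proof (holomorphic_at_mult (fun _ => RtoC (-1)) _ z _ _ (holomorphic_at_const _ z)
        (real_cps_square_holomorphic _ z (starlike_defect_radius _ _ _ kappa D) Hz)) as G1.
      pose proof (holomorphic_at_plus (fun _ => RtoC 1) _ z _ _ (holomorphic_at_const _ z) G1) as G2.
      pose proof (holomorphic_at_mult _ _ z _ _ (real_cps_square_holomorphic e z power_radius Hz) G2) as G.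
      match type of G with holomorphic_at _ _ ?l => match goal with |- holomorphic_at _ _ ?r => replace r with l; [exact G|] end end.
      unfold q, q'. ring. }
  split.
  - rewrite D1 by exact Hz. apply Cmult_neq_0; [exact N1|exact N2].
  - unfold zf''_f'. rewrite D2, D1 by exact Hz.
    rewrite power_derivative by exact Hz2. unfold complex_defect.
    fold q q'.
    assert (Eq : q (z ^ 2)%C = (RtoC 2 * RtoC kappa * (z ^ 2 * real_cps p (z ^ 2)))%C).
    { unfold q. rewrite (starlike_defect_value _ _ _ _ D) by exact Hz2. rewrite RtoC_mult. reflexivity. }
    fold q in N2.
    rewrite RtoC_opp.
    set (E := real_cps e (z ^ 2)) in *. set (Q := q (z ^ 2)%C) in *. set (Q' := q' (z ^ 2)%C).
    set (P := real_cps p (z ^ 2)) in *.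
    replace (- (Q + RtoC 2 * z ^ 2 * Q' / (1 - Q)))%C
      with (- (RtoC 2 * RtoC kappa * (z ^ 2 * P)) - RtoC 2 * z ^ 2 * Q' / (1 - Q))%C by (rewrite <- Eq; unfold Cminus; ring).
    simpl (z ^ 2)%C. field. split; assumption.
Qed.

End OddSeries.

(** * The Gamma factor and the Struve function on the positive axis *)

Section GammaIntegral.

Context (s : R) (Hs : 0 <= s <= 1).

Let f := fun t => Rpower t s * exp (- t).

Lemma gamma_integrand_pos t : 0 < f t.
Proof. unfold f, Rpower. apply Rmult_lt_0_compat; apply exp_pos. Qed.

Lemma gamma_integrand_le t : 0 < t -> f t <= (1 + t) * exp (- t).
Proof.
  intros Ht. unfold f. apply Rmult_le_compat_r; [left; apply exp_pos|].
  destruct (Rle_lt_dec t 1) as [h|h].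
  - apply Rle_trans with (Rpower 1 s).
    + apply Rle_Rpower_l; lra.
    + unfold Rpower. rewrite ln_1, Rmult_0_r, exp_0. lra.
  - apply Rle_trans with (Rpower t 1).
    + apply Rle_Rpower; lra.
    + rewrite Rpower_1 by exact Ht. lra.
Qed.

Lemma gamma_integrand_continuous t : 0 < t -> continuous f t.
Proof.
  intros Ht. apply (@ex_derive_continuous R_AbsRing R_NormedModule). unfold f, Rpower.
  auto_derive. exact Ht.
Qed.

Lemma gamma_integrand_ex a c : 0 < a -> a <= c -> ex_RInt f a c.
Proof.
  intros Ha Hc. apply (@ex_RInt_continuous R_CompleteNormedModule). intros t Ht.
  rewrite Rmin_left in Ht by lra. apply gamma_integrand_continuous. lra.
Qed.

(** Comparison with (1 + t) exp(-t), whose primitive is -(2 + t) exp(-t). *)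
Lemma gamma_integral_bound a c : 0 < a -> a <= c -> RInt f a c <= 2.
Proof.
  intros Ha Hc.
  assert (I : is_RInt (fun t => (1 + t) * exp (- t)) a c (- (2 + c) * exp (- c) - - (2 + a) * exp (- a))).
  { apply (is_RInt_derive (fun t => - (2 + t) * exp (- t))).
    - intros t _. auto_derive; auto. ring.
    - intros t _. apply (@ex_derive_continuous R_AbsRing R_NormedModule). auto_derive. auto. }
  apply Rle_trans with (RInt (fun t => (1 + t) * exp (- t)) a c).
  - apply RInt_le; [exact Hc|apply gamma_integrand_ex; assumption|eexists; exact I|].
    intros t Ht. apply gamma_integrand_le. lra.
  - rewrite (is_RInt_unique _ _ _ _ I).
    assert (0 < (2 + c) * exp (- c)) by (apply Rmult_lt_0_compat; [lra|apply exp_pos]).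
    assert (exp a * exp (- a) = 1) by (rewrite <- exp_plus, Rplus_opp_r; apply exp_0).
    pose proof (exp_ineq1_le a). pose proof (exp_pos (- a)). nra.
Qed.

Lemma gamma_integral_mono a c a' c' : 0 < a' -> a' <= a -> a <= c -> c <= c' ->
  RInt f a c <= RInt f a' c'.
Proof.
  intros H1 H2 H3 H4.
  assert (P : forall x y, 0 < x -> x <= y -> 0 <= RInt f x y).
  { intros x y Hx Hy. apply RInt_ge_0; [exact Hy|apply gamma_integrand_ex; assumption|].
    intros t _. left. apply gamma_integrand_pos. }
  rewrite <- (RInt_Chasles f a' a c') by (apply gamma_integrand_ex; lra).
  rewrite <- (RInt_Chasles f a c c') by (apply gamma_integrand_ex; lra).
  pose proof (P a' a H1 H2). pose proof (P c c' ltac:(lra) H4). unfold plus; simpl. lra.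
Qed.

(** The integrals over compact intervals [a,c] increase with the interval and
    are bounded by 2, hence converge to their supremum as a -> 0 and
    c -> infinity. *)
Lemma gamma_integral_pos : 0 < RInt_gen f (at_right 0) (Rbar_locally p_infty).
Proof.
  set (E := fun y => exists a c, 0 < a <= 1 /\ 1 <= c /\ y = RInt f a c).
  destruct (completeness E) as [l [Hub Hlub]].
  - exists 2. intros y (a & c & Ha & Hc & ->). apply gamma_integral_bound; lra.
  - exists (RInt f 1 1). exists 1, 1. repeat split; lra.
  - assert (lpos : 0 < l).
    { apply Rlt_le_trans with (RInt f 1 2).
      - apply RInt_gt_0; [lra|intros; apply gamma_integrand_pos|].
        intros t Ht. apply gamma_integrand_continuous. lra.
      - apply Hub. exists 1, 2. repeat split; lra. }
    enough (G : is_RInt_gen f (at_right 0) (Rbar_locally p_infty) l).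
    { rewrite (is_RInt_gen_unique _ _ G). exact lpos. }
    intros P [eps HP].
    assert (near : exists a c, 0 < a <= 1 /\ 1 <= c /\ l - eps < RInt f a c).
    { destruct (Classical_Prop.classic (exists a c, 0 < a <= 1 /\ 1 <= c /\ l - eps < RInt f a c)) as [h|h]; [exact h|exfalso].
      assert (l <= l - eps); [|pose proof (cond_pos eps); lra].
      apply Hlub. intros y (a & c & Ha & Hc & ->).
      destruct (Rle_lt_dec (RInt f a c) (l - eps)) as [g|g]; [exact g|exfalso].
      apply h. exists a, c. tauto. }
    destruct near as (a0 & c0 & Ha0 & Hc0 & Hn).
    (* Any interval that contains [a0, c0] has its integral within eps of the
       supremum. *)
    apply (Filter_prod _ _ _ (fun a => 0 < a < a0) (fun c => c0 < c)).
    + exists (mkposreal a0 (proj1 Ha0)). intros a Ha Hpos. simpl.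
      unfold ball in Ha; simpl in Ha. unfold AbsRing_ball, abs, minus, plus, opp in Ha; simpl in Ha.
      rewrite Ropp_0, Rplus_0_r, Rabs_pos_eq in Ha by lra. lra.
    + exists c0. intros c Hc. exact Hc.
    + intros a c Ha Hc. simpl. exists (RInt f a c). split.
      * apply (@RInt_correct R_CompleteNormedModule). apply gamma_integrand_ex; lra.
      * apply HP. unfold ball; simpl. unfold AbsRing_ball, abs, minus, plus, opp; simpl.
        assert (RInt f a c <= l) by (apply Hub; exists a, c; repeat split; lra).
        assert (RInt f a0 c0 <= RInt f a c) by (apply gamma_integral_mono; lra).
        apply Rabs_def1; pose proof (cond_pos eps); lra.
Qed.

End GammaIntegral.

Lemma Gamma_pos x : 1 <= x <= 2 -> 0 < Gamma x.
Proof. intros Hx. unfold Gamma. apply (gamma_integral_pos (x - 1)). lra. Qed.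

Lemma first_zero (f : R -> R) : continuity f -> 0 < f 0 -> (exists x, 0 <= x /\ f x <= 0) ->
  exists z, 0 < z /\ f z = 0 /\ forall y, 0 <= y < z -> 0 < f y.
Proof.
  intros Hc H0 [x0 [Hx0 Hfx0]].
  set (E := fun x => 0 <= x /\ forall y, 0 <= y <= x -> 0 < f y).
  assert (bound : forall x, E x -> x <= x0).
  { intros x [Hx Hpos]. destruct (Rle_lt_dec x x0) as [h|h]; [exact h|exfalso].
    specialize (Hpos x0 ltac:(lra)). lra. }
  destruct (completeness E) as [z [Hub Hlub]].
  - exists x0. exact bound.
  - exists 0. split; [lra|]. intros y Hy. replace y with 0 by lra. exact H0.
  - assert (z0 : 0 <= z).
    { apply Hub. split; [lra|]. intros y Hy. replace y with 0 by lra. exact H0. }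
    assert (below : forall y, 0 <= y < z -> 0 < f y).
    { intros y Hy. destruct (Rlt_le_dec 0 (f y)) as [h|h]; [exact h|exfalso].
      assert (z <= y); [|lra]. apply Hlub. intros x [Hx Hpos].
      destruct (Rle_lt_dec x y) as [g|g]; [exact g|exfalso]. specialize (Hpos y ltac:(lra)). lra. }
    assert (loc : forall e, 0 < e -> exists d, 0 < d /\ forall y, Rabs (y - z) < d -> Rabs (f y - f z) < e).
    { intros e He. destruct (Hc z e He) as [d [Hd Hdd]]. exists d. split; [exact Hd|].
      intros y Hy. destruct (Req_dec y z) as [->|Hne].
      - rewrite Rminus_diag, Rabs_R0. exact He.
      - apply Hdd. split; [split; [exact I|auto]|exact Hy]. }
    assert (fz : f z = 0).
    { destruct (Rtotal_order (f z) 0) as [h|[h|h]]; [exfalso|exact h|exfalso].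
      - destruct (loc (- f z) ltac:(lra)) as [d [Hd Hdd]].
        destruct (Req_dec z 0) as [->|Hne]; [lra|].
        set (y := Rmax 0 (z - d / 2)).
        pose proof (Rmax_l 0 (z - d / 2)). pose proof (Rmax_r 0 (z - d / 2)).
        assert (y < z) by (apply Rmax_lub_lt; lra). fold y in H, H1.
        specialize (Hdd y). rewrite Rabs_left in Hdd by lra. specialize (Hdd ltac:(lra)).
        specialize (below y ltac:(lra)). apply Rabs_def2 in Hdd. lra.
      - destruct (loc (f z) h) as [d [Hd Hdd]].
        assert (z + d / 2 <= z); [|lra]. apply Hub. split; [lra|]. intros y Hy.
        destruct (Rlt_le_dec y z) as [g|g]; [apply below; lra|].
        specialize (Hdd y). rewrite Rabs_pos_eq in Hdd by lra. specialize (Hdd ltac:(lra)).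
        apply Rabs_def2 in Hdd. lra. }
    exists z. split; [|split; assumption].
    destruct (Req_dec z 0) as [->|Hne]; [lra|lra].
Qed.

(** Below the first zero H of the series the bounded partial sums give bounded
    terms p_k x^k, hence a radius of convergence at least H; moreover
    p_0 = - b_1 > 0. *)
Lemma struve_log_derivative_data nu : Rabs nu <= 1 / 2 ->
  exists p H, log_derivative_data (struve_coef nu) p H.
Proof.
  intros Hnu. pose proof (struve_coef_factorially_bounded nu Hnu) as Hb.
  pose proof (factorially_bounded_radius _ _ Hb) as rad.
  assert (b0 : struve_coef nu 0 = 1) by (unfold struve_coef, coef_1F2; simpl; field).
  destruct (first_zero (PSeries (struve_coef nu))) as (H & HH & HzH & Hpos).
  - intros x. apply PSeries_continuity. rewrite rad. exact I.
  - rewrite PSeries_0, b0. lra.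
  - apply struve_series_nonpos, Hnu.
  - destruct (struve_log_derivative nu Hnu) as (p & p0 & newton & partial).
    exists p, H. split; try assumption.
    + pose proof (newton O) as N. unfold PS_mult in N. cbn [sum_f_R0] in N. simpl (0 - 0)%nat in N.
      rewrite struve_coef_step, b0 in N by exact Hnu.
      replace (p O) with (/ (4 * (3 / 2 + INR 0) * (nu + 3 / 2 + INR 0))).
      * apply Rabs_le_between in Hnu. apply Rinv_0_lt_compat. simpl. nra.
      * simpl (INR 1) in N. unfold Rdiv in *. lra.
    + apply Rbar_le_approx; [exact HH|]. intros x Hx. apply CV_radius_ge_bounded.
      assert (fx : 0 < PSeries (struve_coef nu) x) by (apply Hpos; lra).
      exists (- PSeries (PS_derive (struve_coef nu)) x / PSeries (struve_coef nu) x).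
      assert (P : forall k, 0 <= p k * x ^ k) by (intros k; apply Rmult_le_pos; [apply p0|apply pow_le; lra]).
      intros n. rewrite Rabs_pos_eq by apply P.
      specialize (partial x ltac:(lra) ltac:(intros y Hy; apply Hpos; lra) n).
      apply Rmult_le_reg_r with (PSeries (struve_coef nu) x); [exact fx|].
      unfold Rdiv. rewrite (Rmult_assoc _ (/ _)), Rinv_l, Rmult_1_r by lra.
      eapply Rle_trans; [|exact partial]. apply Rmult_le_compat_r; [lra|].
      destruct n as [|n]; [simpl; lra|]. rewrite tech5.
      pose proof (cond_pos_sum (fun k => p k * x ^ k) n P). lra.
    + intros n. unfold PS_derive. rewrite newton. unfold PS_mult.
      rewrite <- (sum_f_R0_skip (fun k => p k * struve_coef nu (n - k)%nat)).
      replace (- sum_f_R0 (fun k => p (n - k)%nat * struve_coef nu (n - (n - k))%nat) n)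
        with (-1 * sum_f_R0 (fun k => p (n - k)%nat * struve_coef nu (n - (n - k))%nat) n) by ring.
      rewrite scal_sum. apply sum_eq. intros i Hi.
      replace (n - (n - i))%nat with i by lia. ring.
Qed.

Section Struve.

Context (nu : R) (hnu : Rabs nu <= 1 / 2) (p : nat -> R) (H : R)
  (D : log_derivative_data (struve_coef nu) p H).

Let kappa := 1 / (nu + 1).

Lemma nu_range : 1 / 2 <= nu + 1 <= 3 / 2.
Proof. apply Rabs_le_between in hnu. lra. Qed.

Lemma kappa_pos : 0 < kappa.
Proof. pose proof nu_range. apply Rdiv_lt_0_compat; lra. Qed.

Let c := / (sqrt (PI / 4) * Gamma (nu + 3 / 2)).

Lemma struve_const_pos : 0 < c.
Proof.
  pose proof nu_range. apply Rinv_0_lt_compat, Rmult_lt_0_compat.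
  - apply sqrt_lt_R0. pose proof PI_RGT_0. lra.
  - apply Gamma_pos. lra.
Qed.

Lemma struve_series x : struve nu x = c * Rpower (x / 2) (nu + 1) * PSeries (struve_coef nu) (x ^ 2).
Proof.
  unfold struve. replace (hyp1F2 1 (3 / 2) (nu + 3 / 2) (- (x ^ 2 / 4))) with (PSeries (struve_coef nu) (x ^ 2)).
  - unfold c, Rdiv. ring.
  - unfold hyp1F2. apply Series_ext. intros n. unfold struve_coef.
    replace (- (x ^ 2 / 4)) with (- / 4 * x ^ 2) by field. rewrite (Rpow_mult_distr (- / 4)). ring.
Qed.

Lemma struve_zero_iff x : struve nu x = 0 <-> PSeries (struve_coef nu) (x ^ 2) = 0.
Proof.
  rewrite struve_series. pose proof struve_const_pos.
  assert (0 < Rpower (x / 2) (nu + 1)) by apply exp_pos. split; intros E.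
  - apply Rmult_integral in E. destruct E as [E|E]; [exfalso|exact E].
    assert (0 < c * Rpower (x / 2) (nu + 1)) by (apply Rmult_lt_0_compat; assumption). lra.
  - rewrite E. ring.
Qed.

Let q := PSeries (starlike_defect p kappa).
Let q' := PSeries (PS_derive (starlike_defect p kappa)).

Lemma square_range x : 0 < x < sqrt H -> 0 < x ^ 2 < H.
Proof.
  pose proof (ld_pos _ _ _ D). intros Hx. split; [nra|]. rewrite <- (sqrt_sqrt H) by lra. nra.
Qed.

Lemma struve_series_pos w : 0 <= w < H -> 0 < PSeries (struve_coef nu) w.
Proof. intros Hw. rewrite (log_value_R _ _ _ D) by exact Hw. apply exp_pos. Qed.

Lemma struve_pos x : 0 < x < sqrt H -> 0 < struve nu x.
Proof.
  intros Hx. rewrite struve_series. pose proof (square_range x Hx).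
  repeat apply Rmult_lt_0_compat; [apply struve_const_pos|apply exp_pos|apply struve_series_pos; lra].
Qed.

Lemma is_derive_square a x : Rbar_lt (x ^ 2) (CV_radius a) ->
  is_derive (fun t => PSeries a (t ^ 2)) x (2 * x * PSeries (PS_derive a) (x ^ 2)).
Proof.
  intros Hx. apply (is_derive_comp (PSeries a) (fun t => t ^ 2)).
  - apply is_derive_PSeries. rewrite Rabs_pos_eq by apply pow2_ge_0. exact Hx.
  - auto_derive; auto. ring.
Qed.

Let g := fun x => (nu + 1) * (1 - q (x ^ 2)) / x.

Lemma struve_derive x : 0 < x < sqrt H -> is_derive (struve nu) x (struve nu x * g x).
Proof.
  intros Hx. pose proof (square_range x Hx) as Hx2. pose proof nu_range as Hn.
  apply is_derive_ext with (fun t => c * Rpower (t / 2) (nu + 1) * PSeries (struve_coef nu) (t ^ 2)).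
  { intros t. symmetry. apply struve_series. }
  assert (dR : is_derive (fun t => c * Rpower (t / 2) (nu + 1)) x (c * Rpower (x / 2) (nu + 1) * ((nu + 1) / x))).
  { unfold Rpower. auto_derive; [lra|]. change (x * / 2) with (x / 2). field. lra. }
  assert (dS := is_derive_square (struve_coef nu) x ltac:(rewrite (ld_entire _ _ _ D); exact I)).
  evar_last; [apply (is_derive_mult _ _ x _ _ dR dS); intros; apply Rmult_comm|].
  change (c * Rpower (x / 2) (nu + 1) * ((nu + 1) / x) * PSeries (struve_coef nu) (x ^ 2)
    + c * Rpower (x / 2) (nu + 1) * (2 * x * PSeries (PS_derive (struve_coef nu)) (x ^ 2)) = struve nu x * g x).
  replace (PSeries (PS_derive (struve_coef nu)) (x ^ 2)) with (PSeries (struve_coef nu) (x ^ 2) * (- PSeries p (x ^ 2))).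
  2:{ rewrite (PSeries_ext _ _ _ (ld_ode _ _ _ D)). rewrite PSeries_mult.
      - f_equal. symmetry. apply PSeries_opp.
      - rewrite (ld_entire _ _ _ D). exact I.
      - rewrite Rabs_pos_eq by lra. change (fun k => - p k) with (PS_opp p). rewrite CV_radius_opp.
        apply (inside_p _ _ _ D). lra. }
  rewrite struve_series. unfold g, q. rewrite (starlike_defect_value_R _ _ _ _ D) by lra.
  unfold kappa. field. lra.
Qed.

Lemma struve_derive_zero_iff x : 0 < x < sqrt H -> (Derive (struve nu) x = 0 <-> q (x ^ 2) = 1).
Proof.
  intros Hx. rewrite (is_derive_unique _ _ _ (struve_derive x Hx)).
  pose proof (struve_pos x Hx). pose proof nu_range. unfold g. split; intros E.
  - apply Rmult_integral in E. destruct E as [E|E]; [lra|].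
    apply (f_equal (fun t => t * x)) in E. unfold Rdiv in E.
    rewrite Rmult_assoc, Rinv_l in E by lra. nra.
  - rewrite E. field. lra.
Qed.

(** With g the logarithmic derivative of the Struve function, the left side is
    kappa x g + x g'/g, where kappa x g = 1 - q and
    x g'/g = -1 - 2 w q'/(1 - q) at w = x^2. *)
Lemma struve_quotients x : 0 < x < sqrt H -> q (x ^ 2) <> 1 ->
  x * Derive_n (struve nu) 2 x / Derive (struve nu) x
  + (1 / (nu + 1) - 1) * (x * Derive (struve nu) x / struve nu x)
  = - convexity_defect p kappa (x ^ 2).
Proof.
  intros Hx Hq. pose proof (square_range x Hx) as Hx2. pose proof nu_range as Hn.
  pose proof (struve_pos x Hx) as Sx.
  assert (D1 : forall t, 0 < t < sqrt H -> Derive (struve nu) t = struve nu t * g t).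
  { intros t Ht. apply is_derive_unique, struve_derive, Ht. }
  assert (dg : is_derive g x ((nu + 1) * (- (1 - q (x ^ 2)) / x ^ 2 - 2 * q' (x ^ 2)))).
  { assert (dq : is_derive (fun t => q (t ^ 2)) x (2 * x * q' (x ^ 2))).
    { apply is_derive_square. apply (inside_defect _ _ _ _ D). lra. }
    unfold g. 
    apply is_derive_ext with (fun t => (1 - q (t ^ 2)) * ((nu + 1) / t)).
    { intros t. unfold Rdiv. simpl. ring. }
    assert (d1 : is_derive (fun t => 1 - q (t ^ 2)) x (- (2 * x * q' (x ^ 2)))).
    { evar_last; [apply (is_derive_minus (fun _ => 1) _ x 0 _ (is_derive_const _ _) dq)|].
      unfold minus, plus, opp; simpl. ring. }
    assert (d2 : is_derive (fun t => (nu + 1) / t) x (- (nu + 1) / x ^ 2)).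
    { auto_derive; [lra|]. field. lra. }
    evar_last; [apply (is_derive_mult _ _ x _ _ d1 d2); intros; apply Rmult_comm|].
    match goal with |- _ = ?r =>
      change (- (2 * x * q' (x ^ 2)) * ((nu + 1) / x) + (1 - q (x ^ 2)) * (- (nu + 1) / x ^ 2) = r) end.
    field. lra. }
  assert (D2 : Derive_n (struve nu) 2 x = struve nu x * g x * g x
     + struve nu x * ((nu + 1) * (- (1 - q (x ^ 2)) / x ^ 2 - 2 * q' (x ^ 2)))).
  { change (Derive_n (struve nu) 2 x) with (Derive (Derive (struve nu)) x).
    apply is_derive_unique. apply is_derive_ext_loc with (fun t => struve nu t * g t).
    - assert (Pd : 0 < Rmin x (sqrt H - x)) by (apply Rmin_glb_lt; lra).
      exists (mkposreal _ Pd). intros t Ht. symmetry. apply D1.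
      unfold ball in Ht; simpl in Ht. unfold AbsRing_ball, abs, minus, plus, opp in Ht; simpl in Ht.
      pose proof (Rmin_l x (sqrt H - x)). pose proof (Rmin_r x (sqrt H - x)).
      apply Rabs_def2 in Ht. lra.
    - evar_last; [apply (is_derive_mult _ _ x _ _ (struve_derive x Hx) dg); intros; apply Rmult_comm|].
      unfold plus, mult; simpl; unfold mult; simpl. ring. }
  rewrite D2, D1 by exact Hx. unfold convexity_defect. fold q q'. unfold g.
  field. repeat split; lra.
Qed.

End Struve.

(** * Radii of convexity *)

Section Radii.

Context (nu : R) (hnu : Rabs nu <= 1 / 2) (p : nat -> R) (H : R)
  (D : log_derivative_data (struve_coef nu) p H).

Let kappa := 1 / (nu + 1).
Let kpos : 0 < kappa := kappa_pos nu hnu.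

(** The series defining u, regrouped in powers of z^2. *)
Lemma u_local e d : (forall w, Cmod w < d -> Cpower (real_cps (struve_coef nu) w) kappa = real_cps e w) ->
  forall z, Cmod z < sqrt d -> u nu z = (z * real_cps e (z ^ 2))%C.
Proof.
  intros He z Hz. unfold u. rewrite <- He by (apply Cmod_square_lt, Hz).
  do 2 f_equal. apply Cseries_ext. intros n. unfold struve_coef.
  replace (- (z ^ 2 / RtoC 4))%C with (RtoC (- / 4) * z ^ 2)%C.
  - rewrite Cpow_mult_l, RtoC_mult, RtoC_pow. ring.
  - rewrite RtoC_opp, RtoC_inv by lra. unfold Cdiv. ring.
Qed.

Lemma u_taylor_sum : exists e,
  e O = 1 /\ (forall n, PS_derive e n = PS_mult e (fun k => - kappa * p k) n) /\
  (forall z, Cmod z < sqrt H -> taylor_sum (u nu) z = (z * real_cps e (z ^ 2))%C) /\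
  Rbar_le (sqrt H) (taylor_radius (u nu)).
Proof.
  destruct (exp_series_exists (fun k => - kappa * p k)) as (e & e0 & e_ode).
  destruct (power_principal _ _ _ kappa D e e0 e_ode) as (d & Hd & Hpow).
  pose proof (odd_spread_radius _ _ _ kappa D e e_ode) as rad.
  assert (T : forall n, taylor (u nu) n = RtoC (odd_spread e n)).
  { apply taylor_local with (sqrt d).
    - apply sqrt_lt_R0. lra.
    - eapply Rbar_le_trans; [|exact rad]. apply sqrt_le_1; lra.
    - intros z Hz. rewrite (u_local e d Hpow z Hz). symmetry.
      apply (odd_spread_value _ _ _ kappa D e e_ode).
      eapply Rlt_le_trans; [exact Hz|]. apply sqrt_le_1; lra. }
  exists e. split; [exact e0|]. split; [exact e_ode|]. split.
  - intros z Hz. rewrite <- (odd_spread_value _ _ _ kappa D e e_ode z Hz).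
    apply Cseries_ext. intros n. rewrite T. reflexivity.
  - pose proof (ld_pos _ _ _ D) as HH.
    apply Rbar_le_approx; [apply sqrt_lt_R0; exact HH|]. intros x Hx.
    apply CV_radius_ge_disk.
    apply ex_series_ext with (fun n => Rabs (odd_spread e n * x ^ n)).
    + intros n. rewrite T, Cmod_R, !Rabs_mult, Rabs_Rabsolu. reflexivity.
    + apply CV_disk_inside. rewrite Rabs_pos_eq by lra.
      eapply Rbar_lt_le_trans; [|exact rad]. simpl. lra.
Qed.

Context (w1 : R) (Hw1 : 0 < w1 < H) (q1 : PSeries (starlike_defect p kappa) w1 = 1).

Let Q := convexity_defect p kappa.

Lemma u_second_quotient z : Cmod z < sqrt w1 ->
  C_derive (taylor_sum (u nu)) z <> 0%C /\
  zf''_f' (taylor_sum (u nu)) z = (- complex_defect p kappa (z ^ 2))%C.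
Proof.
  destruct u_taylor_sum as (e & e0 & e_ode & val & _).
  apply (odd_series_second_quotient _ _ _ _ D kpos e e0 e_ode w1 Hw1 q1 _ z val).
Qed.

(** At z = r the defining inequality is an equality, so no larger radius is
    admissible; for |z| < r it follows from |z f''/f'| <= Q(|z|^2) < Q(r^2). *)
Lemma uniform_convexity_radius_value alpha beta r :
  0 <= alpha < 1 -> 0 <= beta -> 0 < r < sqrt w1 -> Q (r ^ 2) = (1 - alpha) / (1 + beta) ->
  uniform_convexity_radius beta alpha (u nu) = Finite r.
Proof.
  intros Ha Hb Hr HQ. unfold uniform_convexity_radius. apply is_lub_Rbar_unique. split.
  - intros s (s0 & srad & Hs). simpl. destruct (Rle_lt_dec s r) as [h|h]; [exact h|exfalso].
    specialize (Hs (RtoC r)). rewrite Cmod_R, Rabs_pos_eq in Hs by lra.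
    destruct (Hs h) as [_ Hre]. clear Hs.
    (* The point z = r, which lies in the open disc of radius s, violates the
       strict inequality. *)
    destruct (u_second_quotient (RtoC r)) as [_ E]; [rewrite Cmod_R, Rabs_pos_eq by lra; lra|].
    assert (r2 : 0 <= r ^ 2 < w1) by (split; [nra|rewrite <- (sqrt_sqrt w1) by lra; nra]).
    rewrite E, <- RtoC_pow, (complex_defect_R _ _ _ _ D kpos w1 Hw1 q1 _ r2) in Hre.
    fold Q in Hre. rewrite Cmod_opp, Cmod_R in Hre.
    assert (Qpos : 0 < Q (r ^ 2)) by (rewrite HQ; apply Rdiv_lt_0_compat; lra).
    rewrite Rabs_pos_eq in Hre by lra. rewrite <- RtoC_opp, <- RtoC_plus, re_RtoC in Hre.
    assert ((1 + beta) * Q (r ^ 2) = 1 - alpha) by (rewrite HQ; field; lra). lra.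
  - intros l Hl. apply Hl. split; [lra|]. split.
    + destruct u_taylor_sum as (_ & _ & _ & _ & rad).
      eapply Rbar_lt_le_trans; [|exact rad].
      eapply Rlt_trans; [apply Hr|]. apply sqrt_lt_1; lra.
    + intros z Hz. destruct (u_second_quotient z ltac:(lra)) as [N E]. split; [exact N|].
      rewrite E. 
      assert (z2 : Cmod (z ^ 2)%C < w1) by (apply Cmod_square_lt; lra).
      pose proof (complex_defect_bound _ _ _ _ D kpos w1 Hw1 q1 _ z2) as B.
      rewrite Cmod_pow in B. fold Q in B. pose proof (Cmod_ge_0 z) as z0.
      assert (r2 : r ^ 2 < w1) by (rewrite <- (sqrt_sqrt w1) by lra; nra).
      assert (L : Q (Cmod z ^ 2) < Q (r ^ 2)).
      { apply (convexity_defect_incr _ _ _ _ D kpos w1 Hw1 q1); [nra|exact r2]. }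
      rewrite re_plus, re_RtoC, Cmod_opp.
      set (X := complex_defect p kappa (z ^ 2)) in *.
      assert (RX : - Cmod X <= Re (- X)%C).
      { pose proof (re_le_Cmod (- X)%C) as P. rewrite Cmod_opp in P. apply Rabs_le_between in P. lra. }
      assert ((1 + beta) * Q (r ^ 2) = 1 - alpha) by (rewrite HQ; field; lra).
      assert ((1 + beta) * Cmod X < (1 + beta) * Q (r ^ 2)) by (apply Rmult_lt_compat_l; lra).
      lra.
Qed.

Lemma convexity_radius_uniform (f : C -> C) : convexity_radius f = uniform_convexity_radius 0 0 f.
Proof.
  unfold convexity_radius, uniform_convexity_radius. apply Lub_Rbar_eqset.
  intros r. split; intros (r0 & rr & Hz); (split; [exact r0|]); (split; [exact rr|]); intros z Hlt;
    specialize (Hz z Hlt); rewrite Rmult_0_l, Rplus_0_l in *; exact Hz.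
Qed.

(** Below sqrt w1 neither the Struve function nor its derivative vanishes, so
    the two nonvanishing conditions in the equation hold there. *)
Lemma uc_equation_iff alpha beta r : 0 <= beta -> 0 < r < sqrt w1 ->
  (uc_equation nu alpha beta r <-> Q (r ^ 2) = (1 - alpha) / (1 + beta)).
Proof.
  intros Hb Hr.
  assert (Hr' : 0 < r < sqrt H) by (split; [lra|eapply Rlt_trans; [apply Hr|apply sqrt_lt_1; lra]]).
  assert (r2 : 0 <= r ^ 2 < w1) by (split; [nra|rewrite <- (sqrt_sqrt w1) by lra; nra]).
  pose proof (starlike_defect_range _ _ _ _ D kpos w1 Hw1 q1 _ r2) as q_lt.
  unfold uc_equation. rewrite (struve_quotients nu hnu p H D r Hr') by (fold kappa; lra).
  fold kappa Q. split.
  - intros (_ & _ & E). apply Rmult_eq_reg_r with (1 + beta); [|lra].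
    unfold Rdiv. rewrite Rmult_assoc, Rinv_l by lra. lra.
  - intros E. split; [|split].
    + apply Rgt_not_eq, (struve_pos nu hnu p H D r Hr').
    + intros Z. apply (struve_derive_zero_iff nu hnu p H D r Hr') in Z. fold kappa in Z. lra.
    + rewrite E. field. lra.
Qed.

Lemma defect_root T : 0 < T -> exists r, 0 < r < sqrt w1 /\ Q (r ^ 2) = T.
Proof.
  intros HT. destruct (convexity_defect_surjective _ _ _ _ D kpos w1 Hw1 q1 T HT) as [x [Hx E]].
  exists (sqrt x). split; [split; [apply sqrt_lt_R0; lra|apply sqrt_lt_1; lra]|].
  rewrite pow2_sqrt by lra. exact E.
Qed.

Lemma defect_root_mono r s : 0 < r < sqrt w1 -> 0 < s < sqrt w1 -> Q (r ^ 2) <= Q (s ^ 2) -> r <= s.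
Proof.
  intros Hr Hs HQ. destruct (Rle_lt_dec r s) as [h|h]; [exact h|exfalso].
  assert (r ^ 2 < w1) by (rewrite <- (sqrt_sqrt w1) by lra; nra).
  assert (Q (s ^ 2) < Q (r ^ 2)); [|lra].
  apply (convexity_defect_incr _ _ _ _ D kpos w1 Hw1 q1); [nra|assumption].
Qed.

Lemma uc_smallest_root alpha beta r : 0 <= beta -> 0 < r < sqrt w1 ->
  Q (r ^ 2) = (1 - alpha) / (1 + beta) -> is_smallest_positive (uc_equation nu alpha beta) r.
Proof.
  intros Hb Hr HQ. split; [lra|]. split; [apply uc_equation_iff; assumption|].
  intros s s0 Hs. destruct (Rlt_le_dec s (sqrt w1)) as [h|h]; [|lra].
  apply uc_equation_iff in Hs; [|assumption|lra]. apply defect_root_mono; lra.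
Qed.

Lemma struve_first_zero : is_smallest_positive (fun x => struve nu x = 0) (sqrt H).
Proof.
  pose proof (ld_pos _ _ _ D) as HH.
  split; [apply sqrt_lt_R0; exact HH|]. split.
  - apply struve_zero_iff; [exact hnu|]. rewrite pow2_sqrt by lra. apply (ld_zero _ _ _ D).
  - intros s s0 Hs. destruct (Rle_lt_dec (sqrt H) s) as [h|h]; [exact h|exfalso].
    pose proof (struve_pos nu hnu p H D s ltac:(lra)). lra.
Qed.

Lemma struve_derivative_first_zero : is_smallest_positive (fun x => Derive (struve nu) x = 0) (sqrt w1).
Proof.
  assert (sqrt w1 < sqrt H) by (apply sqrt_lt_1; lra).
  assert (0 < sqrt w1) by (apply sqrt_lt_R0; lra).
  split; [assumption|]. split.
  - apply (struve_derive_zero_iff nu hnu p H D); [lra|]. fold kappa. rewrite pow2_sqrt by lra. exact q1.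
  - intros s s0 Hs. destruct (Rle_lt_dec (sqrt w1) s) as [h|h]; [exact h|exfalso].
    apply (struve_derive_zero_iff nu hnu p H D) in Hs; [|lra]. fold kappa in Hs.
    assert (r2 : 0 <= s ^ 2 < w1) by (split; [nra|rewrite <- (sqrt_sqrt w1) by lra; nra]).
    pose proof (starlike_defect_range _ _ _ _ D kpos w1 Hw1 q1 _ r2). lra.
Qed.

End Radii.

Theorem theorem2p4 (nu alpha beta : R)
  (hnu : Rabs nu <= 1 / 2) (halpha : 0 <= alpha < 1) (hbeta : 0 <= beta) :
  (exists r : R,
     is_smallest_positive (uc_equation nu alpha beta) r /\
     uniform_convexity_radius beta alpha (u nu) = Finite r) /\
  (exists h h' : R,
     is_smallest_positive (fun x => struve nu x = 0) h /\
     is_smallest_positive (fun x => Derive (struve nu) x = 0) h' /\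
     Rbar_le (uniform_convexity_radius beta alpha (u nu))
             (convexity_radius (u nu)) /\
     (alpha <> 0 \/ beta <> 0 ->
        Rbar_lt (uniform_convexity_radius beta alpha (u nu))
                (convexity_radius (u nu))) /\
     Rbar_lt (convexity_radius (u nu)) (Finite h') /\
     h' < h).
Proof.
  destruct (struve_log_derivative_data nu hnu) as (p & H & D).
  destruct (starlike_defect_reaches_one _ _ _ _ D (kappa_pos nu hnu)) as (w1 & Hw1 & q1).
  set (T := (1 - alpha) / (1 + beta)).
  assert (T1 : 0 < T <= 1).
  { unfold T. split; [apply Rdiv_lt_0_compat; lra|].
    apply Rmult_le_reg_r with (1 + beta); [lra|]. unfold Rdiv. rewrite Rmult_assoc, Rinv_l by lra. lra. }
  destruct (defect_root nu hnu p H D w1 Hw1 q1 T ltac:(lra)) as (r & Hr & Er).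
  destruct (defect_root nu hnu p H D w1 Hw1 q1 1 ltac:(lra)) as (rc & Hrc & Erc).
  assert (Vr : uniform_convexity_radius beta alpha (u nu) = Finite r).
  { apply (uniform_convexity_radius_value nu hnu p H D w1 Hw1 q1); assumption. }
  assert (Vc : convexity_radius (u nu) = Finite rc).
  { rewrite convexity_radius_uniform.
    apply (uniform_convexity_radius_value nu hnu p H D w1 Hw1 q1); lra. }
  assert (le : r <= rc) by (apply (defect_root_mono nu hnu p H D w1 Hw1 q1); lra).
  split.
  - exists r. split; [|exact Vr]. apply (uc_smallest_root nu hnu p H D w1 Hw1 q1); assumption.
  - exists (sqrt H), (sqrt w1). rewrite Vr, Vc.
    split; [apply (struve_first_zero nu hnu p H D)|].
    split; [apply (struve_derivative_first_zero nu hnu p H D w1 Hw1 q1)|].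
    split; [exact le|]. split; [|split; [apply Hrc|apply sqrt_lt_1; lra]].
    intros Hab. destruct le as [lt|eq]; [exact lt|exfalso].
    assert (T * (1 + beta) = 1 - alpha) by (unfold T; field; lra).
    assert (T = 1) by congruence. nra.
Qed.
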